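(* Let $\varphi$ be an odd Schwartz function on $\mathbb{R}$, and let $\psi=\widehat{\varphi}$ be the Fourier transform of $\varphi$. For each odd integer $k\geq 3$ we have $$\varphi'(0)+\sum_{n=1}^{\infty}\frac{r_k(n)}{\sqrt{n}}\,\varphi(\sqrt{n}) = i\,\alpha_k\,\psi^{(k-2)}(0)+i\sum_{n=1}^{\infty}\frac{r_k(n)}{n^{(k-2)/2}}\Big[\sum_{j=0}^{(k-3)/2}\beta_{j,k}\,n^{j/2}\,\psi^{(j)}(\sqrt{n})\Big],$$ where $$\alpha_k=\frac{(-1)^{(k-3)/2}}{(k-2)!!}\Big(\frac{1}{2\pi}\Big)^{(k-3)/2},\qquad \beta_{j,k}=\frac{(-1)^j\,(k-j-3)!}{j!\,(k-2j-3)!!}\Big(\frac{1}{2\pi}\Big)^{(k-3)/2}\quad (0\leq j\leq (k-3)/2).$$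
   Context: The Fourier transform on $\mathbb{R}$ is normalized as $\widehat{f}(t)=\int_{\mathbb{R}} f(x)e^{-2\pi i t x}\,dx$. Here $r_k(n)=\#\{m\in\mathbb{Z}^k: |m|^2=n\}$ is the number of representations of $n$ as a sum of $k$ squares of integers (order and signs counted), $|\cdot|$ being the Euclidean norm. The double factorial is $n!!=n(n-2)(n-4)\cdots$ (ending in $1$ or $2$), with $0!!=1$. Schwartz functions are complex-valued. *)

(* Defs.v *)
From HB Require Import structures.
From mathcomp Require Import all_boot all_order all_algebra.
From mathcomp Require Import finmap complex.
From mathcomp Require Import all_classical all_reals all_analysis.

Set Implicit Arguments.
Unset Strict Implicit.
Unset Printing Implicit Defensive.

Import Order.TTheory GRing.Theory Num.Theory.
Import numFieldNormedType.Exports.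

Local Open Scope classical_set_scope.
Local Open Scope ring_scope.
Local Open Scope complex_scope.

Definition sqsum_reps (k n : nat) : set 'rV[int]_k :=
  [set m | \sum_(i < k) m ord0 i ^+ 2 = n%:Z].
Arguments sqsum_reps : clear implicits.

(* [r_k(n)]; [fset_set] is empty on infinite sets, whence [finite_sqsum_reps]. *)
Definition r_ (k n : nat) : nat := #|` fset_set (sqsum_reps k n)|.

Lemma finite_sqsum_reps (k n : nat) : finite_set (sqsum_reps k n).
Proof.
pose f (s : {ffun 'I_k -> 'I_(n.*2.+1)}) : 'rV[int]_k :=
  \row_i ((s i : nat)%:Z - n%:Z).
apply: (@sub_finite_set _ _ (f @` [set: _])); last exact: finite_image.
move=> m /= mn.
have le_mn i : (`|m ord0 i| <= n)%N.
  have le2 : m ord0 i ^+ 2 <= n%:Z.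
    by rewrite -mn (bigD1 i)//= lerDl sumr_ge0// => j _; exact: sqr_ge0.
  have : (`|m ord0 i|%N ^ 2 <= n)%N.
    by rewrite -lez_nat -[X in X <= _]natz natrX natz abszE real_normK ?num_real.
  by apply: leq_trans; rewrite -mulnn; case: `|m ord0 i|%N => // p; rewrite leq_pmulr.
have ge0 i : 0 <= m ord0 i + n%:Z.
  by rewrite -lerBlDr sub0r lerNl (le_trans (ler_norm _))// normrN -abszE lez_nat.
exists [ffun i => inord `|(m ord0 i + n%:Z)%R|%N] => //.
apply/rowP => i; rewrite mxE ffunE inordK.
  by rewrite gez0_abs// addrK.
rewrite ltnS -lez_nat gez0_abs// -addnn PoszD lerD2r.
by rewrite (le_trans (ler_norm _))// -abszE lez_nat.
Qed.

(* The double factorial [n!!]. *)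
Fixpoint dfact (n : nat) : nat :=
  if n is p.+2 then (n * dfact p)%N else 1%N.

(* [R[i]] is a normed module over itself but not over [R], so derivatives and
   integrals of functions [R -> R[i]] are taken componentwise. *)
Definition cderiven (R : realType) (n : nat) (f : R -> R[i]) (x : R) : R[i] :=
  derive1n n (fun y => complex.Re (f y)) x +i* derive1n n (fun y => complex.Im (f y)) x.

Definition schwartz (R : realType) (f : R -> R[i]) : Prop :=
  (forall (n : nat) (x : R),
     derivable (derive1n n (fun y => complex.Re (f y))) x 1 /\
     derivable (derive1n n (fun y => complex.Im (f y))) x 1) /\
  (forall m n : nat, exists C : R, forall x : R,
     `|x| ^+ m * Normc.normc (cderiven n f x) <= C).

Definition expi (R : realType) (t : R) : R[i] := cos t +i* sin t.

Definition fourier (R : realType) (f : R -> R[i]) (t : R) : R[i] :=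
  let g x := f x * expi (- (2 * pi * t * x)) in
  (\int[lebesgue_measure]_x complex.Re (g x)) +i* (\int[lebesgue_measure]_x complex.Im (g x)).

(* Convergence is for the norm topology of [R[i]], which the library puts on
   the alias [R[i]^o]. *)
Definition has_sum_from1 (R : realType) (u : nat -> R[i]) (S : R[i]) : Prop :=
  (fun N => \sum_(1 <= n < N) u n : R[i]^o) @ \oo --> (S : R[i]^o).

(* In [alpha] and [beta] the natural subtractions and the halving are exact for
   [k] odd, [3 <= k] and [j <= (k - 3) / 2]. *)
Definition alpha (R : realType) (k : nat) : R :=
  (-1) ^+ ((k - 3) %/ 2) / (dfact (k - 2))%:R * (1 / (2 * pi)) ^+ ((k - 3) %/ 2).

Definition beta (R : realType) (j k : nat) : R :=
  (-1) ^+ j * (k - j - 3)`!%:R / (j`!%:R * (dfact (k - 2 * j - 3))%:R)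
  * (1 / (2 * pi)) ^+ ((k - 3) %/ 2).

(* Main.v *)
Require Import Defs.
From HB Require Import structures.
From mathcomp Require Import all_boot all_order all_algebra.
From mathcomp Require Import finmap complex.
From mathcomp Require Import all_classical all_reals all_analysis.
From mathcomp Require Import measurable_realfun lebesgue_integral_under.
From mathcomp Require Import ring lra zify.
Import Order.TTheory GRing.Theory Num.Theory.
Import numFieldNormedType.Exports.
Set Implicit Arguments.
Unset Strict Implicit.
Unset Printing Implicit Defensive.
Local Open Scope classical_set_scope.
Local Open Scope ring_scope.

(** Write k = 2m + 3.  The formula is Poisson summation on Z^k for a radial
    function, made explicit by expressing a Fourier transform in dimension k
    through one in dimension one.

    Reduction to the real line.  If phi = u + i v is odd, then its cosine
    integrals vanish and i psi = chi_u + i chi_v, where chi_u t is the integral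
    of u x * sin (2 pi t x).  So it is enough to treat a real odd Schwartz
    function u.  Put F s = u (sqrt s) / sqrt s and F 0 = u' 0, that is,
    u x = x * F (x ^ 2).  The left side becomes the sum of F (|v| ^ 2) over the
    lattice points v of Z^k, the origin giving u' 0.

    Poisson summation.  All operators act on functions of s >= 0, where
    F s stands for the value at squared radius s.  Let A_b F s be the integral
    of F (s + x ^ 2) * cos (2 pi b x) over the line.  In one coordinate, the sum
    of F (s + b ^ 2) over |b| <= N is compared with the integral of F (s + x ^ 2)
    against the Fejer kernel, which is the sum of (1 - |b| / N) * A_b F s over
    |b| <= N.  The difference is O (N ^ (- 1 / 2)) with decay in s
    ([fejer_op_lattice_op]).  Both operators respect the decay, so the estimate
    may be iterated over the k coordinates ([iter_fejer_op_lattice_op]).  The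
    only regularity used is that F is Lipschitz with rapidly decreasing
    constants ([rapid]), and this holds for the F above
    ([sqrt_quotient_rapid]).

    Radial form.  Lebesgue measure on the plane is invariant under rotations,
    whence A_a A_b = A_r A_0 with r = sqrt (a ^ 2 + b ^ 2)
    ([line_cos_rotate]).  Hence the product of the A_(v_i) over the k
    coordinates is A_|v| A_0 ^ (k - 1), which depends on |v| only, and both
    sides become sums over n of r_k n times a function of n
    ([lattice_summation]).

    Descent to dimension one.  Let E_i r = A_r (A_0 ^ (2 i) F) 0, the Fourier
    transform in dimension 2 i + 1 ([radial_ft]).  In polar coordinates
    A_0 ^ 2 F is pi times the integral of |x| * F (s + x ^ 2), whose derivative
    in s is - F; integrating by parts, r * E_1 r = chi_u r and
    E_i' r = - 2 pi r * E_(i + 1) r.  An induction on m turns this into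
    r ^ (2 m + 1) * E_(m + 1) r = the sum over j <= m of
    beta_j * r ^ j * chi_u^(j) r ([radial_ft_expansion]), and the Taylor
    expansion of r * E_1 r at 0 gives the value of E_(m + 1) at the origin, which
    is the term in alpha ([radial_ft_taylor]). *)

(** * Integrals of functions dominated by 1 / (1 + x ^ 2), and rotations of the plane *)

(** The common majorant of the integrands: its integral is pi, and it splits
    off when a coordinate is added to the squared radius ([wgtX_sqr]). *)
Definition wgt_sq {R : realType} (x : R) : R := (1 + x ^+ 2)^-1.

Section Integration.
Context {R : realType}.
Implicit Types (f g : R -> R) (C x : R).
Notation mu := (@lebesgue_measure R).
Notation mfun1 f := (@measurable_fun _ _ (measurableTypeR R) R setT f).

Lemma wgt_sq_gt0 x : 0 < wgt_sq x :> R.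
Proof. by rewrite invr_gt0 ltr_wpDr ?sqr_ge0. Qed.

Lemma wgt_sq_ge0 x : 0 <= wgt_sq x :> R.
Proof. exact/ltW/wgt_sq_gt0. Qed.

Lemma integral_wgt_sq : (\int[@lebesgue_measure R]_x (wgt_sq x)%:E = (pi : R)%:E)%E.
Proof.
rewrite ge0_symfun_integralT.
- rewrite -set_itvcy integral0y_oneDsqr -EFinM.
  by congr EFin; rewrite mulrCA divff ?mulr1.
- by move=> x; exact/wgt_sq_ge0.
- exact: continuous_oneDsqrV.
- by move=> x; rewrite fctE /= /wgt_sq sqrrN.
Qed.

Lemma measurable_wgt_sq : mfun1 (fun x : R => wgt_sq x).
Proof. by apply: continuous_measurable_fun; exact: continuous_oneDsqrV. Qed.

Lemma integrable_wgt_sq : mu.-integrable setT (EFin \o wgt_sq).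
Proof.
apply/integrableP; split; first by apply/measurable_EFinP; exact: measurable_wgt_sq.
under eq_integral do rewrite /= ger0_norm ?wgt_sq_ge0//.
by rewrite integral_wgt_sq ltry.
Qed.

Lemma Rintegral_wgt_sq : \int[mu]_x (wgt_sq x) = pi.
Proof. by rewrite /Rintegral integral_wgt_sq. Qed.

Lemma integrable_dec f C : mfun1 f ->
  (forall x, `|f x| <= C * wgt_sq x) ->
  mu.-integrable setT (EFin \o f).
Proof.
move=> mf fC.
apply: (le_integrable measurableT _ _ (integrableZl measurableT C integrable_wgt_sq)).
- exact/measurable_EFinP.
- by move=> x _ /=; rewrite lee_fin (le_trans (fC x))// ler_norm.
Qed.

Lemma Rintegral_dec f C : mfun1 f ->
  (forall x, `|f x| <= C * wgt_sq x) ->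
  `|\int[mu]_x f x| <= C * pi.
Proof.
move=> mf fC; have If := integrable_dec mf fC.
apply: (le_trans (le_normr_Rintegral measurableT If)).
rewrite -Rintegral_wgt_sq -RintegralZl//; last exact: integrable_wgt_sq.
apply: le_Rintegral => //.
- by have := integrable_norm If.
- by have := integrableZl measurableT C integrable_wgt_sq.
Qed.

Lemma measurable_affine (c d : R) : mfun1 (fun x => c * x + d).
Proof. by apply: measurable_funD => //; apply: measurable_funM. Qed.

(** Lebesgue measure is the only measure with the right values on intervals,
    so the change of variables is checked there. *)
Lemma lebesgue_measure_affine (c d : R) (A : set R) : c != 0 -> measurable A ->
  (mu A = `|c|%:E * pushforward mu (fun x => (c * x + d)%R : measurableTypeR R) A)%E.
Proof.
move=> c0 mA.
pose h x : measurableTypeR R := c * x + d.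
have mh : @measurable_fun _ _ (measurableTypeR R) (measurableTypeR R) setT h.
  exact: measurable_affine.
move: A mA.
apply: (lebesgue_measure_unique (mu := mscale (NngNum (normr_ge0 c))
  (measure_function_pushforward__canonical__measure_function_Measure mu mh))).
move=> _ [[a b]] _ <- /=.
rewrite -[RHS]/(`|c|%:E * mu (h @^-1` `]a, b]))%E.
have [c_gt0|c_lt0] : 0 < c \/ c < 0 by case: (ltgtP c 0) c0; [right|left|].
  rewrite [X in (_ * mu X)%E](_ : _ = `](a - d) / c, (b - d) / c]%classic); last first.
    apply/seteqP; split=> x; rewrite /h /= !in_itv/=;
    by rewrite ltr_pdivrMr// ler_pdivlMr// ltrBlDr lerBrDr mulrC.
  rewrite !lebesgue_measure_itv/= !lte_fin ltr_pM2r ?invr_gt0// ltrD2r.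
  case: ifP => _; rewrite ?mule0// -!EFinB -EFinM gtr0_norm//; congr EFin.
  by field.
rewrite [X in (_ * mu X)%E](_ : _ = `[(b - d) / c, (a - d) / c[%classic); last first.
  apply/seteqP; split=> x; rewrite /h /= !in_itv/=;
  by rewrite ler_ndivrMr// ltr_ndivlMr// ltrBlDr lerBrDr mulrC andbC.
rewrite !lebesgue_measure_itv/= !lte_fin ltr_nM2r ?invr_lt0// ltrD2r.
case: ifP => _; rewrite ?mule0// -!EFinB -EFinM ltr0_norm//; congr EFin.
by field; rewrite lt_eqF.
Qed.

Lemma ge0_integral_affine (c d : R) (f : R -> \bar R) : c != 0 ->
  @measurable_fun _ _ (measurableTypeR R) _ setT f -> (forall x, 0 <= f x)%E ->
  (\int[mu]_x f x = `|c|%:E * \int[mu]_x f (c * x + d)%R)%E.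
Proof.
move=> c0 mf f0.
pose h x : measurableTypeR R := c * x + d.
have mh : @measurable_fun _ _ (measurableTypeR R) (measurableTypeR R) setT h.
  exact: measurable_affine.
pose pm := measure_function_pushforward__canonical__measure_function_Measure mu mh.
rewrite (eq_measure_integral (mscale (NngNum (normr_ge0 c)) pm)).
  rewrite ge0_integral_mscale//=; congr (_ * _)%E.
  by rewrite ge0_integral_pushforward.
by move=> A mA _; exact: lebesgue_measure_affine.
Qed.

Lemma integrable_affine (c d : R) f : c != 0 ->
  mu.-integrable setT (EFin \o f) ->
  mu.-integrable setT (EFin \o (fun x => f (c * x + d))).
Proof.
move=> c0 /integrableP[mf fy]; have mf' : mfun1 f by apply/measurable_EFinP.
have mh : mfun1 (fun x => f (c * x + d)).
  by apply: measurableT_comp mf' _; exact: measurable_affine.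
apply/integrableP; split; first exact/measurable_EFinP.
have mg : measurable_fun setT (fun x : measurableTypeR R => `|(f x)%:E|%E).
  exact: measurableT_comp.
move: fy; rewrite (ge0_integral_affine d c0 mg)//.
have c_gt0 : (0 < `|c|%:E)%E by rewrite lte_fin normr_gt0.
by rewrite -[X in (_ < X)%E](gt0_muley c_gt0) lte_pmul2l.
Qed.

Lemma Rintegral_affine (c d : R) f : c != 0 ->
  mu.-integrable setT (EFin \o f) ->
  \int[mu]_x f x = `|c| * \int[mu]_x f (c * x + d).
Proof.
move=> c0 If; have Ih := integrable_affine d c0 If.
have mf := measurable_int _ If.
have fin := integrable_fin_num measurableT Ih.
rewrite /Rintegral -[X in X * _]/(fine `|c|%:E) -fineM//; congr fine.
rewrite integralE [in RHS]integralE muleBr//; last first.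
  by apply/fin_num_adde_defl; rewrite fin_numN; exact: integrable_neg_fin_num.
congr (_ - _)%E.
- have mp := measurable_funepos mf.
  have p0 z : (0 <= (EFin \o f)^\+ z)%E by exact: funepos_ge0.
  rewrite (ge0_integral_affine d c0 mp p0); congr (_ * _)%E.
  by apply: eq_integral => z _; rewrite !funeposE.
- have mp := measurable_funeneg mf.
  have p0 z : (0 <= (EFin \o f)^\- z)%E by exact: funeneg_ge0.
  rewrite (ge0_integral_affine d c0 mp p0); congr (_ * _)%E.
  by apply: eq_integral => z _; rewrite !funenegE.
Qed.

Notation mu2 := (mu \x mu)%E.
Notation T2 := (measurableTypeR R * measurableTypeR R)%type.

Lemma ge0_shear1 (t : R) (f : T2 -> \bar R) : measurable_fun setT f ->
  (forall z, 0 <= f z)%E ->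
  (\int[mu2]_z f ((z.1 + t * z.2)%R, z.2) = \int[mu2]_z f z)%E.
Proof.
move=> mf f0.
have mg : measurable_fun setT (fun z : T2 => f ((z.1 + t * z.2 : R), z.2)).
  apply: measurableT_comp => //; apply: measurable_fun_pair => //=.
  by apply: measurable_funD => //; apply: measurable_funM.
rewrite fubini_tonelli2//= fubini_tonelli2//=.
apply: eq_integral => y _.
rewrite /fubini_G [RHS](ge0_integral_affine (t * y) (oner_neq0 R))//=.
  rewrite normr1 mul1e; apply: eq_integral => x _; by rewrite mul1r.
by apply: measurableT_comp => //; exact: measurable_pair2.
Qed.

Lemma ge0_shear2 (t : R) (f : T2 -> \bar R) : measurable_fun setT f ->
  (forall z, 0 <= f z)%E ->
  (\int[mu2]_z f (z.1, (z.2 + t * z.1)%R) = \int[mu2]_z f z)%E.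
Proof.
move=> mf f0.
have mg : measurable_fun setT (fun z : T2 => f (z.1, (z.2 + t * z.1 : R))).
  apply: measurableT_comp => //; apply: measurable_fun_pair => //=.
  by apply: measurable_funD => //; apply: measurable_funM.
rewrite fubini_tonelli1//= fubini_tonelli1//=.
apply: eq_integral => x _.
rewrite /fubini_F [RHS](ge0_integral_affine (t * x) (oner_neq0 R))//=.
  rewrite normr1 mul1e; apply: eq_integral => y _; by rewrite mul1r.
by apply: measurableT_comp => //; exact: measurable_pair1.
Qed.

Lemma shear1 (t : R) (f : T2 -> \bar R) : measurable_fun setT f ->
  (\int[mu2]_z f ((z.1 + t * z.2)%R, z.2) = \int[mu2]_z f z)%E.
Proof.
move=> mf; rewrite integralE [RHS]integralE; congr (_ - _)%E.
- have mp := measurable_funepos mf.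
  have p0 z : (0 <= f^\+ z)%E by exact: funepos_ge0.
  by rewrite -(ge0_shear1 t mp p0); apply: eq_integral => z _; rewrite !funeposE.
- have mp := measurable_funeneg mf.
  have p0 z : (0 <= f^\- z)%E by exact: funeneg_ge0.
  by rewrite -(ge0_shear1 t mp p0); apply: eq_integral => z _; rewrite !funenegE.
Qed.

Lemma shear2 (t : R) (f : T2 -> \bar R) : measurable_fun setT f ->
  (\int[mu2]_z f (z.1, (z.2 + t * z.1)%R) = \int[mu2]_z f z)%E.
Proof.
move=> mf; rewrite integralE [RHS]integralE; congr (_ - _)%E.
- have mp := measurable_funepos mf.
  have p0 z : (0 <= f^\+ z)%E by exact: funepos_ge0.
  by rewrite -(ge0_shear2 t mp p0); apply: eq_integral => z _; rewrite !funeposE.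
- have mp := measurable_funeneg mf.
  have p0 z : (0 <= f^\- z)%E by exact: funeneg_ge0.
  by rewrite -(ge0_shear2 t mp p0); apply: eq_integral => z _; rewrite !funenegE.
Qed.

Lemma measurable_shear1 (t : R) (f : T2 -> \bar R) : measurable_fun setT f ->
  measurable_fun setT (fun z : T2 => f ((z.1 + t * z.2 : R), z.2)).
Proof.
move=> mf.
  apply: measurableT_comp => //; apply: measurable_fun_pair => //=.
  by apply: measurable_funD => //; apply: measurable_funM.
Qed.

Lemma measurable_shear2 (t : R) (f : T2 -> \bar R) : measurable_fun setT f ->
  measurable_fun setT (fun z : T2 => f (z.1, (z.2 + t * z.1 : R))).
Proof.
move=> mf.
  apply: measurableT_comp => //; apply: measurable_fun_pair => //=.
  by apply: measurable_funD => //; apply: measurable_funM.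
Qed.

(** A rotation is a product of three shears, and a shear preserves the measure
    because each of its sections is a translation.  The hypothesis on 1 + c
    makes the slope t = - s / (1 + c) of the outer shears meaningful. *)
Lemma rotation (c s : R) (f : T2 -> \bar R) : measurable_fun setT f ->
  c ^+ 2 + s ^+ 2 = 1 -> 1 + c != 0 ->
  (\int[mu2]_z f ((c * z.1 - s * z.2)%R, (s * z.1 + c * z.2)%R) = \int[mu2]_z f z)%E.
Proof.
move=> mf cs c1; pose t := - s / (1 + c).
(* undo the shears one by one, starting from the unrotated integral *)
have mf1 := measurable_shear1 t mf.
have mf2 := measurable_shear2 s mf1.
rewrite -(shear1 t mf) -(shear2 s mf1) -(shear1 t mf2).
have tc : t * (1 + c) = - s by rewrite /t divfK.
have ts : t * s = c - 1.
  apply: (mulIf c1); rewrite mulrAC tc mulNr -expr2.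
  have -> : s ^+ 2 = 1 - c ^+ 2 by rewrite -cs; ring.
  by ring.
apply: eq_integral => -[x y] _ /=; congr (f (_, _)).
- transitivity (x + (t * s) * x + (2 + t * s) * (t * y)); last by rewrite /t; ring.
  by rewrite ts -[- (s * y)]mulNr -tc; ring.
- transitivity ((1 + t * s) * y + s * x); last by rewrite /t; ring.
  by rewrite ts; ring.
Qed.

(** One of the two factors of the majorant is at most its value at L outside
    the interval; the other one is integrated. *)
Lemma Rintegral_tail f C (L : R) : 0 <= L -> mfun1 f ->
  (forall x, `|f x| <= C * wgt_sq x ^+ 2) ->
  `|\int[mu]_x f x - \int[mu]_(x in `[- L, L]) f x| <= C * pi * wgt_sq L.
Proof.
move=> L0 mf fC.
have C0 : 0 <= C.
  have := le_trans (normr_ge0 _) (fC 0).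
  by rewrite pmulr_lge0// exprn_gt0// wgt_sq_gt0.
have w1 x : wgt_sq x <= 1 by rewrite /wgt_sq invf_le1 ?lerDl ?sqr_ge0// ltr_wpDr ?sqr_ge0.
have If : mu.-integrable setT (EFin \o f).
  apply: (@integrable_dec _ C) => // x; rewrite (le_trans (fC x))// ler_wpM2l//.
  by rewrite expr2 ler_piMl ?wgt_sq_ge0.
have mI : measurable (`[- L, L]%classic : set R) by [].
have -> : \int[mu]_x f x = \int[mu]_(x in `[- L, L]) f x + \int[mu]_(x in ~` `[- L, L]) f x.
  rewrite -Rintegral_setU//=.
  - by rewrite setUv.
  - exact: measurableC.
  - by rewrite setUv.
  - by apply/disj_setPCl.
rewrite addrAC subrr add0r Rintegral_mkcond.
apply: (le_trans (@Rintegral_dec _ (C * wgt_sq L) _ _)).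
- have := (@measurable_restrict _ _ (measurableTypeR R) R (~` `[- L, L]) setT f (measurableC
  mI) measurableT).1.
  by rewrite setTI; apply; apply: measurable_funTS.
- move=> x; rewrite patchE; case: ifPn => [|_]; last first.
    by rewrite normr0 !mulr_ge0 ?wgt_sq_ge0.
  rewrite inE /= in_itv /= => xL.
  rewrite (le_trans (fC x))// -mulrA ler_wpM2l// expr2 ler_wpM2r ?wgt_sq_ge0//.
  rewrite /wgt_sq lef_pV2 ?posrE ?ltr_wpDr ?sqr_ge0// lerD2l.
  rewrite -[x ^+ 2]real_normK ?num_real//.
  rewrite ler_sqr ?nnegrE// leNgt.
  by apply/negP => /ltW; rewrite ler_norml => /xL.
- by rewrite mulrAC.
Qed.

Lemma wgt_sq_le1 x : wgt_sq x <= 1.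
Proof. by rewrite /wgt_sq invf_le1 ?lerDl ?sqr_ge0// ltr_wpDr ?sqr_ge0. Qed.

(** The fundamental theorem on [- L, L] leaves boundary values that tend to 0
    with L; this is how boundary terms vanish in all integrations by parts. *)
Lemma Rintegral_derive_eq0 (f f' : R -> R) C :
  (forall x, is_derive x 1 f (f' x)) -> continuous f' ->
  (forall x, `|f x| <= C * wgt_sq x) -> (forall x, `|f' x| <= C * wgt_sq x ^+ 2) ->
  \int[mu]_x f' x = 0.
Proof.
move=> df cf' fC f'C.
have cf : continuous f.
  move=> x; apply: differentiable_continuous; apply/derivable1_diffP.
  exact: ex_derive.
have FTC (L : R) : 0 < L -> \int[mu]_(x in `[- L, L]) f' x = f L - f (- L).
  move=> L0; rewrite /Rintegral (@continuous_FTC2 _ f' f)//.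
  - by lra.
  - exact: continuous_subspaceT.
  - split.
    + by move=> x _; exact: ex_derive.
    + by apply: cvg_at_right_filter; exact: cf.
    + by apply: cvg_at_left_filter; exact: cf.
  - by move=> x _; rewrite derive1E; apply: derive_val.
have C0 : 0 <= C.
  by have := le_trans (normr_ge0 _) (fC 0); rewrite pmulr_lge0// wgt_sq_gt0.
have bound (L : R) : 0 < L -> `|\int[mu]_x f' x| <= C * (pi + 2) * wgt_sq L.
  move=> L0.
  have := Rintegral_tail (ltW L0) (continuous_measurable_fun cf') f'C.
  rewrite FTC// => h.
  rewrite -[X in `|X|](subrK (f L - f (- L))) (le_trans (ler_normD _ _))//.
  rewrite mulrDr mulrDl lerD// (le_trans (ler_normB _ _))//.
  have := fC (- L); have := fC L; rewrite /wgt_sq sqrrN; lra.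
apply/eqP; rewrite -normr_eq0 eq_le normr_ge0 andbT.
apply/ler_addgt0Pr => e e0; rewrite add0r.
(* large enough for C (pi + 2) / (1 + L ^ 2) to be below e *)
pose L := 1 + C * (pi + 2) / e.
have K0 : 0 <= C * (pi + 2) by rewrite mulr_ge0// addr_ge0// pi_ge0.
have L1 : 1 <= L by rewrite lerDl divr_ge0// ltW.
have L0 : 0 < L by rewrite (lt_le_trans _ L1).
apply: (le_trans (bound L L0)).
rewrite /wgt_sq ler_pdivrMr ?ltr_wpDr ?sqr_ge0//.
apply: (@le_trans _ _ (e * L)).
  rewrite /L; set K := C * _; rewrite (_ : e * (1 + K / e) = e + K) ?lerDr ?ltW//.
  by field; rewrite gt_eqF.
rewrite ler_pM2l//; nra.
Qed.

Lemma Rintegral_odd (f : R -> R) C : continuous f -> (forall x, f (- x) = - f x) ->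
  (forall x, `|f x| <= C * wgt_sq x) -> \int[mu]_x f x = 0.
Proof.
move=> cf fN fC.
have If := integrable_dec (continuous_measurable_fun cf) fC.
have N10 : -1 != 0 :> R by rewrite oppr_eq0 oner_eq0.
have := Rintegral_affine 0 N10 If.
rewrite (_ : (fun x => f (-1 * x + 0)) = (fun x => -1 * f x)); last first.
  by apply/funext => x /=; rewrite addr0 mulN1r fN mulN1r.
rewrite RintegralZl// normrN1 mul1r mulN1r; lra.
Qed.
End Integration.

(** * Functions of the squared radius, and their cosine integrals along a line *)

Definition wgt {R : realType} (s : R) : R := (1 + s)^-1.

(** The bound and the Lipschitz constant both decay like (1 + s) ^ (- M).
    This class replaces differentiability in s: unlike the latter it passes at
    once to integrals and sums over a further coordinate, and it bounds the
    error of a Riemann-type sum. *)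
Definition lip_decay {R : realType} (C : R) (M : nat) (F : R -> R) :=
  forall s t, 0 <= s -> s <= t ->
    `|F s| <= C * wgt s ^+ M /\ `|F t - F s| <= C * (t - s) * wgt s ^+ M.

Definition rapid {R : realType} (F : R -> R) := forall M, exists C, lip_decay C M F.

(** With F s the value at squared radius s, this is a Fourier transform in one
    of the coordinates, at frequency b. *)
Definition line_cos {R : realType} (b : R) (F : R -> R) (s : R) : R :=
  \int[@lebesgue_measure R]_x (F (s + x ^+ 2) * cos (2 * pi * b * x)).

(** The integral of F over [s, +oo), written as an integral over the line; it
    is where two integrations over a line lead ([line_cos0_polar]). *)
Definition line_abs {R : realType} (F : R -> R) (s : R) : R :=
  \int[@lebesgue_measure R]_x (`|x| * F (s + x ^+ 2)).

Section LD.
Context {R : realType}.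
Implicit Types (F : R -> R) (C s t x : R) (M : nat).
Notation mu := (@lebesgue_measure R).
Notation mfun1 f := (@measurable_fun _ _ (measurableTypeR R) R setT f).
Notation mu2 := (mu \x mu)%E.
Notation T2 := (measurableTypeR R * measurableTypeR R)%type.

Lemma wgt_gt0 s : 0 <= s -> 0 < wgt s.
Proof. by move=> s0; rewrite invr_gt0 ltr_wpDr. Qed.

Lemma wgt_ge0 s : 0 <= s -> 0 <= wgt s.
Proof. by move=> s0; rewrite ltW// wgt_gt0. Qed.

Lemma wgt_le s t : 0 <= s -> s <= t -> wgt t <= wgt s.
Proof.
move=> s0 st; rewrite lef_pV2 ?posrE ?lerD2l// ltr_wpDr//.
exact: le_trans st.
Qed.

Lemma wgt_le1 s : 0 <= s -> wgt s <= 1.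
Proof. by move=> s0; rewrite /wgt invf_le1 ?lerDl// ltr_wpDr. Qed.

Lemma wgtX_le s t M : 0 <= s -> s <= t -> wgt t ^+ M <= wgt s ^+ M.
Proof.
move=> s0 st; apply: lerXn2r; rewrite ?nnegrE ?wgt_ge0//; last exact: wgt_le.
exact: le_trans st.
Qed.

Lemma wgtX_ge0 s M : 0 <= s -> 0 <= wgt s ^+ M.
Proof. by move=> s0; rewrite exprn_ge0// wgt_ge0. Qed.

Lemma wgtX_le1 s M : 0 <= s -> wgt s ^+ M <= 1.
Proof. by move=> s0; rewrite exprn_ile1// ?wgt_ge0 ?wgt_le1. Qed.

Lemma wgtX_le_exp s M N : 0 <= s -> (M <= N)%N -> wgt s ^+ N <= wgt s ^+ M.
Proof. by move=> s0 MN; rewrite ler_wiXn2l// ?wgt_ge0 ?wgt_le1. Qed.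

Lemma wgtX_split s t M N : 0 <= s -> 0 <= t ->
  wgt (s + t) ^+ (M + N) <= wgt s ^+ M * wgt t ^+ N.
Proof.
move=> s0 t0; rewrite exprD ler_pM ?wgtX_ge0 ?addr_ge0//.
  by rewrite wgtX_le// lerDl.
by rewrite wgtX_le// lerDr.
Qed.

Lemma wgt_sqE x : wgt_sq x = wgt (x ^+ 2). Proof. by []. Qed.

(** Adding a coordinate x costs one power of the weight and pays for the
    integration in x. *)
Lemma wgtX_sqr s x M : 0 <= s -> wgt (s + x ^+ 2) ^+ M.+1 <= wgt s ^+ M * wgt_sq x.
Proof. by move=> s0; have := wgtX_split M 1 s0 (sqr_ge0 x); rewrite addn1 expr1. Qed.

Lemma wgtX_sqr2 s x M : 0 <= s -> wgt (s + x ^+ 2) ^+ M.+2 <= wgt s ^+ M * wgt_sq x ^+ 2.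
Proof. by move=> s0; have := wgtX_split M 2 s0 (sqr_ge0 x); rewrite addn2. Qed.

Lemma lip_decay_ge0 C M F : lip_decay C M F -> 0 <= C.
Proof.
move=> /(_ 0 0 (lexx _) (lexx _))[h _]; have := le_trans (normr_ge0 _) h.
by rewrite pmulr_lge0// exprn_gt0// wgt_gt0.
Qed.

Lemma lip_decay_bound C M F s : lip_decay C M F -> 0 <= s -> `|F s| <= C * wgt s ^+ M.
Proof. by move=> h s0; have [] := h s s s0 (lexx _). Qed.

Lemma lip_decay_lip C M F s t : lip_decay C M F -> 0 <= s -> 0 <= t ->
  `|F t - F s| <= C * `|t - s|.
Proof.
move=> h s0 t0; have C0 := lip_decay_ge0 h.
wlog st : s t s0 t0 / s <= t => [hw|].
  have [/hw->//|/ltW/hw] := leP s t.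
  by rewrite distrC [X in _ * X]distrC; exact.
have [_ h1] := h s t s0 st.
rewrite (le_trans h1)// ger0_norm ?subr_ge0// ler_piMr ?wgtX_le1//.
by rewrite mulr_ge0 ?subr_ge0.
Qed.

Lemma lip_decay_weaken C C' M N F : lip_decay C N F -> (M <= N)%N -> C <= C' -> lip_decay C' M F.
Proof.
move=> h MN CC s t s0 st; have [h1 h2] := h s t s0 st; have C0 := lip_decay_ge0 h.
split; [apply: (le_trans h1)|apply: (le_trans h2)].
  by rewrite ler_pM ?wgtX_ge0 ?wgtX_le_exp.
by rewrite ler_pM ?wgtX_ge0 ?wgtX_le_exp ?mulr_ge0 ?ler_wpM2r// subr_ge0.
Qed.

(** The absolute value extends F from s >= 0 to the line, which gives plain
    continuity in place of continuity on a half-line. *)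
Lemma lip_decay_cont C M F : lip_decay C M F -> continuous (fun x => F `|x|).
Proof.
move=> h x; apply/cvgrPdist_le => /= e e0.
have C0 := lip_decay_ge0 h.
near=> y; apply: (le_trans (lip_decay_lip h _ _)) => //.
apply: (@le_trans _ _ (C * `|x - y|)).
  by rewrite ler_wpM2l// ler_dist_dist.
apply: (@le_trans _ _ ((C + 1) * `|x - y|)).
  by rewrite ler_wpM2r// lerDl.
rewrite -ler_pdivlMl ?ltr_wpDl//.
near: y; apply/nbhs_ballP; exists ((C + 1)^-1 * e) => /=.
  by rewrite mulr_gt0 ?invr_gt0 ?ltr_wpDl.
by move=> z /ltW.
Unshelve. all: by end_near. Qed.

Lemma continuous_sq s : continuous (fun x : R => s + x ^+ 2).
Proof. by move=> x; apply: cvgD; [exact: cvg_cst|exact: exprn_continuous]. Qed.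

Lemma lip_decay_cont_sq C M F s : lip_decay C M F -> 0 <= s ->
  continuous (fun x => F (s + x ^+ 2)).
Proof.
move=> h s0.
rewrite (_ : (fun x => _) = (fun x => F `|x|) \o (fun x => s + x ^+ 2)).
  by move=> x; apply: continuous_comp; [exact: continuous_sq|exact: (lip_decay_cont h)].
by apply/funext => x /=; rewrite ger0_norm// addr_ge0// sqr_ge0.
Qed.

Lemma continuous_lin (a : R) : continuous (fun x : R => a * x).
Proof. by move=> x; apply: cvgM; [exact: cvg_cst|exact: cvg_id]. Qed.

Lemma continuous_cosM (a : R) : continuous (fun x : R => cos (a * x)).
Proof.
move=> x; apply: (@continuous_comp _ _ _ (fun x => a * x) cos).
  exact: continuous_lin.
exact: continuous_cos.
Qed.

Lemma continuous_sinM (a : R) : continuous (fun x : R => sin (a * x)).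
Proof.
move=> x; apply: (@continuous_comp _ _ _ (fun x => a * x) sin).
  exact: continuous_lin.
exact: continuous_sin.
Qed.

Lemma line_cos_cont C M F s b : lip_decay C M F -> 0 <= s ->
  continuous (fun x => F (s + x ^+ 2) * cos (2 * pi * b * x)).
Proof.
move=> h s0 x; apply: cvgM; [exact: (lip_decay_cont_sq h)|exact: continuous_cosM].
Qed.

Lemma normM_cos (a : R) x : `|a * cos x| <= `|a|.
Proof. by rewrite normrM ler_piMr// cos_max. Qed.

Lemma line_cos_dom C M F s b x : lip_decay C M.+1 F -> 0 <= s ->
  `|F (s + x ^+ 2) * cos (2 * pi * b * x)| <= (C * wgt s ^+ M) * wgt_sq x.
Proof.
move=> h s0; rewrite (le_trans (normM_cos _ _))// (le_trans (lip_decay_bound h _))//.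
  by rewrite addr_ge0// sqr_ge0.
by rewrite -mulrA ler_wpM2l ?wgtX_sqr// (lip_decay_ge0 h).
Qed.

Lemma line_cos_integrable C M F s b : lip_decay C M.+1 F -> 0 <= s ->
  mu.-integrable setT (EFin \o (fun x => F (s + x ^+ 2) * cos (2 * pi * b * x))).
Proof.
move=> h s0; apply: (@integrable_dec _ _ (C * wgt s ^+ M)).
  by have cA := line_cos_cont (b := b) h s0; exact: (continuous_measurable_fun cA).
by move=> x; exact: line_cos_dom.
Qed.

Lemma line_cos_lip_decay C M F b : lip_decay C M.+1 F -> lip_decay (C * pi) M (line_cos b F).
Proof.
move=> h s t s0 st; have C0 := lip_decay_ge0 h.
have t0 := le_trans s0 st.
split.
  rewrite mulrAC; apply: Rintegral_dec.
    by have cA := line_cos_cont (b := b) h s0; exact: (continuous_measurable_fun cA).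
  by move=> x; exact: line_cos_dom.
rewrite -RintegralB//; try exact: (line_cos_integrable _ h).
rewrite [leRHS](_ : _ = (C * (t - s) * wgt s ^+ M) * pi); last by ring.
apply: Rintegral_dec.
  apply: continuous_measurable_fun => x.
  by apply: cvgB; [exact: (line_cos_cont (b := b) h t0)|exact: (line_cos_cont (b := b) h s0)].
move=> x; rewrite -mulrBl (le_trans (normM_cos _ _))//.
have [_ h2] := h (s + x ^+ 2) (t + x ^+ 2) (addr_ge0 s0 (sqr_ge0 x))
  (lerD st (lexx _)).
rewrite (le_trans h2)// -mulrA (_ : t + _ - _ = t - s); last by ring.
rewrite -!mulrA !ler_wpM2l ?subr_ge0//.
exact: wgtX_sqr.
Qed.

Lemma line_cos_rapid F b : rapid F -> rapid (line_cos b F).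
Proof. by move=> h M; have [C hC] := h M.+1; exists (C * pi); exact: line_cos_lip_decay. Qed.

Lemma measurable_sumsq s : measurable_fun setT (fun z : T2 => s + (z.1 : R) ^+ 2 + (z.2 :
  R) ^+ 2 : R).
Proof.
apply: measurable_funD => /=; last exact: measurable_funX.
by apply: measurable_funD => //=; exact: measurable_funX.
Qed.

Lemma lip_decay_measurable2 C M F s : lip_decay C M F -> 0 <= s ->
  measurable_fun setT (fun z : T2 => F (s + z.1 ^+ 2 + z.2 ^+ 2)).
Proof.
move=> h s0.
rewrite (_ : (fun z => _) = (fun x => F `|x|) \o (fun z : T2 => s + (z.1 : R) ^+ 2 + (z.2 :
  R) ^+ 2)).
  apply: measurableT_comp; last exact: measurable_sumsq.
  by apply: continuous_measurable_fun; exact: (lip_decay_cont h).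
by apply/funext => x /=; rewrite ger0_norm// !addr_ge0// sqr_ge0.
Qed.

Lemma integrable_dec2 (f : T2 -> R) C : measurable_fun setT f ->
  (forall x y : R, `|f (x, y)| <= C * wgt_sq x * wgt_sq y) ->
  mu2.-integrable setT (EFin \o f).
Proof.
move=> mf fC.
have C0 : 0 <= C.
  have := le_trans (normr_ge0 _) (fC 0 0).
  by rewrite !pmulr_lge0 ?wgt_sq_gt0.
apply/integrable12ltyP; first exact/measurable_EFinP.
apply: (@le_lt_trans _ _ (\int[mu]_x ((C * pi)%:E * (wgt_sq x)%:E))%E); last first.
  rewrite integralZl//; last exact: integrable_wgt_sq.
  by rewrite integral_wgt_sq -EFinM ltry.
apply: ge0_le_integral => //=.
- by move=> x _; apply: integral_ge0.
- apply: (measurable_fun_fubini_tonelli_F (abse \o (EFin \o f))) => //=.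
  by apply: measurableT_comp => //; exact/measurable_EFinP.
- apply/measurable_EFinP; apply: measurable_funM => //; exact: measurable_wgt_sq.
- move=> x _.
  apply: (@le_trans _ _ (\int[mu]_y ((C * wgt_sq x)%:E * (wgt_sq y)%:E))%E); last first.
    rewrite integralZl//; last exact: integrable_wgt_sq.
    by rewrite integral_wgt_sq -!EFinM lee_fin mulrAC.
  apply: ge0_le_integral => //=.
  - have m1 := measurable_fun_pair2 x mf.
    have m2 : mfun1 (fun y => `|f (x, y)|) by exact: measurableT_comp m1.
    by move/measurable_EFinP : m2.
  - apply/measurable_EFinP; apply: measurable_funM => //; exact: measurable_wgt_sq.
  - by move=> y _; rewrite -EFinM lee_fin.
Qed.

Lemma Rintegral12 (f : T2 -> R) : mu2.-integrable setT (EFin \o f) ->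
  (forall x : R, mu.-integrable setT (fun y => (f (x, y))%:E)) ->
  \int[mu]_x \int[mu]_y f (x, y) = fine (\int[mu2]_z (f z)%:E)%E.
Proof.
move=> If Ify; rewrite -(integral12_prod_meas1 If) /Rintegral; congr fine.
apply: eq_integral => x _; rewrite fineK//.
exact: (integrable_fin_num measurableT (Ify x)).
Qed.

Lemma sin_part_eq0 C F s b : lip_decay C 1 F -> 0 <= s ->
  \int[mu]_x (F (s + x ^+ 2) * sin (2 * pi * b * x)) = 0.
Proof.
move=> h s0; apply: (@Rintegral_odd _ _ C).
- move=> x; apply: cvgM; [exact: (lip_decay_cont_sq h)|exact: continuous_sinM].
- by move=> x; rewrite sqrrN mulrN sinN mulrN.
- move=> x; rewrite normrM; apply: (@le_trans _ _ (`|F (s + x ^+ 2)|)).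
    by rewrite ler_piMr// sin_max.
  rewrite (le_trans (lip_decay_bound h _)) ?addr_ge0 ?sqr_ge0//.
  rewrite ler_wpM2l ?(lip_decay_ge0 h)// (le_trans (wgtX_sqr x 0 s0))//.
  by rewrite expr0 mul1r.
Qed.

Lemma plane_cos_measurable C M F s (g : T2 -> R) : lip_decay C M F -> 0 <= s ->
  measurable_fun setT g ->
  measurable_fun setT (fun z : T2 => F (s + z.1 ^+ 2 + z.2 ^+ 2) * cos (g z)).
Proof.
move=> h s0 mg; apply: measurable_funM; first exact: lip_decay_measurable2 h s0.
apply: measurableT_comp => //.
by apply: continuous_measurable_fun; exact: continuous_cos.
Qed.

Lemma sumsq_dom C F s x y : lip_decay C 2 F -> 0 <= s ->
  `|F (s + x ^+ 2 + y ^+ 2)| <= C * wgt_sq x * wgt_sq y.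
Proof.
move=> h s0; rewrite (le_trans (lip_decay_bound h _)) ?addr_ge0 ?sqr_ge0//.
rewrite -mulrA ler_wpM2l ?(lip_decay_ge0 h)//.
rewrite (le_trans (wgtX_sqr y 1 (addr_ge0 s0 (sqr_ge0 x))))//.
rewrite ler_wpM2r ?wgt_sq_ge0// (le_trans (wgtX_sqr x 0 s0))//.
by rewrite expr0 mul1r.
Qed.

Lemma measurable_lin2 (a b : R) :
  measurable_fun setT (fun z : T2 => 2 * pi * (a * z.1 + b * z.2) : R).
Proof.
by apply: measurable_funM => //=; apply: measurable_funD => //=; apply: measurable_funM.
Qed.

(** In the cosine of the sum, the product of sines integrates to 0 because F
    (s + x ^ 2 + y ^ 2) is even in y, so the iterated transform is one cosine
    integral over the plane. *)
Lemma line_cos2_plane C F s a b : lip_decay C 2 F -> 0 <= s ->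
  line_cos a (line_cos b F) s = fine (\int[mu2]_z
    (F (s + z.1 ^+ 2 + z.2 ^+ 2) * cos (2 * pi * (a * z.1 + b * z.2)))%:E)%E.
Proof.
move=> h s0.
pose f z := F (s + z.1 ^+ 2 + z.2 ^+ 2) * cos (2 * pi * (a * z.1 + b * z.2)).
rewrite -[in RHS]/(f _).
have h1 : lip_decay C 1 F by exact: lip_decay_weaken h _ _.
have mf : measurable_fun setT (f : T2 -> R).
  by apply: (plane_cos_measurable h s0); exact: measurable_lin2.
have fC x y : `|f (x, y)| <= C * wgt_sq x * wgt_sq y.
  by rewrite (le_trans (normM_cos _ _))// sumsq_dom.
rewrite -(Rintegral12 (integrable_dec2 mf fC)); last first.
  move=> x; apply: (@integrable_dec _ (fun y => f (x, y)) (C * wgt_sq x)) => //.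
  exact: (measurable_fun_pair2 x mf).
apply: eq_Rintegral => x _.
have sx : 0 <= s + x ^+ 2 by rewrite addr_ge0// sqr_ge0.
transitivity (\int[mu]_y (cos (2 * pi * a * x) * (F (s + x ^+ 2 +
  y ^+ 2) * cos (2 * pi * b * y)) -
  sin (2 * pi * a * x) * (F (s + x ^+ 2 + y ^+ 2) * sin (2 * pi * b * y)))).
  have I1 := line_cos_integrable b h1 sx.
  have I2 : mu.-integrable setT (EFin \o (fun y => F (s + x ^+ 2 +
    y ^+ 2) * sin (2 * pi * b * y))).
    apply: (@integrable_dec _ _ C).
      apply: continuous_measurable_fun => y.
      by apply: cvgM; [exact: (lip_decay_cont_sq h)|exact: continuous_sinM].
    move=> y; rewrite normrM; apply: (@le_trans _ _ (`|F (s + x ^+ 2 + y ^+ 2)|)).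
      by rewrite ler_piMr// sin_max.
    rewrite (le_trans (sumsq_dom x y h s0))// ler_wpM2r ?wgt_sq_ge0//.
    by rewrite ler_piMr ?wgt_sq_le1// (lip_decay_ge0 h).
  rewrite RintegralB//; last 2 first.
  - by have := integrableZl measurableT (cos (2 * pi * a * x)) I1.
  - by have := integrableZl measurableT (sin (2 * pi * a * x)) I2.
  by rewrite !RintegralZl// (sin_part_eq0 b h1 sx) mulr0 subr0 mulrC.
apply: eq_Rintegral => y _; rewrite /f /= !mulrDr cosD !mulrA; ring.
Qed.

(** The phase a x + b y is r times the first coordinate in the frame rotated
    by the angle of (a, b), while x ^ 2 + y ^ 2 is unchanged by rotations.
    The condition on a keeps the rotation away from the half turn, which
    [rotation] excludes. *)
Lemma line_cos_rotate C F s a b : lip_decay C 2 F -> 0 <= s -> 0 <= a ->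
  line_cos a (line_cos b F) s = line_cos (Num.sqrt (a ^+ 2 + b ^+ 2)) (line_cos 0 F) s.
Proof.
move=> h s0 a0; set r := Num.sqrt _.
have r2 : r ^+ 2 = a ^+ 2 + b ^+ 2 by rewrite sqr_sqrtr// addr_ge0 ?sqr_ge0.
have [r0|r_neq0] := eqVneq r 0.
  have : a ^+ 2 + b ^+ 2 == 0 by rewrite -r2 r0 expr0n.
  by rewrite paddr_eq0 ?sqr_ge0// !sqrf_eq0 => /andP[/eqP-> /eqP->]; rewrite r0.
have r_gt0 : 0 < r by rewrite lt0r r_neq0 sqrtr_ge0.
rewrite !(line_cos2_plane _ _ h s0); congr fine.
pose f z := (F (s + z.1 ^+ 2 + z.2 ^+ 2) * cos (2 * pi * (a * z.1 + b * z.2)))%:E.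
have mf : measurable_fun setT (f : T2 -> \bar R).
  by apply/measurable_EFinP; apply: (plane_cos_measurable h s0); exact: measurable_lin2.
have cs : (a / r) ^+ 2 + (b / r) ^+ 2 = 1.
  by rewrite !expr_div_n -mulrDl -r2 divff// expf_neq0.
have c1 : 1 + a / r != 0.
  by rewrite gt_eqF// ltr_wpDr// divr_ge0// ltW.
rewrite -(rotation mf cs c1); apply: eq_integral => -[x y] _.
rewrite /f /=; congr (_ * cos _)%:E.
- congr F; rewrite -!addrA; congr (_ + _).
  transitivity (((a / r) ^+ 2 + (b / r) ^+ 2) * (x ^+ 2 + y ^+ 2)); first by ring.
  by rewrite cs mul1r.
- congr (_ * _); transitivity ((a ^+ 2 + b ^+ 2) / r * x); first by ring.
  by rewrite -r2 mul0r addr0; congr (_ * _); field.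
Qed.

End LD.

(** * Two radial integrations: polar coordinates *)

Section Polar.
Context {R : realType}.
Implicit Types (F : R -> R) (C s t x : R) (M : nat).
Notation mu := (@lebesgue_measure R).
Notation mu2 := (mu \x mu)%E.
Notation T2 := (measurableTypeR R * measurableTypeR R)%type.

Lemma is_derive_eqr (f : R -> R) x a b : is_derive x 1 f a -> a = b -> is_derive x 1 f b.
Proof. by move=> ? <-. Qed.

Lemma line_cos0E F s : line_cos 0 F s = \int[mu]_x F (s + x ^+ 2).
Proof. by apply: eq_Rintegral => x _; rewrite mulr0 mul0r cos0 mulr1. Qed.

Lemma norm_wgt_sq_le1 x : `|x| * wgt_sq x <= 1.
Proof.
rewrite /wgt_sq ler_pdivrMr ?ltr_wpDr ?sqr_ge0// mul1r -[x ^+ 2]real_normK ?num_real//.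
have := normr_ge0 x; nra.
Qed.

Lemma line_abs_dom C M F s x : lip_decay C M.+3 F -> 0 <= s ->
  `| `|x| * F (s + x ^+ 2) | <= C * wgt s ^+ M * wgt_sq x ^+ 2.
Proof.
move=> h s0; rewrite normrM normr_id.
have sx : 0 <= s + x ^+ 2 by rewrite addr_ge0 ?sqr_ge0.
apply: (@le_trans _ _ (`|x| * (C * (wgt s ^+ M * wgt_sq x ^+ 3)))).
  rewrite ler_wpM2l// (le_trans (lip_decay_bound h sx))// ler_wpM2l ?(lip_decay_ge0 h)//.
  by have := wgtX_split M 3 s0 (sqr_ge0 x); rewrite addn3.
have := norm_wgt_sq_le1 x; rewrite exprS => h1.
rewrite [leLHS](_ : _ = C * wgt s ^+ M * wgt_sq x ^+ 2 * (`|x| * wgt_sq x)); last by ring.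
by rewrite ler_piMr// !mulr_ge0 ?wgtX_ge0 ?(lip_decay_ge0 h) ?exprn_ge0 ?wgt_sq_ge0.
Qed.

Lemma line_abs_cont C M F s : lip_decay C M F -> 0 <= s ->
  continuous (fun x => `|x| * F (s + x ^+ 2)).
Proof.
by move=> h s0 x; apply: cvgM; [exact: norm_continuous|exact: (lip_decay_cont_sq h)].
Qed.

Lemma wgt_sq2_le (K : R) x : 0 <= K -> K * wgt_sq x ^+ 2 <= K * wgt_sq x.
Proof. by move=> K0; rewrite ler_wpM2l// expr2 ler_piMr ?wgt_sq_le1 ?wgt_sq_ge0. Qed.

Lemma line_abs_integrable C F s : lip_decay C 3 F -> 0 <= s ->
  mu.-integrable setT (EFin \o (fun x => `|x| * F (s + x ^+ 2))).
Proof.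
move=> h s0; apply: (@integrable_dec _ _ C).
  by have cJ := line_abs_cont h s0; exact: (continuous_measurable_fun cJ).
move=> x; rewrite (le_trans (line_abs_dom x h s0))// expr0 mulr1.
by rewrite wgt_sq2_le ?(lip_decay_ge0 h).
Qed.

(** The integrand of F (s + x ^ 2 + y ^ 2) after y = x t; |x| is the
    Jacobian. *)
Let polar_fun F s (z : T2) : R := `|z.1| * F (s + z.1 ^+ 2 * (1 + z.2 ^+ 2)).

Lemma polar_fun_measurable C M F s : lip_decay C M F -> 0 <= s ->
  measurable_fun setT (polar_fun F s).
Proof.
move=> h s0; apply: measurable_funM.
  by apply: (@measurableT_comp _ _ _ _ _ _ (@Num.norm R R)).
rewrite (_ : (fun z => _) = (fun x => F `|x|) \o
    (fun z : T2 => s + (z.1 : R) ^+ 2 * (1 + (z.2 : R) ^+ 2))).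
  apply: measurableT_comp.
    by apply: continuous_measurable_fun; exact: (lip_decay_cont h).
  apply: measurable_funD => //=; apply: measurable_funM => //=.
    exact: measurable_funX.
  by apply: measurable_funD => //; exact: measurable_funX.
apply/funext => x /=; rewrite ger0_norm// addr_ge0// mulr_ge0 ?sqr_ge0//.
by rewrite addr_ge0// sqr_ge0.
Qed.

(** For a fixed slope t, the substitution of x / sqrt (1 + t ^ 2) for x brings
    out the factor 1 / (1 + t ^ 2). *)
Lemma polar_slice_radius C F s t : lip_decay C 3 F -> 0 <= s ->
  (\int[mu]_x (polar_fun F s (x, t))%:E = (wgt_sq t * line_abs F s)%:E)%E.
Proof.
move=> h s0; set c := Num.sqrt (1 + t ^+ 2).
have c1 : 0 < 1 + t ^+ 2 by rewrite ltr_wpDr// sqr_ge0.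
have c2 : c ^+ 2 = 1 + t ^+ 2 by rewrite sqr_sqrtr// ltW.
have c0 : 0 < c by rewrite sqrtr_gt0.
have gE : (fun x => `|c * x + 0| * F (s + (c * x + 0) ^+ 2)) =
  (fun x => c * polar_fun F s (x, t)).
  by apply/funext => x; rewrite /polar_fun /= addr0 normrM (gtr0_norm c0) exprMn c2 -mulrA;
    congr (c * (`|x| * F _)); ring.
have IJ := line_abs_integrable h s0.
have Icg := integrable_affine 0 (lt0r_neq0 c0) IJ.
rewrite gE in Icg.
have Ig : mu.-integrable setT (EFin \o (fun x => polar_fun F s (x, t))).
  have := integrableZl measurableT c^-1 Icg.
  congr (_.-integrable _ _); apply/funext => x /=.
  by rewrite -EFinM mulKf// gt_eqF.
have := Rintegral_affine 0 (lt0r_neq0 c0) IJ.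
rewrite -/(line_abs F s) gE.
rewrite RintegralZl// gtr0_norm// mulrA -expr2 c2 => ->.
rewrite mulrA mulVf ?gt_eqF// mul1r /Rintegral fineK//.
exact: (integrable_fin_num measurableT Ig).
Qed.

Lemma lip_decay_abs C M F : lip_decay C M F -> lip_decay C M (fun x => `|F x|).
Proof.
move=> h s t s0 st; have [h1 h2] := h s t s0 st; split; first by rewrite normr_id.
by rewrite (le_trans _ h2)// ler_dist_dist.
Qed.

Lemma polar_fun_integrable C F s : lip_decay C 3 F -> 0 <= s ->
  mu2.-integrable setT (EFin \o polar_fun F s).
Proof.
move=> h s0; have mg := polar_fun_measurable h s0.
apply/integrable21ltyP; first exact/measurable_EFinP.
have -> : (\int[mu]_t \int[mu]_x `|(EFin \o polar_fun F s) (x, t)| =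
    \int[mu]_t ((line_abs (fun x => `|F x|) s)%:E * (wgt_sq t)%:E))%E.
  apply: eq_integral => t _; rewrite -EFinM mulrC -(polar_slice_radius t (lip_decay_abs h) s0).
  by apply: eq_integral => x _; rewrite /polar_fun /= normrM normr_id.
rewrite integralZl//; last exact: integrable_wgt_sq.
by rewrite integral_wgt_sq -EFinM ltry.
Qed.

Lemma polar_slice_line C F s x : lip_decay C 3 F -> 0 <= s -> x != 0 ->
  (\int[mu]_t (polar_fun F s (x, t))%:E = (line_cos 0 F (s + x ^+ 2))%:E)%E.
Proof.
move=> h s0 x0.
have sx : 0 <= s + x ^+ 2 by rewrite addr_ge0// sqr_ge0.
have IF : mu.-integrable setT (EFin \o (fun y => F (s + x ^+ 2 + y ^+ 2))).
  have := line_cos_integrable 0 h sx.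
  congr (_.-integrable _ _); apply/funext => y /=.
  by rewrite mulr0 mul0r cos0 mulr1.
have IFx := integrable_affine 0 x0 IF.
have E : (fun t => F (s + x ^+ 2 + (x * t + 0) ^+ 2)) = (fun t => F (s + x ^+ 2 * (1 + t ^+ 2))).
  by apply/funext => t; congr F; ring.
rewrite E in IFx.
have Ig : mu.-integrable setT (EFin \o (fun t => polar_fun F s (x, t))).
  by have := integrableZl measurableT `|x| IFx.
rewrite line_cos0E (Rintegral_affine 0 x0 IF) E -RintegralZl// /Rintegral fineK//.
exact: (integrable_fin_num measurableT Ig).
Qed.

(** Polar coordinates with the slope t = y / x in place of the angle: pi is
    the integral of 1 / (1 + t ^ 2).  The line x = 0, where the slope is
    undefined, has measure 0. *)
Lemma line_cos0_polar C F s : lip_decay C 4 F -> 0 <= s ->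
  line_cos 0 (line_cos 0 F) s = pi * line_abs F s.
Proof.
move=> h s0; rewrite line_cos0E /Rintegral.
have h3 : lip_decay C 3 F by exact: lip_decay_weaken h _ _.
have Ig := polar_fun_integrable h3 s0.
have hA : lip_decay (C * pi) 3 (line_cos 0 F) by exact: line_cos_lip_decay.
transitivity (fine (\int[mu]_x \int[mu]_t (polar_fun F s (x, t))%:E)%E); last first.
  have -> := Fubini Ig.
  transitivity (fine (\int[mu]_t ((line_abs F s)%:E * (wgt_sq t)%:E))%E).
    by congr fine; apply: eq_integral => t _; rewrite -EFinM mulrC;
      exact: polar_slice_radius h3 s0.
  by rewrite integralZl ?integral_wgt_sq//=; [rewrite mulrC|exact: integrable_wgt_sq].
congr fine; apply: ae_eq_integral => //.
- apply/measurable_EFinP.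
  by have cA := lip_decay_cont_sq hA s0; exact: (continuous_measurable_fun cA).
- by have := measurable_int _ (integrable_fubini_F Ig).
exists [set 0]; split => //; first exact: lebesgue_measure_set1.
move=> x /= xE; apply: contrapT => x0; apply: xE => _.
by rewrite (polar_slice_line h3 s0)//; apply/eqP.
Qed.

(** The base point -1 makes every s >= 0 interior to the interval of
    integration, so that the two-sided derivative exists at s = 0 as well. *)
Let antiderivative F (u : R) : R := \int[mu]_(v in `[-1, u]) F `|v|.

Lemma antiderivative_derive C M F (u : R) : lip_decay C M F -> 0 <= u ->
  is_derive u 1 (antiderivative F) (F u).
Proof.
move=> h u0; have cF := lip_decay_cont h.
have uu : u < u + 1 by rewrite ltrDl.
have If : mu.-integrable `[-1, u + 1] (EFin \o (fun v => F `|v|)).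
  apply: continuous_compact_integrable; first exact: segment_compact.
  exact: continuous_subspaceT.
have u1 : -1 < u by rewrite (lt_le_trans _ u0)// ltrN10.
have [dG GE] := continuous_FTC1_closed uu If u1 (cF u).
by apply: DeriveDef => //; rewrite -derive1E GE ger0_norm.
Qed.

Lemma is_derive_sq (a x : R) : is_derive x 1 (fun x => a + x ^+ 2) (2 * x).
Proof. by apply: is_derive_eq; rewrite /GRing.scale /=; ring. Qed.

Lemma antiderivative_sq_derive C M F s x : lip_decay C M F -> 0 <= s ->
  is_derive x 1 (fun x => antiderivative F (s + x ^+ 2)) (2 * x * F (s + x ^+ 2)).
Proof.
move=> h s0.
have sx : 0 <= s + x ^+ 2 by rewrite addr_ge0// sqr_ge0.
have dG := antiderivative_derive h sx; have ds := is_derive_sq s x.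
have := @is_derive1_comp _ (antiderivative F) (fun x => s + x ^+ 2) x _ _ dG ds.
by rewrite mulrC.
Qed.

(** |x| F (s + x ^ 2) is the derivative of half the antiderivative of F at s +
    x ^ 2, up to the sign of x; the two halves of the interval contribute
    equally. *)
Lemma line_abs_trunc C M F s L : lip_decay C M F -> 0 <= s -> 0 < L ->
  \int[mu]_(x in `[- L, L]) (`|x| * F (s + x ^+ 2)) =
    antiderivative F (s + L ^+ 2) - antiderivative F s.
Proof.
move=> h s0 L0.
have cJ := line_abs_cont h s0.
have dG x := antiderivative_sq_derive x h s0.
have cG : continuous (fun x => antiderivative F (s + x ^+ 2)).
  move=> x; apply: differentiable_continuous; apply/derivable1_diffP.
  exact: ex_derive.
have IJ : mu.-integrable `[- L, L] (EFin \o (fun x => `|x| * F (s + x ^+ 2))).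
  apply: continuous_compact_integrable; first exact: segment_compact.
  exact: continuous_subspaceT.
have LL : (BLeft (- L) <= BRight 0)%O by rewrite bnd_simp oppr_le0 ltW.
have L1 : (BRight 0 <= BRight L)%O by rewrite bnd_simp ltW.
have := Rintegral_itvB IJ LL L1.
move=> /eqP; rewrite subr_eq => /eqP ->.
rewrite Rintegral_itv_obnd_cbnd; last first.
  apply: integrableS IJ => //= y /=; rewrite !in_itv /= => /andP[y0 ->].
  by rewrite andbT; lra.
pose K x := 2^-1 * antiderivative F (s + x ^+ 2).
have dK x : is_derive x 1 K (x * F (s + x ^+ 2)).
  have h' := is_deriveZ 2^-1 (dG x).
  by apply: (is_derive_eqr h'); rewrite /GRing.scale /=; field.
have cK : continuous K by move=> x; apply: cvgM; [exact: cvg_cst|exact: cG].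
have -> : \int[mu]_(x in `[0, L]) (`|x| * F (s + x ^+ 2)) = K L - K 0.
  transitivity (\int[mu]_(x in `[0, L]) (x * F (s + x ^+ 2))).
    apply: eq_Rintegral => x; rewrite inE /= in_itv /= => /andP[x0 _].
    by rewrite ger0_norm.
  rewrite /Rintegral (@continuous_FTC2 _ _ K)//.
  - apply: continuous_subspaceT => x; apply: cvgM; [exact: cvg_id|exact: (lip_decay_cont_sq h
    s0)].
  - split; [by move=> x _; exact: ex_derive|..].
    + by apply: cvg_at_right_filter; exact: cK.
    + by apply: cvg_at_left_filter; exact: cK.
  - by move=> x _; rewrite derive1E; apply: derive_val.
have -> : \int[mu]_(x in `[- L, 0]) (`|x| * F (s + x ^+ 2)) = K (- L) - K 0.
  have cN : continuous (fun x => - K x) by move=> x; apply: cvgN; exact: cK.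
  transitivity (\int[mu]_(x in `[- L, 0]) (- (x * F (s + x ^+ 2)))).
    apply: eq_Rintegral => x; rewrite inE /= in_itv /= => /andP[_ x0].
    by rewrite ler0_norm// mulNr.
  rewrite /Rintegral (@continuous_FTC2 _ _ (fun x => - K x)) ?oppr_lt0//=.
  - by rewrite opprK addrC.
  - apply: continuous_subspaceT => x; apply: cvgN; apply: cvgM;
    [exact: cvg_id|exact: (lip_decay_cont_sq h s0)].
  - split; [by move=> x _; apply: derivableN; exact: ex_derive|..].
    + by apply: cvg_at_right_filter; exact: cN.
    + by apply: cvg_at_left_filter; exact: cN.
  - by move=> x _; rewrite derive1E derive_val.
by rewrite /K sqrrN expr0n addr0; field.
Qed.

(** The truncated integrals at s and at 0, both cut at squared radius T,
    differ by the increment of the antiderivative between 0 and s, whatever T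
    is. *)
Lemma line_abs_antiderivative C F s : lip_decay C 3 F -> 0 <= s ->
  line_abs F s = line_abs F 0 + antiderivative F 0 - antiderivative F s.
Proof.
move=> h s0.
have C0 := lip_decay_ge0 h.
have bound t T : 0 <= t -> t < T ->
    `|line_abs F t - (antiderivative F T - antiderivative F t)| <= C * pi * wgt (T - t).
  move=> t0 tT; set L := Num.sqrt (T - t).
  have L2 : L ^+ 2 = T - t by rewrite sqr_sqrtr// subr_ge0 ltW.
  have L0 : 0 < L by rewrite sqrtr_gt0 subr_gt0.
  have := line_abs_trunc h t0 L0.
  rewrite L2 [t + _]addrC subrK => <-; rewrite -L2 -wgt_sqE.
  apply: Rintegral_tail; first exact: ltW.
    by have cJ := line_abs_cont h t0; exact: (continuous_measurable_fun cJ).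
  move=> x; rewrite (le_trans (line_abs_dom x h t0))// expr0 mulr1//.
apply/eqP; rewrite -subr_eq0 -normr_eq0 eq_le normr_ge0 andbT.
apply/ler_addgt0Pr => e e0; rewrite add0r.
pose K := C * pi; have K0 : 0 <= K by rewrite mulr_ge0// pi_ge0.
pose T := s + 1 + 2 * K / e.
have Ke : 0 <= 2 * K / e by apply: divr_ge0; [exact: mulr_ge0|exact: ltW].
have sT : s < T by rewrite /T; lra.
have T0 : 0 < T by rewrite (le_lt_trans s0).
have b1 := bound s T s0 sT; have b2 := bound 0 T (lexx _) T0.
rewrite subr0 in b2.
have q1 : wgt (T - s) <= e / 2 / (K + e).
  have eT : e / 2 * (1 + (T - s)) = K + e by rewrite /T; field; rewrite gt_eqF.
  have sT1 : 0 < 1 + (T - s) by lra.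
  rewrite /wgt ler_pdivlMr ?ltr_wpDl// mulrC ler_pdivrMr//.
  by rewrite eT.
have q2 : wgt T <= e / 2 / (K + e).
  by rewrite (le_trans _ q1)// wgt_le//; lra.
have Kq : K * (e / 2 / (K + e)) <= e / 2.
  rewrite mulrA ler_pdivrMr ?ltr_wpDl//; nra.
have k1 : K * wgt (T - s) <= e / 2 by rewrite (le_trans _ Kq)// ler_wpM2l.
have k2 : K * wgt T <= e / 2 by rewrite (le_trans _ Kq)// ler_wpM2l.
rewrite (_ : _ - _ = (line_abs F s - (antiderivative F T - antiderivative F s)) -
  (line_abs F 0 - (antiderivative F T - antiderivative F 0))); last by ring.
rewrite (le_trans (ler_normB _ _))//.
rewrite -/K in b1 b2; lra.
Qed.

(** As a function of the radius, because that is the form in which it is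
    integrated by parts. *)
Lemma plane_int_sq_derive C F x : lip_decay C 4 F ->
  is_derive x 1 (fun x => line_cos 0 (line_cos 0 F) (x ^+ 2)) (- (2 * pi * x * F (x ^+ 2))).
Proof.
move=> h; have h3 : lip_decay C 3 F by exact: lip_decay_weaken h _ _.
rewrite (_ : (fun x => _) = (fun x => pi * (line_abs F 0 +
  antiderivative F 0) - pi * antiderivative F (0 + x ^+ 2))).
  have h' := is_deriveB (is_derive_cst (pi * (line_abs F 0 + antiderivative F 0)) x 1)
    (is_deriveZ pi (antiderivative_sq_derive x h (lexx 0))).
  by apply: (is_derive_eqr h'); rewrite !add0r /GRing.scale /=; ring.
apply/funext => y; rewrite (line_cos0_polar h) ?sqr_ge0// (line_abs_antiderivative h3)
  ?sqr_ge0// add0r; ring.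
Qed.
End Polar.

(** * Smooth functions and their cosine and sine transforms *)

Definition smooth {R : realType} (f : R -> R) :=
  forall (n : nat) (x : R), derivable (derive1n n f) x 1.

Definition cos_tr {R : realType} (f : R -> R) (t : R) : R :=
  \int[@lebesgue_measure R]_x (f x * cos (2 * pi * t * x)).
Definition sin_tr {R : realType} (f : R -> R) (t : R) : R :=
  \int[@lebesgue_measure R]_x (f x * sin (2 * pi * t * x)).

Section Smooth.
Context {R : realType}.
Implicit Types (f g : R -> R) (C s t x : R) (n M : nat).
Notation mu := (@lebesgue_measure R).

Lemma derive1_eq f f' : (forall x, is_derive x 1 f (f' x)) -> derive1 f = f'.
Proof. by move=> df; apply/funext => x; rewrite derive1E derive_val. Qed.

Lemma derive1nSr f n : derive1n n.+1 f = derive1n n (derive1 f).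
Proof. by rewrite /derive1n iterSr. Qed.

Lemma is_derive_continuous f f' : (forall x, is_derive x 1 f (f' x)) -> continuous f.
Proof.
move=> df x; apply: differentiable_continuous; apply/derivable1_diffP.
exact: ex_derive.
Qed.

Lemma derivable_is_derive1 f x : derivable f x 1 -> is_derive x 1 f (derive1 f x).
Proof. by move=> df; rewrite derive1E; apply: DeriveDef. Qed.

Lemma smooth_is_derive f n x : smooth f ->
  is_derive x 1 (derive1n n f) (derive1n n.+1 f x).
Proof. by move=> sf; rewrite derive1nS; apply: derivable_is_derive1; exact: sf. Qed.

Lemma smooth_is_derive0 f x : smooth f -> is_derive x 1 f (derive1 f x).
Proof. by move=> sf; apply: derivable_is_derive1; exact: (sf 0%N). Qed.

Lemma smooth_derive1 f : smooth f -> smooth (derive1 f).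
Proof. by move=> sf n x; rewrite -derive1nSr; exact: sf. Qed.

Lemma smooth_cont f n : smooth f -> continuous (derive1n n f).
Proof. by move=> sf; apply: is_derive_continuous => x; exact: smooth_is_derive. Qed.

Lemma is_derive_xM f x (df : R) : is_derive x 1 f df ->
  is_derive x 1 (fun y => y * f y) (x * df + f x).
Proof.
move=> hf; have h := is_deriveM (is_derive_id x 1) hf.
by apply: (is_derive_eqr h); rewrite /GRing.scale /= mulr1.
Qed.

Lemma is_derive_ZM (c : R) f x (df : R) : is_derive x 1 f df ->
  is_derive x 1 (fun y => c * f y) (c * df).
Proof. by move=> hf; have h := is_deriveZ c hf. Qed.

Lemma derive1n_xM f n : smooth f ->
  (forall x, derivable (derive1n n (fun y => y * f y)) x 1) /\
  derive1n n (fun y => y * f y) =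
    (fun y => y * derive1n n f y + n%:R * derive1n n.-1 f y).
Proof.
move=> sf; elim: n => [|n [_ IH]].
  split=> [x|]; last by apply/funext => x /=; rewrite mul0r addr0.
  by have h := is_derive_xM (smooth_is_derive0 x sf); exact: ex_derive.
have E : derive1n n.+1 (fun y => y * f y) =
    (fun y => y * derive1n n.+1 f y + n.+1%:R * derive1n n f y).
  rewrite derive1nS IH; apply: derive1_eq => x.
  have h1 := is_derive_xM (smooth_is_derive n x sf).
  case: n {IH} h1 => [|n] h1.
    have h2 := is_deriveD h1 (is_derive_cst (0:R) x 1).
    rewrite (_ : (fun y => _) = (fun y => y * derive1n 0 f y) + cst 0).
      by apply: (is_derive_eqr h2); rewrite addr0 mul1r.
    by apply/funext => y; rewrite mul0r.
  have h2 := is_deriveD h1 (is_derive_ZM n.+1%:R (smooth_is_derive n x sf)).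
  apply: (is_derive_eqr h2); rewrite [n.+2%:R]mulrS; ring.
split=> // x; rewrite E.
have h := is_deriveD (is_derive_xM (smooth_is_derive n.+1 x sf))
   (is_derive_ZM n.+1%:R (smooth_is_derive n x sf)).
by have := @ex_derive _ _ _ _ _ _ _ h.
Qed.

Lemma smooth_xM f : smooth f -> smooth (fun y => y * f y).
Proof. by move=> sf n; exact: (derive1n_xM n sf).1. Qed.

Lemma derive1n_ZM (c : R) f n : smooth f ->
  (forall x, derivable (derive1n n (fun y => c * f y)) x 1) /\
  derive1n n (fun y => c * f y) = (fun y => c * derive1n n f y).
Proof.
move=> sf; elim: n => [|n [_ IH]].
  split=> // x; have h := is_derive_ZM c (smooth_is_derive0 x sf); exact: ex_derive.
have E : derive1n n.+1 (fun y => c * f y) = (fun y => c * derive1n n.+1 f y).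
  rewrite derive1nS IH; apply: derive1_eq => x.
  exact: is_derive_ZM (smooth_is_derive n x sf).
split=> // x; rewrite E.
have h := is_derive_ZM c (smooth_is_derive n.+1 x sf); exact: ex_derive.
Qed.

Lemma smooth_ZM (c : R) f : smooth f -> smooth (fun y => c * f y).
Proof. by move=> sf n; exact: (derive1n_ZM c n sf).1. Qed.

Lemma is_derive_cosM (a x : R) : is_derive x 1 (fun y => cos (a * y)) (- (a * sin (a * x))).
Proof.
have h : is_derive x 1 (fun y : R => a * y) a.
  by have := is_derive_ZM a (is_derive_id x (1:R)); rewrite mulr1.
have := is_derive1_comp (f := cos) (g := fun y : R => a * y) (is_derive_cos _) h.
by move=> h'; apply: (is_derive_eqr h'); rewrite mulNr mulrC.
Qed.

Lemma is_derive_sinM (a x : R) : is_derive x 1 (fun y => sin (a * y)) (a * cos (a * x)).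
Proof.
have h : is_derive x 1 (fun y : R => a * y) a.
  by have := is_derive_ZM a (is_derive_id x (1:R)); rewrite mulr1.
have := is_derive1_comp (f := sin) (g := fun y : R => a * y) (is_derive_sin _) h.
by move=> h'; apply: (is_derive_eqr h'); rewrite mulrC.
Qed.

Lemma normM_sin (a : R) x : `|a * sin x| <= `|a|.
Proof. by rewrite normrM ler_piMr// sin_max. Qed.

Lemma trig_cont f t : continuous f ->
  continuous (fun x => f x * cos (2 * pi * t * x)) /\
  continuous (fun x => f x * sin (2 * pi * t * x)).
Proof.
move=> cf; split=> x; apply: cvgM; try exact: cf.
  exact: continuous_cosM.
exact: continuous_sinM.
Qed.

Lemma trig_integrable f C t : continuous f -> (forall x, `|f x| <= C * wgt_sq x) ->
  mu.-integrable setT (EFin \o (fun x => f x * cos (2 * pi * t * x))) /\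
  mu.-integrable setT (EFin \o (fun x => f x * sin (2 * pi * t * x))).
Proof.
move=> cf fC; have [c1 c2] := trig_cont t cf.
split; [apply: (integrable_dec (continuous_measurable_fun c1) (C := C))|
  apply: (integrable_dec (continuous_measurable_fun c2) (C := C))] => x;
  apply: le_trans (fC x); [exact: normM_cos|exact: normM_sin].
Qed.

Lemma trig_bound f C t : continuous f -> (forall x, `|f x| <= C * wgt_sq x) ->
  `|cos_tr f t| <= C * pi /\ `|sin_tr f t| <= C * pi.
Proof.
move=> cf fC; have [c1 c2] := trig_cont t cf.
split; [apply: (Rintegral_dec (continuous_measurable_fun c1))|
  apply: (Rintegral_dec (continuous_measurable_fun c2))] => x;
  apply: le_trans (fC x); [exact: normM_cos|exact: normM_sin].
Qed.

Lemma dom_wgt_sq2 f C x : (forall x, `|f x| <= C * wgt_sq x ^+ 2) -> `|f x| <= C * wgt_sq x.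
Proof.
move=> fC; have C0 : 0 <= C.
  by have := le_trans (normr_ge0 _) (fC 0); rewrite pmulr_lge0// exprn_gt0// wgt_sq_gt0.
exact: le_trans (fC x) (wgt_sq2_le x C0).
Qed.

Lemma xM_dom_wgt_sq f C x : (forall x, `|f x| <= C * wgt_sq x ^+ 2) -> `|x * f x| <= C * wgt_sq x.
Proof.
move=> fC; have C0 : 0 <= C.
  by have := le_trans (normr_ge0 _) (fC 0); rewrite pmulr_lge0// exprn_gt0// wgt_sq_gt0.
rewrite normrM (@le_trans _ _ (`|x| * (C * wgt_sq x ^+ 2)))// ?ler_wpM2l//.
rewrite [leLHS](_ : _ = C * wgt_sq x * (`|x| * wgt_sq x)); last by ring.
by rewrite ler_piMr ?norm_wgt_sq_le1// mulr_ge0 ?wgt_sq_ge0.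
Qed.

(** Differentiation under the integral sign; one of the two factors of the
    majorant absorbs the x that comes out. *)
Lemma cos_tr_derive f C t : continuous f -> (forall x, `|f x| <= C * wgt_sq x ^+ 2) ->
  is_derive t 1 (cos_tr f) (sin_tr (fun x => - (2 * pi) * (x * f x)) t).
Proof.
move=> cf fC.
pose F t x := f x * cos (2 * pi * t * x).
have dF x y : is_derive x 1 (F ^~ y) (- (2 * pi) * (y * f y) * sin (2 * pi * x * y)).
  have h := is_derive_ZM (f y) (is_derive_cosM (2 * pi * y) x).
  rewrite (_ : F ^~ y = (fun z => f y * cos (2 * pi * y * z))).
    by apply: (is_derive_eqr h); rewrite [2 * pi * x * y]mulrAC; ring.
  by apply/funext => z; rewrite /F mulrAC.
have p1E x y : partial1of2 F x y = - (2 * pi) * (y * f y) * sin (2 * pi * x * y).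
  by rewrite partial1of2E; have := dF x y => h; rewrite derive_val.
have p0 : 0 <= 2 * pi :> R by rewrite mulr_ge0 ?pi_ge0.
have C0 : 0 <= C.
  by have := le_trans (normr_ge0 _) (fC 0); rewrite pmulr_lge0// exprn_gt0// wgt_sq_gt0.
have It : `]t - 1, t + 1[%classic t by rewrite /= in_itv /=; lra.
have iF x : `]t - 1, t + 1[%classic x -> mu.-integrable setT (EFin \o F x).
  by move=> _; exact: (trig_integrable x cf (fun z => dom_wgt_sq2 z fC)).1.
have G0 y : 0 <= (2 * pi * C) * wgt_sq y by rewrite !mulr_ge0 ?wgt_sq_ge0 ?pi_ge0.
have iG : mu.-integrable setT (EFin \o (fun y => (2 * pi * C) * wgt_sq y)).
  by have := integrableZl measurableT (2 * pi * C) integrable_wgt_sq.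
have GF x y : `]t - 1, t + 1[%classic x -> [set: measurableTypeR R] y ->
    `|partial1of2 F x y| <= (2 * pi * C) * wgt_sq y.
  move=> _ _; rewrite p1E (le_trans (normM_sin _ _))// normrM normrN (ger0_norm p0).
  by rewrite -mulrA ler_wpM2l// xM_dom_wgt_sq.
have dF' x y : `]t - 1, t + 1[%classic x -> [set: measurableTypeR R] y ->
    derivable (F ^~ y) x 1.
  by move=> _ _; have h := dF x y; exact: ex_derive.
have D := derivable_under_integral measurableT It iF dF' G0 iG GF.
have V := differentiation_under_integral measurableT It iF dF' G0 iG GF.
have := derivable_is_derive1 D; rewrite V => h; apply: (is_derive_eqr h).
by apply: eq_Rintegral => y _; exact: p1E.
Qed.

Lemma sin_tr_derive f C t : continuous f -> (forall x, `|f x| <= C * wgt_sq x ^+ 2) ->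
  is_derive t 1 (sin_tr f) (cos_tr (fun x => (2 * pi) * (x * f x)) t).
Proof.
move=> cf fC.
pose F t x := f x * sin (2 * pi * t * x).
have dF x y : is_derive x 1 (F ^~ y) (2 * pi * (y * f y) * cos (2 * pi * x * y)).
  have h := is_derive_ZM (f y) (is_derive_sinM (2 * pi * y) x).
  rewrite (_ : F ^~ y = (fun z => f y * sin (2 * pi * y * z))).
    by apply: (is_derive_eqr h); rewrite [2 * pi * x * y]mulrAC; ring.
  by apply/funext => z; rewrite /F mulrAC.
have p1E x y : partial1of2 F x y = 2 * pi * (y * f y) * cos (2 * pi * x * y).
  by rewrite partial1of2E; have := dF x y => h; rewrite derive_val.
have p0 : 0 <= 2 * pi :> R by rewrite mulr_ge0 ?pi_ge0.
have C0 : 0 <= C.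
  by have := le_trans (normr_ge0 _) (fC 0); rewrite pmulr_lge0// exprn_gt0// wgt_sq_gt0.
have It : `]t - 1, t + 1[%classic t by rewrite /= in_itv /=; lra.
have iF x : `]t - 1, t + 1[%classic x -> mu.-integrable setT (EFin \o F x).
  by move=> _; exact: (trig_integrable x cf (fun z => dom_wgt_sq2 z fC)).2.
have G0 y : 0 <= (2 * pi * C) * wgt_sq y by rewrite !mulr_ge0 ?wgt_sq_ge0 ?pi_ge0.
have iG : mu.-integrable setT (EFin \o (fun y => (2 * pi * C) * wgt_sq y)).
  by have := integrableZl measurableT (2 * pi * C) integrable_wgt_sq.
have GF x y : `]t - 1, t + 1[%classic x -> [set: measurableTypeR R] y ->
    `|partial1of2 F x y| <= (2 * pi * C) * wgt_sq y.
  move=> _ _; rewrite p1E (le_trans (normM_cos _ _))// normrM (ger0_norm p0).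
  by rewrite -mulrA ler_wpM2l// xM_dom_wgt_sq.
have dF' x y : `]t - 1, t + 1[%classic x -> [set: measurableTypeR R] y ->
    derivable (F ^~ y) x 1.
  by move=> _ _; have h := dF x y; exact: ex_derive.
have D := derivable_under_integral measurableT It iF dF' G0 iG GF.
have V := differentiation_under_integral measurableT It iF dF' G0 iG GF.
have := derivable_is_derive1 D; rewrite V => h; apply: (is_derive_eqr h).
by apply: eq_Rintegral => y _; exact: p1E.
Qed.

Lemma trigZ f C c t : continuous f -> (forall x, `|f x| <= C * wgt_sq x) ->
  cos_tr (fun x => c * f x) t = c * cos_tr f t /\ sin_tr (fun x => c * f x) t = c * sin_tr f t.
Proof.
move=> cf fC; have [i1 i2] := trig_integrable t cf fC.
split; rewrite -RintegralZl//; apply: eq_Rintegral => x _; by rewrite mulrA.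
Qed.

Lemma trig_parts f f' C t : (forall x, is_derive x 1 f (f' x)) -> continuous f' ->
  (forall x, `|f x| <= C * wgt_sq x ^+ 2) -> (forall x, `|f' x| <= C * wgt_sq x ^+ 2) ->
  2 * pi * t * cos_tr f t = - sin_tr f' t /\ 2 * pi * t * sin_tr f t = cos_tr f' t.
Proof.
move=> df cf' fC f'C; have cf := is_derive_continuous df.
have C0 : 0 <= C.
  by have := le_trans (normr_ge0 _) (fC 0); rewrite pmulr_lge0// exprn_gt0// wgt_sq_gt0.
pose a := 2 * pi * t.
have [if1 if2] := trig_integrable t cf (fun z => dom_wgt_sq2 z fC).
have [ig1 ig2] := trig_integrable t cf' (fun z => dom_wgt_sq2 z f'C).
have [cf1 cf2] := trig_cont t cf.
have [cg1 cg2] := trig_cont t cf'.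
pose K := C * (1 + `|a|).
have CK : C <= K by rewrite ler_peMr// lerDl.
have bnd x (c1 c2 : R) : `|c1| <= 1 -> `|c2| <= `|a| ->
   `|f' x * c1 + c2 * f x| <= K * wgt_sq x ^+ 2.
  move=> h1 h2; rewrite (le_trans (ler_normD _ _))// !normrM /K mulrDr mulr1 mulrDl lerD//.
    by rewrite (le_trans _ (f'C x))// ler_piMr.
  by rewrite [C * _]mulrC -mulrA ler_pM.
split.
- have d1 x : is_derive x 1 (fun x => f x * sin (a * x))
     (f' x * sin (a * x) + a * (f x * cos (a * x))).
    have h := is_deriveM (df x) (is_derive_sinM a x).
    by apply: (is_derive_eqr h); rewrite /GRing.scale /=; ring.
  have := @Rintegral_derive_eq0 _ _ _ K d1.
  rewrite RintegralD//; last by have := integrableZl measurableT a if1.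
  rewrite RintegralZl//; move=> H; apply/eqP; rewrite -addr_eq0 addrC; apply/eqP; apply: H.
  + by move=> x; apply: cvgD; [exact: cg2|apply: cvgM; [exact: cvg_cst|exact: cf1]].
  + move=> x; rewrite (le_trans (normM_sin _ _))// (le_trans (dom_wgt_sq2 x fC))//.
    by rewrite ler_wpM2r// wgt_sq_ge0.
  + move=> x; have -> : a * (f x * cos (a * x)) = (a * cos (a * x)) * f x by ring.
    by apply: bnd; [exact: sin_max|exact: normM_cos].
- have d1 x : is_derive x 1 (fun x => f x * cos (a * x))
     (f' x * cos (a * x) - a * (f x * sin (a * x))).
    have h := is_deriveM (df x) (is_derive_cosM a x).
    by apply: (is_derive_eqr h); rewrite /GRing.scale /=; ring.
  have := @Rintegral_derive_eq0 _ _ _ K d1.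
  rewrite RintegralB//; last by have := integrableZl measurableT a if2.
  rewrite RintegralZl//; move=> H; apply/eqP; rewrite eq_sym -subr_eq0; apply/eqP; apply: H.
  + by move=> x; apply: cvgB; [exact: cg1|apply: cvgM; [exact: cvg_cst|exact: cf2]].
  + move=> x; rewrite (le_trans (normM_cos _ _))// (le_trans (dom_wgt_sq2 x fC))//.
    by rewrite ler_wpM2r// wgt_sq_ge0.
  + move=> x; have -> : - (a * (f x * sin (a * x))) = (- a * sin (a * x)) * f x by ring.
    by apply: bnd; [exact: cos_max|rewrite (le_trans (normM_sin _ _))// normrN].
Qed.
End Smooth.

(** * Schwartz functions and radial Fourier transforms in odd dimension *)

(** The real counterpart of a Schwartz function; real and imaginary parts are
    treated separately. *)
Definition rschwartz {R : realType} (u : R -> R) :=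
  smooth u /\ forall m n, exists C, forall x, `|x| ^+ m * `|derive1n n u x| <= C.

(** Integration over two further coordinates, which raises the dimension by
    2. *)
Definition plane_int {R : realType} (F : R -> R) := line_cos 0 (line_cos 0 F).

(** The Fourier transform at radius r of the function F (|x| ^ 2) on R^(2 i +
    1): 2 i coordinates are integrated, the last one against the cosine. *)
Definition radial_ft {R : realType} (F : R -> R) (i : nat) (r : R) : R :=
  line_cos r (iter i plane_int F) 0.

Section Schwartz.
Context {R : realType}.
Implicit Types (f g u F : R -> R) (C s t x : R) (n m M : nat).

Lemma rschwartz_derive1 u : rschwartz u -> rschwartz (derive1 u).
Proof.
move=> [su du]; split; first exact: smooth_derive1.
by move=> m n; have [C hC] := du m n.+1; exists C => x; rewrite -derive1nSr.
Qed.

Lemma rschwartz_ZM (c : R) u : rschwartz u -> rschwartz (fun x => c * u x).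
Proof.
move=> [su du]; split; first exact: smooth_ZM.
move=> m n; have [C hC] := du m n; exists (`|c| * C) => x.
by rewrite (derive1n_ZM c n su).2 normrM mulrCA ler_wpM2l.
Qed.

Lemma rschwartz_xM u : rschwartz u -> rschwartz (fun x => x * u x).
Proof.
move=> [su du]; split; first exact: smooth_xM.
move=> m n; have [C1 h1] := du m.+1 n; have [C2 h2] := du m n.-1.
exists (C1 + n%:R * C2) => x.
rewrite (derive1n_xM n su).2.
apply: (@le_trans _ _ (`|x| ^+ m * (`|x * derive1n n u x| + `|n%:R * derive1n n.-1 u x|))).
  by rewrite ler_wpM2l ?exprn_ge0// ler_normD.
rewrite mulrDr lerD//.
  by rewrite normrM mulrA -exprSr.
by rewrite normrM normr_nat mulrCA ler_wpM2l.
Qed.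

Lemma rschwartz_weight u M m : rschwartz u ->
  exists C, forall x, `|x| ^+ m * ((1 + x ^+ 2) ^+ M * `|u x|) <= C.
Proof.
move=> [su du]; elim: M m => [|M IH] m.
  by have [C hC] := du m 0%N; exists C => x; rewrite expr0 mul1r.
have [C1 h1] := IH m; have [C2 h2] := IH m.+2.
exists (C1 + C2) => x.
apply: le_trans (lerD (h1 x) (h2 x)).
have -> : (1 + x ^+ 2) ^+ M.+1 = (1 + x ^+ 2) ^+ M * (1 + `|x| ^+ 2).
  by rewrite exprSr real_normK ?num_real.
by rewrite -[m.+2]addn2 exprD le_eqVlt; apply/orP; left; apply/eqP; ring.
Qed.

Lemma rschwartz_dom u M : rschwartz u -> exists C, forall x, `|u x| <= C * wgt_sq x ^+ M.
Proof.
move=> /(rschwartz_weight M 0)[C hC]; exists C => x; have := hC x.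
rewrite expr0 mul1r /wgt_sq exprVn ler_pdivlMr ?exprn_gt0 ?ltr_wpDr ?sqr_ge0//.
by rewrite mulrC.
Qed.

Lemma rschwartz_cont u : rschwartz u -> continuous u.
Proof. by move=> [su _]; exact: (@smooth_cont R u 0 su). Qed.

Lemma pi2_ge1 : 1 <= 2 * pi :> R.
Proof. have := pi_ge2 R; lra. Qed.

(** Each power of t is one integration by parts. *)
Lemma rschwartz_trig_decay u M : rschwartz u -> exists C, forall t,
  `|t| ^+ M * `|cos_tr u t| <= C /\ `|t| ^+ M * `|sin_tr u t| <= C.
Proof.
elim: M u => [|M IH] u ru.
  have [C hC] := rschwartz_dom 1 ru; exists (C * pi) => t; rewrite expr0 !mul1r.
  by apply: (trig_bound t (rschwartz_cont ru)) => x; have := hC x; rewrite expr1.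
have [C hC] := IH _ (rschwartz_derive1 ru).
have [C1 h1] := rschwartz_dom 2 ru; have [C2 h2] := rschwartz_dom 2 (rschwartz_derive1 ru).
pose K := Num.max C1 C2.
have k1 x : `|u x| <= K * wgt_sq x ^+ 2.
  by rewrite (le_trans (h1 x))// ler_wpM2r ?exprn_ge0 ?wgt_sq_ge0// le_max lexx.
have k2 x : `|derive1 u x| <= K * wgt_sq x ^+ 2.
  by rewrite (le_trans (h2 x))// ler_wpM2r ?exprn_ge0 ?wgt_sq_ge0// le_max lexx orbT.
have du x := smooth_is_derive0 x ru.1.
exists C => t; have [e1 e2] := trig_parts t du (rschwartz_cont (rschwartz_derive1 ru)) k1 k2.
have p0 : 0 < 2 * pi :> R by have := pi2_ge1; lra.
have aux a b : 2 * pi * t * a = b -> `|t| ^+ M * `|b| <= C -> `|t| ^+ M.+1 * `|a| <= C.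
  move=> <-; rewrite -mulrA normrM (gtr0_norm p0) normrM => h.
  apply: le_trans h; rewrite exprSr -mulrA ler_wpM2l ?exprn_ge0//.
  by rewrite ler_peMl ?mulr_ge0 ?pi2_ge1.
split; [apply: (aux _ _ e1)|apply: (aux _ _ e2)]; last exact: (hC t).1.
by rewrite normrN; exact: (hC t).2.
Qed.

Lemma rschwartz_cos_tr_derive u : rschwartz u -> derive1 (cos_tr u) =
  sin_tr (fun x => - (2 * pi) * (x * u x)) /\
  forall t, derivable (cos_tr u) t 1.
Proof.
move=> ru; have [C hC] := rschwartz_dom 2 ru.
have d t := cos_tr_derive t (rschwartz_cont ru) hC.
split; first exact: derive1_eq.
by move=> t; have h := d t; exact: ex_derive.
Qed.

Lemma rschwartz_sin_tr_derive u : rschwartz u -> derive1 (sin_tr u) =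
  cos_tr (fun x => (2 * pi) * (x * u x)) /\
  forall t, derivable (sin_tr u) t 1.
Proof.
move=> ru; have [C hC] := rschwartz_dom 2 ru.
have d t := sin_tr_derive t (rschwartz_cont ru) hC.
split; first exact: derive1_eq.
by move=> t; have h := d t; exact: ex_derive.
Qed.

Lemma rschwartz_trig u n M : rschwartz u ->
  exists C, forall t, `|t| ^+ M * `|derive1n n (cos_tr u) t| <= C /\
        `|t| ^+ M * `|derive1n n (sin_tr u) t| <= C.
Proof.
elim: n u => [|n IH] u ru; first exact: rschwartz_trig_decay.
have [C1 h1] := IH _ (rschwartz_ZM (- (2 * pi)) (rschwartz_xM ru)).
have [C2 h2] := IH _ (rschwartz_ZM (2 * pi) (rschwartz_xM ru)).
rewrite !derive1nSr (rschwartz_cos_tr_derive ru).1 (rschwartz_sin_tr_derive ru).1.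
by exists (Num.max C1 C2) => t; rewrite !le_max (h1 t).2 (h2 t).1 orbT.
Qed.

Lemma sin_tr_decay u n M : rschwartz u -> exists C, forall t, `|t| ^+ M * `|derive1n n (sin_tr
  u) t| <= C.
Proof. by move=> /(rschwartz_trig n M)[C hC]; exists C => t; exact: (hC t).2. Qed.

(** Schwartz-type decay of the function alone.  The functions F (x ^ 2) that
    occur are only Lipschitz, but their transforms are still smooth, as
    differentiation in t only multiplies them by x. *)
Definition cdecay f := continuous f /\ forall M, exists C, forall x, `|f x| <= C * wgt_sq x ^+ M.

Lemma rschwartz_cdecay u : rschwartz u -> cdecay u.
Proof. by move=> ru; split=> [|M]; [exact: rschwartz_cont|exact: rschwartz_dom]. Qed.

Lemma cdecay_ZxM (c : R) f : cdecay f -> cdecay (fun x => c * (x * f x)).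
Proof.
move=> [cf df]; split.
  by move=> x; apply: cvgM; [exact: cvg_cst|apply: cvgM; [exact: cvg_id|exact: cf]].
move=> M; have [C hC] := df M.+1; exists (`|c| * C) => x.
rewrite normrM -mulrA ler_wpM2l// normrM.
apply: (@le_trans _ _ (`|x| * (C * wgt_sq x ^+ M.+1))); first by rewrite ler_wpM2l.
have C0 : 0 <= C.
  by have := le_trans (normr_ge0 _) (hC 0); rewrite pmulr_lge0// exprn_gt0// wgt_sq_gt0.
rewrite exprS [leLHS](_ : _ = C * wgt_sq x ^+ M * (`|x| * wgt_sq x)); last by ring.
by rewrite ler_piMr ?norm_wgt_sq_le1// mulr_ge0 ?exprn_ge0 ?wgt_sq_ge0.
Qed.

Lemma trig_smooth f : cdecay f -> smooth (cos_tr f) /\ smooth (sin_tr f).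
Proof.
move=> cf; suff H n : (forall t, derivable (derive1n n (cos_tr f)) t 1) /\
    (forall t, derivable (derive1n n (sin_tr f)) t 1).
  by split=> n; [exact: (H n).1|exact: (H n).2].
elim: n f cf => [|n IH] f cf; have [C hC] := cf.2 2.
  split=> t; [have h := cos_tr_derive t cf.1 hC|have h := sin_tr_derive t cf.1 hC];
  exact: ex_derive.
rewrite !derive1nSr (derive1_eq (fun t => cos_tr_derive t cf.1 hC)).
rewrite (derive1_eq (fun t => sin_tr_derive t cf.1 hC)).
split; [exact: (IH _ (cdecay_ZxM _ cf)).2|exact: (IH _ (cdecay_ZxM _ cf)).1].
Qed.

Lemma sin_tr_smooth u : rschwartz u -> smooth (sin_tr u).
Proof. by move=> /rschwartz_cdecay/trig_smooth[]. Qed.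

Lemma plane_int_rapid F : rapid F -> rapid (plane_int F).
Proof. by move=> rF; exact/line_cos_rapid/line_cos_rapid. Qed.

Lemma iter_plane_int_rapid F i : rapid F -> rapid (iter i plane_int F).
Proof. by move=> rF; elim: i => //= i; exact: plane_int_rapid. Qed.

Lemma sq_dom F : rapid F -> exists C, forall x, `|F (x ^+ 2)| <= C * wgt_sq x ^+ 2 /\
  `|x * F (x ^+ 2)| <= C * wgt_sq x ^+ 2.
Proof.
move=> /(_ 3)[C hC]; exists C => x; split.
  rewrite (le_trans (lip_decay_bound hC (sqr_ge0 x)))// ler_wpM2l ?(lip_decay_ge0 hC)//.
  by rewrite -wgt_sqE ler_wiXn2l ?wgt_sq_ge0 ?wgt_sq_le1.
have := line_abs_dom x hC (lexx 0); rewrite add0r expr0 mulr1.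
by rewrite normrM normr_id -normrM.
Qed.

Lemma sq_cont F : rapid F -> continuous (fun x => F (x ^+ 2)).
Proof.
move=> /(_ 0)[C hC]; have := lip_decay_cont_sq hC (lexx 0).
by under eq_fun do rewrite add0r.
Qed.

Lemma line_cos_trE F r : line_cos r F 0 = cos_tr (fun x => F (x ^+ 2)) r.
Proof. by apply: eq_Rintegral => x _; rewrite add0r. Qed.

Lemma xsq_cont F : rapid F -> continuous (fun x => x * F (x ^+ 2)).
Proof. by move=> rF x; apply: cvgM; [exact: cvg_id|exact: sq_cont]. Qed.

(** Integration by parts, as - 2 pi x F (x ^ 2) is the derivative of plane_int
    F (x ^ 2). *)
Lemma sin_tr_plane_int F r : rapid F -> sin_tr (fun x => x * F (x ^+ 2)) r =
  r * line_cos r (plane_int F) 0.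
Proof.
move=> rF; rewrite line_cos_trE.
have [C1 h1] := sq_dom rF; have [C2 h2] := sq_dom (plane_int_rapid rF).
pose K := Num.max (2 * pi * C1) C2.
have pp : 0 < 2 * pi :> R by have := pi2_ge1; lra.
have k1 x : `|plane_int F (x ^+ 2)| <= K * wgt_sq x ^+ 2.
  by rewrite (le_trans (h2 x).1)// ler_wpM2r ?exprn_ge0 ?wgt_sq_ge0// le_max lexx orbT.
have k2 x : `|- (2 * pi) * (x * F (x ^+ 2))| <= K * wgt_sq x ^+ 2.
  rewrite normrM normrN (gtr0_norm pp).
  apply: (@le_trans _ _ (2 * pi * (C1 * wgt_sq x ^+ 2))); first by rewrite ler_pM2l// (h1 x).2.
  by rewrite mulrA ler_wpM2r ?exprn_ge0 ?wgt_sq_ge0// le_max lexx.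
have [C4 h4] := rF 4.
have d x : is_derive x 1 (fun x => plane_int F (x ^+ 2)) (- (2 * pi) * (x * F (x ^+ 2))).
  by have h := plane_int_sq_derive x h4; apply: (is_derive_eqr h); ring.
have cf : continuous (fun x => - (2 * pi) * (x * F (x ^+ 2))).
  by move=> x; apply: cvgM; [exact: cvg_cst|exact: xsq_cont].
have [+ _] := trig_parts r d cf k1 k2.
rewrite (trigZ _ _ (xsq_cont rF) (fun x => dom_wgt_sq2 x (fun y => (h1 y).2))).2.
move=> /eqP; rewrite mulNr opprK -mulrA (inj_eq (mulfI (lt0r_neq0 pp))) => /eqP ->//.
Qed.

(** Differentiation in r multiplies by x under the integral and replaces the
    cosine by the sine, so [sin_tr_plane_int] applies. *)
Lemma radial_ft_derive F i (r : R) : rapid F ->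
  is_derive r 1 (radial_ft F i) (- (2 * pi) * (r * radial_ft F i.+1 r)).
Proof.
move=> rF0; rewrite /radial_ft /=; have rF := iter_plane_int_rapid i rF0.
set H := iter i plane_int F in rF *.
have [C hC] := sq_dom rF.
have h := cos_tr_derive r (sq_cont rF) (fun x => (hC x).1).
rewrite (_ : (fun r => line_cos r H 0) = cos_tr (fun x => H (x ^+ 2))); last first.
  by apply/funext => t; rewrite line_cos_trE.
apply: (is_derive_eqr h).
rewrite (trigZ _ _ (xsq_cont rF) (fun x => dom_wgt_sq2 x (fun y => (hC y).2))).2.
by rewrite sin_tr_plane_int.
Qed.

Lemma radial_ft1E F r : rapid F -> sin_tr (fun x => x * F (x ^+ 2)) r = r * radial_ft F 1 r.
Proof. exact: sin_tr_plane_int. Qed.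

Lemma sq_cdecay F : rapid F -> cdecay (fun x => F (x ^+ 2)).
Proof.
move=> rF; split; first exact: sq_cont.
by move=> M; have [C hC] := rF M; exists C => x; exact: (lip_decay_bound hC (sqr_ge0 x)).
Qed.

Lemma radial_ft_smooth F i : rapid F -> smooth (radial_ft F i).
Proof.
move=> rF; rewrite /radial_ft (_ : (fun r => _) = cos_tr (fun x => iter i plane_int F (x ^+ 2))).
  by have [] := trig_smooth (sq_cdecay (iter_plane_int_rapid i rF)).
by apply/funext => r; rewrite line_cos_trE.
Qed.

(** At r = 0 the derivative of order n of r * E r is n times the derivative of
    order n - 1 of E, and E_i' r = - 2 pi r * E_(i + 1) r starts the same
    computation again two orders lower: hence the odd factors of the double
    factorial and the powers of - 2 pi. *)
Lemma radial_ft_taylor F i m : rapid F ->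
  derive1n (2 * m).+1 (fun r => r * radial_ft F i r) 0 =
  (dfact (2 * m).+1)%:R * (- (2 * pi)) ^+ m * radial_ft F (i + m) 0.
Proof.
move=> rF; elim: m i => [|m IH] i.
  rewrite muln0 (derive1n_xM 1 (radial_ft_smooth (i := i) rF)).2 mul0r add0r expr0 addn0.
  by rewrite !mul1r.
rewrite (_ : (2 * m.+1).+1 = (2 * m).+3); last by rewrite mulnS.
rewrite (derive1n_xM _ (radial_ft_smooth (i := i) rF)).2 mul0r add0r.
rewrite -[(2 * m).+3.-1]/((2 * m).+2) derive1nSr.
rewrite (derive1_eq (fun r => radial_ft_derive i r rF)).
rewrite (derive1n_ZM _ _ (smooth_xM (radial_ft_smooth (i := i.+1) rF))).2 IH addSnnS.
rewrite -/(dfact (2 * m).+1) natrM exprS; ring.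
Qed.

End Schwartz.

(** * The coefficients beta, and reduction of odd dimension to dimension one *)

Section Coefficients.
Context {R : realType}.
Implicit Types (f g u F : R -> R) (C s t x : R) (n m M : nat).

(** The coefficients beta with k = 2 m + 3, extended by 0 to j > m so that
    their recursion in m holds up to j = m + 1. *)
Definition beta_odd m j : R := if (j <= m)%N then
  (-1) ^+ j * ((2 * m - j)`!)%:R / ((j`!)%:R * (2 ^+ (m - j) * ((m - j)`!)%:R))
    / (2 * pi) ^+ m else 0.

Lemma dfact_even n : dfact (2 * n) = (2 ^ n * n`!)%N.
Proof.
elim: n => // n IH; rewrite mulnS /= -/(dfact (2 * n)) IH expnS factS; lia.
Qed.

Lemma fact_neq0 n : (n`!)%:R != 0 :> R.
Proof. by rewrite pnatr_eq0 -lt0n fact_gt0. Qed.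

Lemma beta_oddE m j : (j <= m)%N -> beta R j (2 * m + 3) = beta_odd m j.
Proof.
move=> jm; rewrite /beta /beta_odd jm.
have -> : (2 * m + 3 - j - 3 = 2 * m - j)%N by lia.
have -> : (2 * m + 3 - 2 * j - 3 = 2 * (m - j))%N by lia.
have -> : ((2 * m + 3 - 3) %/ 2 = m)%N by lia.
by rewrite dfact_even natrM natrX div1r exprVn.
Qed.

Lemma beta_odd_rec0 m : 2 * pi * beta_odd m.+1 0 = (2 * m + 1)%:R * beta_odd m 0.
Proof.
rewrite /beta_odd /= !subn0 mulnS !factS fact0 !expr0 !mul1r !natrM exprS [in LHS]exprS.
have pp : pi != 0 :> R by rewrite gt_eqF// pi_gt0.
have h1 := fact_neq0 m; have h2 : (2 ^+ m : R) != 0 by rewrite expf_neq0.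
have h3 : ((2 * pi) ^+ m : R) != 0 by rewrite expf_neq0// mulf_neq0.
have h4 : (m.+1)%:R != 0 :> R by rewrite pnatr_eq0.
move: (m`!)%:R h1 ((2 * m)`!)%:R (2 ^+ m) h2 ((2 * pi) ^+ m) h3 => a ha b c hc d hd.
rewrite addn1 (_ : (2 * m).+2 = 2 * m.+1)%N ?natrM; last by rewrite mulnS.
move: (m.+1)%:R h4 ((2 * m).+1)%:R pi pp => e he g p pp.
by field; rewrite ?ha ?hc ?hd ?pp ?he.
Qed.

(** The recursion satisfied by the coefficients when the expansion of r ^ (2 m
    + 1) E_(m + 1) is differentiated. *)
Lemma beta_odd_rec m j : (j <= m)%N ->
  2 * pi * beta_odd m.+1 j.+1 = (2 * m - j)%:R * beta_odd m j.+1 - beta_odd m j.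
Proof.
move=> jm; have pp : pi != 0 :> R by rewrite gt_eqF// pi_gt0.
have h3 : ((2 * pi) ^+ m : R) != 0 by rewrite expf_neq0// mulf_neq0.
have aux2 (p a b c d e g s A B : R) : p != 0 -> a != 0 -> b != 0 -> c != 0 ->
    d != 0 -> e != 0 -> g != 0 ->
    2 * p * (-1 * s * ((c + 2 * d) * (A * B)) / (c * a * (2 * e * (d * b))) / (2 * p * g)) =
    A * (-1 * s * B / (c * a * (e * b)) / g) - s * (A * B) / (a * (2 * e * (d * b))) / g.
  move=> p0 a0 b0 c0 d0 e0 g0; field.
  by rewrite p0 a0 b0 c0 d0 e0 g0.
have aux (p D a b s : R) : p != 0 -> D != 0 -> a != 0 -> b != 0 ->
    2 * p * (-1 * s * b / (b * (1 * 1)) / (2 * p * D)) = - (s * a / (a * (1 * 1)) / D).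
  by move=> p0 D0 a0 b0; field; rewrite p0 D0 a0 b0.
move: jm; rewrite leq_eqVlt => /predU1P[->|jm].
  rewrite /beta_odd ltnn !leqnn !subnn mulr0 sub0r !expr0.
  have -> : (2 * m.+1 - m.+1 = m.+1)%N by lia.
  have -> : (2 * m - m = m)%N by lia.
  have h1 := fact_neq0 m; have h2 := fact_neq0 m.+1.
  rewrite [(-1) ^+ m.+1]exprS [(2 * pi) ^+ m.+1]exprS fact0.
  by apply: aux.
rewrite /beta_odd ltnS (ltnW jm) jm.
have [i ->] : exists i, m = (j + 1 + i)%N by exists (m - j.+1)%N; lia.
have -> : (2 * (j + 1 + i).+1 - j.+1 = (j + 1 + 2 * i).+2)%N by lia.
have -> : (2 * (j + 1 + i) - j.+1 = j + 1 + 2 * i)%N by lia.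
have -> : (2 * (j + 1 + i) - j = (j + 1 + 2 * i).+1)%N by lia.
have -> : ((j + 1 + i).+1 - j.+1 = i.+1)%N by lia.
have -> : (j + 1 + i - j.+1 = i)%N by lia.
have -> : (j + 1 + i - j = i.+1)%N by lia.
rewrite !factS !natrM [2 ^+ i.+1]exprS [(-1) ^+ j.+1]exprS [(2 * pi) ^+ _.+1]exprS.
have -> : ((j + 1 + 2 * i).+2)%:R = j.+1%:R + 2 * i.+1%:R :> R.
  by rewrite -natrM -natrD; congr _%:R; lia.
have h3' : ((2 * pi) ^+ (j + 1 + i) : R) != 0 by rewrite expf_neq0// mulf_neq0.
have h1 := fact_neq0 j; have h2 := fact_neq0 i.
have h4 : (j.+1)%:R != 0 :> R by rewrite pnatr_eq0.
have h5 : (i.+1)%:R != 0 :> R by rewrite pnatr_eq0.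
have h6 : (2 ^+ i : R) != 0 by rewrite expf_neq0.
by apply: aux2.
Qed.

Lemma is_derive_Xn n x : is_derive x 1 (fun y : R => y ^+ n) (n%:R * x ^+ n.-1).
Proof.
have h := is_deriveX n (is_derive_id x (1:R)).
rewrite (_ : (fun y => _) = id ^+ n); last by apply/funext => y; rewrite exprfctE.
by apply: (is_derive_eqr h); rewrite /GRing.scale /= mulr1.
Qed.

(** Apply (2 m + 1) - r d/dr to the identity of order m.  On the right it
    removes the term in which the power of r is differentiated and leaves 2 pi
    r ^ (2 m + 3) E_(m + 2); on the left it produces the coefficients of order
    m + 1. *)
Lemma radial_ft_expansion_step (chi e1 e2 : R -> R) m : smooth chi ->
  (forall r : R, is_derive r 1 e1 (- (2 * pi) * (r * e2 r))) ->
  (forall r, \sum_(0 <= j < m.+1) beta_odd m j * r ^+ j * derive1n j chi r =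
    r ^+ (2 * m + 1) * e1 r) ->
  forall r, \sum_(0 <= j < m.+2) beta_odd m.+1 j * r ^+ j * derive1n j chi r =
    r ^+ (2 * m.+1 + 1) * e2 r.
Proof.
move=> sc de IH r.
have pp : 0 < 2 * pi :> R by have := @pi2_ge1 R; lra.
pose X j t : R := t ^+ j * derive1n j chi t.
have dX j : is_derive r 1 (X j) (j%:R * r ^+ j.-1 * derive1n j chi r +
  r ^+ j * derive1n j.+1 chi r).
  have h := is_deriveM (is_derive_Xn j r) (smooth_is_derive j r sc).
  by apply: (is_derive_eqr h); rewrite /GRing.scale /=; ring.
(* in terms of X, differentiation followed by multiplication by r has integer
   coefficients *)
have rdX j : r * (j%:R * r ^+ j.-1 * derive1n j chi r + r ^+ j * derive1n j.+1 chi r) =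
    j%:R * X j r + X j.+1 r.
  rewrite /X; case: j {dX} => [|j] /=; first by rewrite !mul0r expr0 expr1; ring.
  by rewrite !exprS; ring.
have d1 : is_derive r 1 (fun t => \sum_(0 <= j < m.+1) beta_odd m j * t ^+ j * derive1n j chi t)
   (\sum_(0 <= j < m.+1) beta_odd m j * (j%:R * r ^+ j.-1 * derive1n j chi r +
     r ^+ j * derive1n j.+1 chi r)).
  have h := is_derive_sum (fun j : 'I_m.+1 => is_derive_ZM (beta_odd m j) (dX j)).
  rewrite big_mkord; rewrite (_ : (fun t => _) = \sum_(j < m.+1) (fun t => beta_odd m j * X j
    t))//.
  apply/funext => t; rewrite fct_sumE big_mkord; apply: eq_bigr => j _.
  by rewrite /X mulrA.
have d2 : is_derive r 1 (fun t => t ^+ (2 * m + 1) * e1 t)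
   ((2 * m + 1)%:R * r ^+ (2 * m) * e1 r + r ^+ (2 * m + 1) * (- (2 * pi) * (r * e2 r))).
  have h := is_deriveM (is_derive_Xn (2 * m + 1) r) (de r).
  by apply: (is_derive_eqr h); rewrite /GRing.scale addn1 /=; ring.
have e12 : \sum_(0 <= j < m.+1) beta_odd m j * (j%:R * r ^+ j.-1 * derive1n j chi r +
  r ^+ j * derive1n j.+1 chi r) =
  (2 * m + 1)%:R * r ^+ (2 * m) * e1 r + r ^+ (2 * m + 1) * (- (2 * pi) * (r * e2 r)).
  rewrite -(@derive_val _ _ _ _ _ _ _ d1) -(@derive_val _ _ _ _ _ _ _ d2).
  by congr ('D_1 _ r); apply/funext.
(* both sides times 2 pi: the right one is (2 m + 1) - r d/dr applied to the
   identity of order m *)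
apply: (mulfI (lt0r_neq0 pp)).
transitivity ((2 * m + 1)%:R * (r ^+ (2 * m + 1) * e1 r) -
   r * ((2 * m + 1)%:R * r ^+ (2 * m) * e1 r + r ^+ (2 * m + 1) * (- (2 * pi) * (r * e2 r))));
     last first.
  by rewrite mulnS addn1 add2n addn1 !exprS; ring.
rewrite -e12 -IH mulr_sumr mulr_sumr mulr_sumr.
transitivity (\sum_(0 <= j < m.+2) 2 * pi * beta_odd m.+1 j * X j r).
  by apply: eq_bigr => j _; rewrite /X; ring.
rewrite big_nat_recl//.
have -> : \sum_(0 <= j < m.+1) 2 * pi * beta_odd m.+1 j.+1 * X j.+1 r =
   \sum_(0 <= j < m.+1) (2 * m - j)%:R * beta_odd m j.+1 * X j.+1 r - \sum_(0 <=
     j < m.+1) beta_odd m j * X j.+1 r.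
  rewrite -sumrB; apply: eq_big_nat => j /andP[_ jm].
  by rewrite beta_odd_rec//; ring.
rewrite beta_odd_rec0 addrA.
have -> : (2 * m + 1)%:R * beta_odd m 0 * X 0 r + \sum_(0 <=
  j < m.+1) (2 * m - j)%:R * beta_odd m j.+1 * X j.+1 r
  = \sum_(0 <= j < m.+1) (2 * m + 1 - j)%:R * beta_odd m j * X j r.
  rewrite [RHS]big_nat_recl// subn0; congr (_ + _).
  rewrite big_nat_recr//= {2}/beta_odd ltnn mulr0 mul0r addr0.
  by apply: eq_big_nat => j /andP[_ jm]; congr (_%:R * _ * _); lia.
rewrite -!sumrB; apply: eq_big_nat => j /andP[_ jm].
rewrite [r * _]mulrCA rdX natrB; last by lia.
by rewrite -[beta_odd m j * r ^+ j * _]mulrA -/(X j r); ring.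
Qed.

Lemma radial_ft_expansion (chi : R -> R) F m r : rapid F -> smooth chi ->
  (forall t, chi t = t * radial_ft F 1 t) ->
  \sum_(0 <= j < m.+1) beta_odd m j * r ^+ j * derive1n j chi r =
  r ^+ (2 * m + 1) * radial_ft F m.+1 r.
Proof.
move=> rF sc chiE; elim: m r => [|m IH] r.
  by rewrite big_nat1 /beta_odd /= !expr0 muln0 add0n expr1 chiE subnn fact0; field.
by apply: (radial_ft_expansion_step sc _ IH) => t; exact: radial_ft_derive.
Qed.
End Coefficients.

(** * The Fejer kernel *)

(** The sum over the integers from - N to N of an even summand, given by its
    values at the absolute values; the doubling saves signed indices. *)
Definition symsum {R : realType} (N : nat) (f : nat -> R) : R :=
  f 0%N + 2 * \sum_(1 <= b < N.+1) f b.

Definition fejer_wgt {R : realType} (N b : nat) : R := 1 - b%:R / N%:R.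

Definition fejer_kernel {R : realType} (N : nat) (x : R) : R :=
  symsum N (fun b => fejer_wgt N b * cos (2 * pi * b%:R * x)).

Section Fejer.
Context {R : realType}.
Implicit Types (F : R -> R) (C s t x : R) (M N n b : nat) (f g : nat -> R).
Notation mu := (@lebesgue_measure R).

Lemma symsumS N f : symsum N.+1 f = symsum N f + 2 * f N.+1.
Proof. by rewrite /symsum [in LHS]big_nat_recr//= mulrDr addrA. Qed.

Lemma symsum0 f : symsum 0 f = f 0%N.
Proof. by rewrite /symsum big_geq// mulr0 addr0. Qed.

Lemma eq_symsum N f g : (forall b, (b <= N)%N -> f b = g b) -> symsum N f = symsum N g.
Proof.
move=> fg; rewrite /symsum fg//; congr (_ + 2 * _).
by apply: eq_big_nat => b /andP[_ bN]; exact: fg.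
Qed.

Lemma symsumD N f g : symsum N (fun b => f b + g b) = symsum N f + symsum N g.
Proof. by rewrite /symsum big_split/=; ring. Qed.

Lemma symsumZ N (c : R) f : symsum N (fun b => c * f b) = c * symsum N f.
Proof. by rewrite /symsum -mulr_sumr; ring. Qed.

Lemma symsumB N f g : symsum N (fun b => f b - g b) = symsum N f - symsum N g.
Proof. by rewrite /symsum sumrB; ring. Qed.

Lemma ler_symsum N f g : (forall b, (b <= N)%N -> f b <= g b) -> symsum N f <= symsum N g.
Proof.
move=> fg; rewrite /symsum lerD ?fg// ler_pM2l//.
by apply: ler_sum_nat => b /andP[_ bN]; exact: fg.
Qed.

Lemma symsum_norm N f : `|symsum N f| <= symsum N (fun b => `|f b|).
Proof.
rewrite /symsum (le_trans (ler_normD _ _))// lerD2l normrM ger0_norm// ler_pM2l//.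
exact: ler_norm_sum.
Qed.

Lemma symsum_ge0 N f : (forall b, (b <= N)%N -> 0 <= f b) -> 0 <= symsum N f.
Proof.
move=> f0; apply: (le_trans _ (ler_symsum (f := fun=> 0) f0)).
by rewrite /symsum big1// mulr0 addr0.
Qed.

(** By comparison with the telescoping sum of 1 / n - 1 / (n + 1), the terms
    with b >= 1 add up to at most 2. *)
Lemma symsum_wgt_sq_le N : symsum N (fun b => wgt_sq (b%:R : R)) <= 5.
Proof.
have H n : \sum_(1 <= b < n.+2) wgt_sq (b%:R : R) <= 2 - n.+1%:R^-1.
  elim: n => [|n IH].
    by rewrite big_nat1 invr1 (le_trans (wgt_sq_le1 _))//; lra.
  rewrite big_nat_recr//=; apply: (le_trans (lerD IH (lexx _))).
  (* the step of the induction: the difference of both sides is the explicit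
     nonnegative fraction below *)
  rewrite /wgt_sq; set y := n.+1%:R.
  have y1 : 1 <= y :> R by rewrite ler1n.
  have -> : n.+2%:R = y + 1 by rewrite -natr1.
  rewrite -subr_ge0.
  have -> : 2 - (y + 1)^-1 - (2 - y^-1 + (1 + (y + 1) ^+ 2)^-1)
    = (y + 2) / (y * (y + 1) * (1 + (y + 1) ^+ 2)).
    field; apply/and3P; split; rewrite gt_eqF//; nra.
  by rewrite divr_ge0//; [lra|rewrite !mulr_ge0//; nra].
case: N => [|N]; first by rewrite symsum0 (le_trans (wgt_sq_le1 _))//; lra.
apply: (@le_trans _ _ (1 + 2 * 2)); last lra.
rewrite lerD ?wgt_sq_le1// ler_pM2l// (le_trans (H N))//.
by rewrite lerBlDr lerDl invr_ge0.
Qed.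

Lemma dirichlet N x : sin (pi * x) * symsum N (fun b => cos (2 * pi * b%:R * x)) =
  sin (pi * (2 * N + 1)%:R * x).
Proof.
have oddN n : (2 * n + 1)%:R = 2 * n%:R + 1 :> R by rewrite natrD natrM.
elim: N => [|N IH]; first by rewrite symsum0 mulr0 mul0r cos0 muln0 add0n !mulr1.
rewrite symsumS mulrDr IH.
set a := pi * x; set c := 2 * pi * N.+1%:R * x.
have -> : pi * (2 * N + 1)%:R * x = c - a.
  by rewrite /c /a oddN -natr1; ring.
have -> : pi * (2 * N.+1 + 1)%:R * x = c + a.
  by rewrite /c /a oddN -natr1; ring.
by rewrite !sinD sinN cosN; ring.
Qed.

Lemma fejer_sum N x :
  sin (pi * x) ^+ 2 * symsum N (fun b => (N%:R - b%:R) * cos (2 * pi * b%:R * x)) =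
  sin (pi * N%:R * x) ^+ 2.
Proof.
elim: N => [|N IH].
  by rewrite symsum0 subrr mul0r !mulr0 mul0r sin0 expr0n.
rewrite symsumS subrr mul0r mulr0 addr0.
rewrite (@eq_symsum N _ (fun b => (N%:R - b%:R) * cos (2 * pi * b%:R * x) +
    cos (2 * pi * b%:R * x))); last by move=> b _; rewrite -[N.+1]addn1 natrD; ring.
rewrite symsumD mulrDr IH [X in _ + X * _]expr2 -[X in _ + X = _]mulrA dirichlet.
set a := pi * x; set c := pi * N%:R * x.
have -> : pi * (2 * N + 1)%:R * x = c + (c + a).
  by rewrite /c /a natrD natrM; ring.
have -> : pi * N.+1%:R * x = c + a by rewrite /c /a -[N.+1]addn1 natrD; ring.
rewrite !sinD !cosD; have := cos2Dsin2 c; have := cos2Dsin2 a.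
move: (cos c) (sin c) (cos a) (sin a) => u v p r h1 h2.
have e1 : p * p = 1 - r ^+ 2 by rewrite -h1; ring.
have e2 : u * u = 1 - v ^+ 2 by rewrite -h2; ring.
transitivity (v ^+ 2 + r * (2 * (u * v) * p + r * (u * u - v ^+ 2))); first by ring.
transitivity (v ^+ 2 * (p * p) + 2 * v * p * u * r + (u * u) * r ^+ 2); last by ring.
by rewrite e1 e2; ring.
Qed.

Lemma fejer_kernel_sin N x : (0 < N)%N ->
  sin (pi * x) ^+ 2 * fejer_kernel N x = sin (pi * N%:R * x) ^+ 2 / N%:R.
Proof.
move=> N0; have NN : N%:R != 0 :> R by rewrite pnatr_eq0 -lt0n.
rewrite -fejer_sum -mulrA; congr (_ * _); rewrite mulrC -symsumZ.
apply: eq_symsum => b _; rewrite /fejer_wgt; field.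
by rewrite NN.
Qed.

Lemma fejer_wgt_ge0 N b : (b <= N)%N -> 0 <= fejer_wgt N b :> R.
Proof.
case: N => [|N] bN; first by rewrite /fejer_wgt invr0 mulr0 subr0.
by rewrite subr_ge0 ler_pdivrMr ?ltr0n// mul1r ler_nat.
Qed.

Lemma fejer_wgt_le1 N b : fejer_wgt N b <= 1 :> R.
Proof. by rewrite lerBlDr lerDl divr_ge0. Qed.

(** Where sin (pi x) = 0, that is, at the integers, the closed form says
    nothing and each summand is looked at instead. *)
Lemma fejer_kernel_ge0 N x : (0 < N)%N -> 0 <= fejer_kernel N x.
Proof.
move=> N0; have [s0|s0] := eqVneq (sin (pi * x)) 0; last first.
  have s2 : 0 < sin (pi * x) ^+ 2 by rewrite exprn_even_gt0.
  by rewrite -(pmulr_rge0 _ s2) fejer_kernel_sin// divr_ge0// sqr_ge0.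
have sb b : sin (pi * b%:R * x) = 0.
  elim: b => [|b IH]; first by rewrite mulr0 mul0r sin0.
  rewrite -natr1 mulrDr mulr1 mulrDl sinD IH s0; ring.
apply: symsum_ge0 => b bN; rewrite mulr_ge0 ?fejer_wgt_ge0//.
have -> : 2 * pi * b%:R * x = pi * b%:R * x + pi * b%:R * x by ring.
by rewrite cosD sb mulr0 subr0 -expr2 sqr_ge0.
Qed.

Lemma fejer_kernel_le N x : fejer_kernel N x <= (2 * N + 1)%:R.
Proof.
apply: (@le_trans _ _ (symsum N (fun=> 1))).
  apply: ler_symsum => b bN; rewrite -[leRHS]mulr1 (le_trans (ler_norm _))// normrM.
  by rewrite ler_pM// ?cos_max// ger0_norm ?fejer_wgt_ge0 ?fejer_wgt_le1.
by rewrite /symsum big_const_nat subn1 /= iter_addr addr0 natrD natrM addrC.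
Qed.

Lemma fejer_kernel_cont N : continuous (fejer_kernel N : R -> R).
Proof.
rewrite /fejer_kernel; move: (fejer_wgt N) => l; elim: N => [|N IH] x.
  under eq_fun do rewrite symsum0.
  by apply: cvgM; [exact: cvg_cst|exact: continuous_cosM].
under eq_fun do rewrite symsumS.
apply: cvgD; first exact: IH.
apply: cvgM; first exact: cvg_cst.
by apply: cvgM; [exact: cvg_cst|exact: continuous_cosM].
Qed.

Lemma sin_pi_nat b : sin (pi * b%:R) = 0 :> R.
Proof.
elim: b => [|b IH]; first by rewrite mulr0 sin0.
by rewrite -natr1 mulrDr mulr1 sinD IH sinpi; ring.
Qed.

Lemma sin_pi_shift b x : sin (pi * (x - b%:R)) ^+ 2 = sin (pi * x) ^+ 2.
Proof.
rewrite mulrBr sinB sin_pi_nat mulr0 subr0 exprMn cos2sin2 sin_pi_nat expr0n subr0.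
by rewrite mulr1.
Qed.

(** An explicit antiderivative; its oscillating part takes equal values at
    half-integers e - 1 / 2 and e + 1 / 2, so the kernel has mass 1 around
    each integer e. *)
Definition fejer_primitive N x : R := x + 2 * \sum_(1 <= b < N.+1)
  (fejer_wgt N b / (2 * pi * b%:R)) * sin (2 * pi * b%:R * x).

Lemma fejer_primitive_derive N x : is_derive x 1 (fejer_primitive N) (fejer_kernel N x).
Proof.
rewrite /fejer_primitive /fejer_kernel /symsum.
pose h (b : 'I_N) (y : R) : R :=
  (fejer_wgt N b.+1 / (2 * pi * b.+1%:R)) * sin (2 * pi * b.+1%:R * y).
have dh (b : 'I_N) : is_derive x 1 (h b) (fejer_wgt N b.+1 * cos (2 * pi * b.+1%:R * x)).
  have d := is_derive_ZM (fejer_wgt N b.+1 / (2 * pi * b.+1%:R)) (is_derive_sinM (2 * pi *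
    b.+1%:R) x).
  apply: (is_derive_eqr d); rewrite mulrA divfK// !mulf_neq0 ?pnatr_eq0//.
  by rewrite gt_eqF// pi_gt0.
have D := is_deriveD (is_derive_id x (1:R)) (is_derive_ZM 2 (is_derive_sum dh)).
have -> : (fun y => y + 2 * \sum_(1 <= b < N.+1)
    (fejer_wgt N b / (2 * pi * b%:R)) * sin (2 * pi * b%:R * y)) =
    id + (fun y => 2 * (\sum_(b < N) h b) y).
  apply/funext => y /=; congr (_ + 2 * _).
  by rewrite fct_sumE big_add1 /= big_mkord.
apply: (is_derive_eqr D); rewrite /fejer_wgt mul0r subr0 mulr0 mul0r cos0 mulr1;
  congr (_ + 2 * _).
by rewrite big_add1 /= big_mkord.
Qed.

Lemma itv_integrable (f : R -> R) (a b : R) : continuous f ->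
  mu.-integrable `[a, b] (EFin \o f).
Proof.
move=> cf; apply: continuous_compact_integrable; first exact: segment_compact.
exact: continuous_subspaceT.
Qed.

Lemma fejer_kernel_unit N n (e : R) : e = n%:R \/ e = - n%:R ->
  \int[mu]_(x in `[e - 2^-1, e + 2^-1]) fejer_kernel N x = 1.
Proof.
move=> en.
have dF x := fejer_primitive_derive N x.
have ca := is_derive_continuous dF.
rewrite /Rintegral (@continuous_FTC2 _ _ (fejer_primitive N)) /=; last 4 first.
- by lra.
- by apply: continuous_subspaceT; exact: fejer_kernel_cont.
- split; [by move=> x _; exact: ex_derive|..].
  + by apply: cvg_at_right_filter; exact: ca.
  + by apply: cvg_at_left_filter; exact: ca.
- by move=> x _; rewrite derive1E derive_val.
have aux (A B c1 c2 : R) : A = B -> c1 - c2 = 1 -> (c1 + A) - (c2 + B) = 1.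
  by move=> -> <-; ring.
apply: aux; last by field.
congr (2 * _); apply: eq_big_nat => b _; congr (_ * _).
have -> : 2 * pi * b%:R * (e + 2^-1) = 2 * pi * b%:R * e + pi * b%:R by field.
have -> : 2 * pi * b%:R * (e - 2^-1) = 2 * pi * b%:R * e - pi * b%:R by field.
by rewrite sinD sinB sin_pi_nat mulr0 addr0 subr0.
Qed.

(** sin (pi y) = 2 sin t cos t with t = pi y / 2 at most pi / 4, where the
    cosine is at least sqrt (1 / 2); the mean value theorem gives sin t >=
    sqrt (1 / 2) t, so that sin (pi y) >= t, and t >= y as pi >= 2. *)
Lemma sin_ge_linear (y : R) : 0 <= y <= 2^-1 -> y <= sin (pi * y).
Proof.
move=> /andP[y0 y1]; pose t : R := pi * y / 2.
have p2 := pi_ge2 R; have p0 := pi_gt0 R.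
have t0 : 0 <= t by rewrite /t !mulr_ge0// ?pi_ge0// invr_ge0.
have tpi : t <= pi / 4 by rewrite /t; nra.
have c1 (u : R) : 0 <= u -> u <= pi / 4 -> Num.sqrt 2^-1 <= cos u.
  move=> u0 u1.
  have cu : 0 <= cos u by apply: cos_ge0_pihalf; apply/andP; split; lra.
  rewrite -(ler_sqr (x := Num.sqrt _)) ?nnegrE ?sqrtr_ge0// sqr_sqrtr ?invr_ge0//.
  have : 0 <= cos (u *+ 2) by apply: cos_ge0_pihalf; rewrite [u *+ 2]mulr2n; apply/andP; split;
    lra.
  by rewrite cos_mulr2n [_ ^+ 2 *+ 2]mulr2n; lra.
have st : Num.sqrt 2^-1 * t <= sin t.
  move: t0; rewrite le_eqVlt => /predU1P[<-|t0]; first by rewrite mulr0 sin0.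
  have [c /[!in_itv]/= /andP[c0 ct]] := @MVT _ sin cos 0 t t0 (fun x _ => is_derive_sin x)
    (continuous_subspaceT (@continuous_sin R)).
  rewrite sin0 !subr0 => ->; rewrite ler_wpM2r ?(ltW t0)// c1 ?(ltW c0)//.
  by rewrite (le_trans (ltW ct)).
have ct := c1 t t0 tpi.
have -> : pi * y = t + t by rewrite /t; field.
rewrite sinD.
have sq : Num.sqrt 2^-1 * Num.sqrt 2^-1 = 2^-1 :> R by rewrite -expr2 sqr_sqrtr// invr_ge0.
have s0 : 0 <= Num.sqrt 2^-1 :> R by exact: sqrtr_ge0.
have h : Num.sqrt 2^-1 * t * Num.sqrt 2^-1 <= sin t * cos t.
  by rewrite ler_pM// mulr_ge0.
have : Num.sqrt 2^-1 * t * Num.sqrt 2^-1 = t / 2 by rewrite mulrAC sq mulrC.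
rewrite /t in h *; nra.
Qed.

Lemma sin_sqr_ge (y : R) : `|y| <= 2^-1 -> y ^+ 2 <= sin (pi * y) ^+ 2.
Proof.
move=> hy; rewrite -[y ^+ 2]real_normK ?num_real// -[leRHS]real_normK ?num_real//.
have -> : `|sin (pi * y)| = `|sin (pi * `|y|)|.
  by have [//|_] := ger0P y; rewrite mulrN sinN normrN.
have h : `|y| <= sin (pi * `|y|) by apply: sin_ge_linear; rewrite normr_ge0.
by rewrite ler_sqr ?nnegrE// (le_trans h)// ler_norm.
Qed.

(** Use |y| <= d + y ^ 2 / d, y = x - e: the first term meets the mass 1 of
    the kernel, and in the second y ^ 2 <= sin (pi x) ^ 2 cancels the
    denominator of the kernel, leaving at most 1 / N. *)
Lemma fejer_kernel_moment N n (e d : R) : (0 < N)%N -> 0 < d -> e = n%:R \/ e = - n%:R ->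
  \int[mu]_(x in `[e - 2^-1, e + 2^-1]) (`|x - e| * fejer_kernel N x) <= d + (N%:R * d)^-1.
Proof.
move=> N0 d0 en; have NN : 0 < N%:R :> R by rewrite ltr0n.
have se x : sin (pi * (x - e)) ^+ 2 = sin (pi * x) ^+ 2.
  case: en => ->; first exact: sin_pi_shift.
  by rewrite -(sin_pi_shift n (x - - n%:R)); congr (sin (pi * _) ^+ 2); ring.
have cK := @fejer_kernel_cont N.
have I1 : mu.-integrable `[e - 2^-1, e + 2^-1] (EFin \o (fun x => d * fejer_kernel N x)).
  by apply: itv_integrable => x; apply: cvgM; [exact: cvg_cst|exact: cK].
have I2 : mu.-integrable `[e - 2^-1, e + 2^-1] (EFin \o (fun x => (N%:R * d)^-1 * (cst 1 : R ->
  R) x)).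
  by apply: itv_integrable => x; apply: cvgM; exact: cvg_cst.
have J1 : mu.-integrable `[e - 2^-1, e + 2^-1] (EFin \o fejer_kernel N) by exact: itv_integrable.
have J2 : mu.-integrable `[e - 2^-1, e + 2^-1] (EFin \o (cst 1 : R -> R)).
  by apply: itv_integrable => x; exact: cvg_cst.
have -> : d + (N%:R * d)^-1 = \int[mu]_(x in `[e - 2^-1, e + 2^-1])
    (d * fejer_kernel N x + (N%:R * d)^-1 * (cst 1 : R -> R) x).
  rewrite RintegralD// !RintegralZl// (fejer_kernel_unit N en) mulr1; congr (_ + _).
  rewrite Rintegral_cst// mul1r.
  have /= -> := lebesgue_measure_itv `[e - 2^-1, e + 2^-1].
  rewrite lte_fin ifT; last by lra.
  rewrite -EFinB /=; field; rewrite ?gt_eqF//.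
apply: le_Rintegral => //.
- apply: itv_integrable => x; apply: cvgM; last exact: cK.
  by apply: cvg_norm; apply: cvgB; [exact: cvg_id|exact: cvg_cst].
- have := integrableD _ I1 I2; exact.
move=> x /=; rewrite in_itv /= => /andP[x1 x2].
have hx : `|x - e| <= 2^-1 by rewrite ler_norml; lra.
have K0 := fejer_kernel_ge0 x N0.
have k1 : (x - e) ^+ 2 * fejer_kernel N x <= N%:R^-1.
  apply: (@le_trans _ _ (sin (pi * x) ^+ 2 * fejer_kernel N x)).
    by rewrite ler_wpM2r// -se sin_sqr_ge.
  by rewrite fejer_kernel_sin// -[leRHS]mul1r ler_pM2r ?invr_gt0.
have k2 : `|x - e| <= d + (x - e) ^+ 2 / d.
  rewrite -subr_ge0 -(pmulr_lge0 _ d0) -[(x - e) ^+ 2]real_normK ?num_real//.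
  have -> : (d + `|x - e| ^+ 2 / d - `|x - e|) * d = d ^+ 2 + `|x - e| ^+ 2 - `|x - e| * d.
    by field; rewrite gt_eqF.
  by have := normr_ge0 (x - e); nra.
apply: (le_trans (ler_wpM2r K0 k2)).
rewrite mulrDl lerD2l mulr1 invfM mulrAC ler_pM2r ?invr_gt0//.
Qed.

Lemma itv_split (f : R -> R) N : continuous f ->
  \int[mu]_(x in `[- (N%:R + 2^-1), N%:R + 2^-1]) f x =
  \int[mu]_(x in `[0 - 2^-1, 0 + 2^-1]) f x +
  \sum_(1 <= n < N.+1) (\int[mu]_(x in `[n%:R - 2^-1, n%:R + 2^-1]) f x +
    \int[mu]_(x in `[- n%:R - 2^-1, - n%:R + 2^-1]) f x).
Proof.
move=> cf; elim: N => [|N IH].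
  by rewrite big_geq// addr0 sub0r !add0r.
have cut (a b c : R) : a <= b -> b <= c ->
    \int[mu]_(x in `[a, c]) f x = \int[mu]_(x in `[a, b]) f x + \int[mu]_(x in `[b, c]) f x.
  move=> ab bc; have If := itv_integrable a c cf.
  have ab' : (BLeft a <= BRight b)%O by rewrite bnd_simp.
  have bc' : (BRight b <= BRight c)%O by rewrite bnd_simp.
  have := Rintegral_itvB If ab' bc'.
  rewrite Rintegral_itv_obnd_cbnd; first by move=> <-; ring.
  apply: integrableS If => //= y /=; rewrite !in_itv /= => /andP[y0 ->].
  by rewrite andbT (le_trans ab)// ltW.
rewrite big_nat_recr//= addrA -IH.
have hN : 0 <= N%:R :> R by rewrite ler0n.
have E : N.+1%:R = N%:R + 1 :> R by rewrite natr1.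
rewrite (cut _ (- (N%:R + 2^-1)) (N.+1%:R + 2^-1)); [|rewrite E; lra|rewrite E; lra].
rewrite (cut (- (N%:R + 2^-1)) (N%:R + 2^-1) (N.+1%:R + 2^-1)); [|lra|rewrite E; lra].
have -> : N.+1%:R - 2^-1 = N%:R + 2^-1 :> R by rewrite E; field.
have -> : - N.+1%:R + 2^-1 = - (N%:R + 2^-1) :> R by rewrite E; field.
have -> : - N.+1%:R - 2^-1 = - (N.+1%:R + 2^-1) :> R by rewrite E; field.
ring.
Qed.

Definition near_int (n : nat) (e x : R) := (e = n%:R \/ e = - n%:R) /\ `|x - e| <= 2^-1.

(** Around an integer the weight is comparable with its value there, which
    makes the errors of the unit intervals summable. *)
Lemma near_int_wgt_sq n e x : near_int n e x -> wgt_sq x <= 2 * wgt_sq (n%:R : R).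
Proof.
move=> [en xe].
have e2 : e ^+ 2 = n%:R ^+ 2 by case: en => ->//; rewrite sqrrN.
have h : (x - e) ^+ 2 <= 4^-1.
  rewrite -real_normK ?num_real//.
  by rewrite (_ : 4^-1 = 2^-1 ^+ 2 :> R); [rewrite ler_sqr ?nnegrE|field].
rewrite /wgt_sq -[2]invrK -invfM lef_pV2 ?posrE ?mulr_gt0 ?invr_gt0 ?ltr_wpDr ?sqr_ge0//.
rewrite -e2; have := sqr_ge0 (x + (x - e)); nra.
Qed.

(** The kernel is at most 2 N + 1, and beyond N + 1 / 2 one factor of the
    majorant of g is at most N ^ (- 2) while the other one is integrated, so
    what lies outside the unit intervals is O (1 / N). *)
Lemma fejer_split (g : R -> R) B N : (0 < N)%N -> continuous g ->
  (forall x, `|g x| <= B * wgt_sq x ^+ 2) ->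
  `| \int[mu]_x (g x * fejer_kernel N x) -
     (\int[mu]_(x in `[0 - 2^-1, 0 + 2^-1]) (g x * fejer_kernel N x) +
      \sum_(1 <= n < N.+1) (\int[mu]_(x in `[n%:R - 2^-1, n%:R + 2^-1]) (g x * fejer_kernel N x) +
        \int[mu]_(x in `[- n%:R - 2^-1, - n%:R + 2^-1]) (g x * fejer_kernel N x))) |
  <= 3 * pi * B / N%:R.
Proof.
move=> N0 cg gB.
have cf : continuous (fun x => g x * fejer_kernel N x).
  by move=> x; apply: cvgM; [exact: cg|exact: fejer_kernel_cont].
have B0 : 0 <= B.
  by have := le_trans (normr_ge0 _) (gB 0); rewrite pmulr_lge0// exprn_gt0// wgt_sq_gt0.
have NN : 0 < N%:R :> R by rewrite ltr0n.
rewrite -(itv_split _ cf).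
apply: (@le_trans _ _ (B * (2 * N + 1)%:R * pi * wgt_sq (N%:R + 2^-1 : R))).
  apply: Rintegral_tail.
  - by rewrite addr_ge0// invr_ge0.
  - exact: (continuous_measurable_fun cf).
  - move=> x; rewrite normrM mulrAC ler_pM//.
    by rewrite ger0_norm ?fejer_kernel_ge0// fejer_kernel_le.
rewrite [leRHS](_ : _ = B * pi * (3 / N%:R)); last by ring.
rewrite (_ : _ * wgt_sq _ = B * pi * ((2 * N + 1)%:R * wgt_sq (N%:R + 2^-1))); last by ring.
rewrite ler_wpM2l ?mulr_ge0 ?pi_ge0//.
rewrite /wgt_sq ler_pdivrMr ?ltr_wpDr ?sqr_ge0// mulrAC ler_pdivlMr//.
have -> : (2 * N + 1)%:R = 2 * N%:R + 1 :> R by rewrite natrD natrM.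
have : 1 <= N%:R :> R by rewrite ler1n.
nra.
Qed.

Lemma signed_sum_symsum N (h : R -> R) f : h 0 = f 0%N ->
  (forall n, h n%:R = f n) -> (forall n, h (- n%:R) = f n) ->
  h 0 + \sum_(1 <= n < N.+1) (h n%:R + h (- n%:R)) = symsum N f.
Proof.
move=> h0 h1 h2; rewrite h0 /symsum mulr_sumr; congr (_ + _).
by apply: eq_bigr => n _; rewrite h1 h2; ring.
Qed.

Lemma signed_sum_bound N (h : R -> R) f : (forall n e, e = n%:R \/ e = - n%:R -> `|h e| <= f n) ->
  `|h 0 + \sum_(1 <= n < N.+1) (h n%:R + h (- n%:R))| <= symsum N f.
Proof.
move=> hf; rewrite (le_trans (ler_normD _ _))// /symsum lerD//.
  by apply: hf; left.
rewrite (le_trans (ler_norm_sum _ _ _))// mulr_sumr ler_sum// => n _.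
rewrite (le_trans (ler_normD _ _))//.
have := hf n _ (or_introl erefl); have := hf n _ (or_intror erefl); lra.
Qed.

Lemma fejer_unit_bound N n (g : R -> R) (e K : R) : (0 < N)%N -> continuous g ->
  e = n%:R \/ e = - n%:R -> (forall x, `|x - e| <= 2^-1 -> `|g x| <= K) ->
  `|\int[mu]_(x in `[e - 2^-1, e + 2^-1]) (g x * fejer_kernel N x)| <= K.
Proof.
move=> N0 cg en gK.
have mI : @measurable _ (measurableTypeR R) `[e - 2^-1, e +
  2^-1]%classic by exact: measurable_itv.
have cK := @fejer_kernel_cont N.
have I1 : mu.-integrable `[e - 2^-1, e + 2^-1] (EFin \o (fun x => g x * fejer_kernel N x)).
  by apply: itv_integrable => x; apply: cvgM; [exact: cg|exact: cK].
have J1 : mu.-integrable `[e - 2^-1, e + 2^-1] (EFin \o fejer_kernel N) by exact: itv_integrable.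
rewrite (le_trans (le_normr_Rintegral _ I1))//.
rewrite -[leRHS]mulr1 -[X in K * X](fejer_kernel_unit N en) -RintegralZl//.
apply: le_Rintegral => //.
- by have := integrable_norm I1.
- by have := integrableZl mI K J1.
move=> x /=; rewrite in_itv /= => /andP[x1 x2].
rewrite normrM (ger0_norm (fejer_kernel_ge0 x N0)) ler_wpM2r ?fejer_kernel_ge0//.
by apply: gK; rewrite ler_norml; lra.
Qed.

Lemma fejer_unit_approx N n (g : R -> R) (e L d : R) : (0 < N)%N -> continuous g -> 0 <= L ->
  0 < d ->
  e = n%:R \/ e = - n%:R -> (forall x, `|x - e| <= 2^-1 -> `|g x - g e| <= L * `|x - e|) ->
  `|\int[mu]_(x in `[e - 2^-1, e + 2^-1]) (g x * fejer_kernel N x) - g e| <=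
    L * (d + (N%:R * d)^-1).
Proof.
move=> N0 cg L0 d0 en gL.
have mI : @measurable _ (measurableTypeR R) `[e - 2^-1, e +
  2^-1]%classic by exact: measurable_itv.
have cK := @fejer_kernel_cont N.
have I1 : mu.-integrable `[e - 2^-1, e + 2^-1] (EFin \o (fun x => g x * fejer_kernel N x)).
  by apply: itv_integrable => x; apply: cvgM; [exact: cg|exact: cK].
have J1 : mu.-integrable `[e - 2^-1, e + 2^-1] (EFin \o fejer_kernel N) by exact: itv_integrable.
have I2 : mu.-integrable `[e - 2^-1, e + 2^-1] (EFin \o (fun x => g e * fejer_kernel N x)).
  by have := integrableZl mI (g e) J1.
have I3 : mu.-integrable `[e - 2^-1, e + 2^-1] (EFin \o (fun x => `|x - e| * fejer_kernel N x)).
  apply: itv_integrable => x; apply: cvgM; last exact: cK.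
  by apply: cvg_norm; apply: cvgB; [exact: cvg_id|exact: cvg_cst].
have I12 : mu.-integrable `[e - 2^-1, e + 2^-1] (EFin \o (fun x => g x * fejer_kernel N x -
  g e * fejer_kernel N x)).
  by have := integrableB mI I1 I2.
rewrite -[X in _ - X]mulr1 -[X in g e * X](fejer_kernel_unit N en) -RintegralZl// -RintegralB//.
rewrite (le_trans (le_normr_Rintegral _ I12))//.
apply: le_trans (ler_wpM2l L0 (fejer_kernel_moment N0 d0 en)).
rewrite -RintegralZl//; apply: le_Rintegral => //.
- by have := integrable_norm I12.
- by have := integrableZl mI L I3.
move=> x /=; rewrite in_itv /= => /andP[x1 x2].
rewrite -mulrBl normrM (ger0_norm (fejer_kernel_ge0 x N0)) mulrA ler_wpM2r ?fejer_kernel_ge0//.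
by apply: gL; rewrite ler_norml; lra.
Qed.

Lemma pi_le4 : pi <= 4 :> R.
Proof. have [/andP[_]] := @pihalf_02_cos_pihalf R; lra. Qed.

(** Without the Lipschitz hypothesis the kernel still has mass 1 around each
    integer, hence a bound uniform in N. *)
Lemma fejer_bound (g : R -> R) B N : (0 < N)%N -> continuous g ->
  (forall x, `|g x| <= B * wgt_sq x ^+ 2) -> `|\int[mu]_x (g x * fejer_kernel N x)| <= 32 * B.
Proof.
move=> N0 cg gB.
have B0 : 0 <= B.
  by have := le_trans (normr_ge0 _) (gB 0); rewrite pmulr_lge0// exprn_gt0// wgt_sq_gt0.
have := fejer_split N0 cg gB; set I := \int[mu]_x _.
set S := (X in `|_ - X| <= _) => h.
have hS : `|S| <= 20 * B.
  apply: (@le_trans _ _ (symsum N (fun n => 4 * B * wgt_sq (n%:R : R)))).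
    apply: (@signed_sum_bound N (fun e => \int[mu]_(x in `[e - 2^-1, e +
      2^-1]) (g x * fejer_kernel N x))).
    move=> n e en; apply: (fejer_unit_bound N0 cg en) => x xe.
    rewrite (le_trans (gB x))// [_ * B]mulrC -mulrA ler_wpM2l//.
    have hw := near_int_wgt_sq (conj en xe); have w0 := wgt_sq_ge0 x;
      have w1 := wgt_sq_le1 (n%:R : R).
    have wn := wgt_sq_ge0 (n%:R : R); nra.
  rewrite symsumZ [leRHS](_ : _ = 4 * B * 5); last by ring.
  by rewrite ler_wpM2l ?symsum_wgt_sq_le// mulr_ge0.
have N1 : 3 * pi * B / N%:R <= 12 * B.
  rewrite ler_pdivrMr ?ltr0n//.
  have n1 : 1 <= N%:R :> R by rewrite ler1n.
  have := pi_le4; have := pi_ge0 R => p1 p2.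
  apply: (@le_trans _ _ (12 * B)); first nra.
  by rewrite ler_peMr// mulr_ge0.
rewrite -[I](subrK S) (le_trans (ler_normD _ _))//; lra.
Qed.

(** On the unit interval around e the kernel has mass 1 and first absolute
    moment at most d + 1 / (N d), so it replaces g by g e up to that error;
    d = N ^ (- 1 / 2) balances the two terms. *)
Lemma fejer_approx (g : R -> R) B L N : (0 < N)%N -> continuous g -> 0 <= L ->
  (forall x, g (- x) = g x) -> (forall x, `|g x| <= B * wgt_sq x ^+ 2) ->
  (forall n e x, near_int n e x -> `|g x - g e| <= L * wgt_sq (n%:R : R) * `|x - e|) ->
  `|\int[mu]_x (g x * fejer_kernel N x) - symsum N (fun n => g n%:R)| <=
    (12 * B + 10 * L) / Num.sqrt N%:R.
Proof.
move=> N0 cg L0 gN gB gL.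
have B0 : 0 <= B.
  by have := le_trans (normr_ge0 _) (gB 0); rewrite pmulr_lge0// exprn_gt0// wgt_sq_gt0.
set r := Num.sqrt _.
have n1 : 1 <= N%:R :> R by rewrite ler1n.
have r2 : r ^+ 2 = N%:R by rewrite sqr_sqrtr// ler0n.
have r1 : 1 <= r by rewrite -(@ler_sqr R 1 r) ?nnegrE ?sqrtr_ge0// r2 expr1n.
have r0 : 0 < r by lra.
have := fejer_split N0 cg gB; set I := \int[mu]_x _.
set S := (X in `|_ - X| <= _) => h.
(* d = N ^ (- 1 / 2), so that d and 1 / (N d) are equal *)
pose d := r^-1; have d0 : 0 < d by rewrite invr_gt0.
have dE : d + (N%:R * d)^-1 = 2 / r by rewrite /d -r2; field; rewrite gt_eqF.
have hS : `|S - symsum N (fun n => g n%:R)| <= 10 * L / r.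
  rewrite -(@signed_sum_symsum N g (fun n => g n%:R) erefl (fun n => erefl) (fun n => gN _)).
  pose hh e := \int[mu]_(x in `[e - 2^-1, e + 2^-1]) (g x * fejer_kernel N x) - g e.
  rewrite (_ : S - _ = hh 0 + \sum_(1 <= n < N.+1) (hh n%:R + hh (- n%:R))); last first.
    rewrite /S /hh opprD addrACA; congr (_ + _).
    by rewrite -sumrB; apply: eq_bigr => n _; ring.
  apply: (@le_trans _ _ (symsum N (fun n => 2 * L / r * wgt_sq (n%:R : R)))).
    apply: signed_sum_bound => n e en.
    rewrite [leRHS](_ : _ = L * wgt_sq n%:R * (2 / r)); last by ring.
    rewrite -dE; apply: (fejer_unit_approx (n := n)) => //.
      by rewrite mulr_ge0// wgt_sq_ge0.
    by move=> x xe; apply: gL.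
  rewrite symsumZ [leRHS](_ : _ = 2 * L / r * 5); last by ring.
  by rewrite ler_wpM2l ?symsum_wgt_sq_le// divr_ge0 ?mulr_ge0// ltW.
have N1 : 3 * pi * B / N%:R <= 12 * B / r.
  rewrite -r2 ler_pdivrMr ?exprn_gt0// expr2 mulrA divfK ?gt_eqF//.
  have := pi_le4; have := pi_ge0 R => p1 p2.
  apply: (@le_trans _ _ (12 * B)); first nra.
  by rewrite ler_peMr// mulr_ge0.
rewrite (_ : I - _ = (I - S) + (S - symsum N (fun n => g n%:R))); last by ring.
rewrite (le_trans (ler_normD _ _))// mulrDl; lra.
Qed.
End Fejer.

(** * Comparison of lattice sums and Fejer sums, one coordinate after the other *)

Definition lattice_op {R : realType} N (F : R -> R) (s : R) : R :=
  symsum N (fun b => F (s + b%:R ^+ 2)).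
Definition fejer_op {R : realType} N (F : R -> R) (s : R) : R :=
  symsum N (fun b => fejer_wgt N b * line_cos b%:R F s).

(** The sum over v in {- N, ..., N} ^ k of the product of the u |v_i| times a
    (|v| ^ 2), one coordinate at a time: summing over a coordinate b shifts
    the argument of a by b ^ 2. *)
Fixpoint box_sum {R : realType} (N : nat) (u : nat -> R) (k : nat) (a : nat -> R) : R :=
  if k is k'.+1 then symsum N (fun b => u b * box_sum N u k' (fun n => a (n + b ^ 2)%N))
  else a 0%N.

Section Iterate.
Context {R : realType}.
Implicit Types (F G : R -> R) (C s t x : R) (M N n b k : nat) (f g a : nat -> R).
Notation mu := (@lebesgue_measure R).

Lemma lip_decayZ c C M F : lip_decay C M F -> lip_decay (`|c| * C) M (fun s => c * F s).
Proof.
move=> h s t s0 st; have [h1 h2] := h s t s0 st.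
by split; rewrite -?mulrBr normrM -!mulrA ler_wpM2l// !mulrA.
Qed.

Lemma lip_decayD C1 C2 M F G : lip_decay C1 M F -> lip_decay C2 M G ->
  lip_decay (C1 + C2) M (fun s => F s + G s).
Proof.
move=> h g s t s0 st; have [h1 h2] := h s t s0 st; have [g1 g2] := g s t s0 st.
split; first by rewrite mulrDl (le_trans (ler_normD _ _))// lerD.
rewrite opprD addrACA (le_trans (ler_normD _ _))//.
by rewrite -mulrA mulrDl !mulrA lerD.
Qed.

Lemma rapidZ c F : rapid F -> rapid (fun s => c * F s).
Proof. by move=> rF M; have [C hC] := rF M; exists (`|c| * C); exact: lip_decayZ. Qed.

Lemma rapidD F G : rapid F -> rapid G -> rapid (fun s => F s + G s).
Proof.
by move=> rF rG M; have [C hC] := rF M; have [D hD] := rG M; exists (C + D); exact: lip_decayD.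
Qed.

Lemma rapid_symsum N (f : nat -> R -> R) : (forall b, rapid (f b)) ->
  rapid (fun s => symsum N (fun b => f b s)).
Proof.
move=> rf; elim: N => [|N IH].
  by rewrite (_ : (fun s => _) = f 0%N)//; apply/funext => s; rewrite symsum0.
rewrite (_ : (fun s => _) = (fun s => symsum N (fun b => f b s) + 2 * f N.+1 s)).
  by apply: rapidD => //; exact: rapidZ.
by apply/funext => s; rewrite symsumS.
Qed.

Lemma fejer_op_rapid N F : rapid F -> rapid (fejer_op N F).
Proof. by move=> rF; apply: rapid_symsum => b; apply/rapidZ/line_cos_rapid. Qed.

Lemma lip_decay_symsum N (f : nat -> R -> R) (c : nat -> R) (K : R) M :
  (forall b, lip_decay (c b) M (f b)) -> symsum N c <= K ->
  lip_decay K M (fun s => symsum N (fun b => f b s)).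
Proof.
move=> h cK s t s0 st; split.
  apply: (le_trans (symsum_norm _ _)).
  apply: (@le_trans _ _ (symsum N c * wgt s ^+ M)); last by rewrite ler_wpM2r// wgtX_ge0.
  rewrite mulrC -symsumZ; apply: ler_symsum => b _; rewrite mulrC.
  by have [] := h b s t s0 st.
rewrite -symsumB; apply: (le_trans (symsum_norm _ _)).
apply: (@le_trans _ _ (symsum N c * (t - s) * wgt s ^+ M)); last first.
  by rewrite ler_wpM2r ?wgtX_ge0// ler_wpM2r// subr_ge0.
rewrite -mulrA mulrC -symsumZ; apply: ler_symsum => b _; rewrite mulrC mulrA.
by have [] := h b s t s0 st.
Qed.

Lemma lip_decay_shift C M F (e : R) : lip_decay C M.+1 F ->
  lip_decay (C * wgt_sq e) M (fun s => F (s + e ^+ 2)).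
Proof.
move=> h s t s0 st; have C0 := lip_decay_ge0 h.
have se : 0 <= s + e ^+ 2 by rewrite addr_ge0// sqr_ge0.
have [h1 h2] := h (s + e ^+ 2) (t + e ^+ 2) se (lerD st (lexx _)).
have hq := wgtX_sqr e M s0.
split.
  by rewrite (le_trans h1)// -mulrA ler_wpM2l// mulrC.
rewrite (le_trans h2)// opprD addrACA subrr addr0.
rewrite [leRHS](_ : _ = C * (t - s) * (wgt s ^+ M * wgt_sq e)); last by ring.
by rewrite ler_wpM2l// mulr_ge0// subr_ge0.
Qed.

(** The constant does not depend on N: this is what allows
    [fejer_op_lattice_op] to be applied to iterates of the operator. *)
Lemma lattice_op_lip_decay N C M F : lip_decay C M.+1 F -> lip_decay (5 * C) M (lattice_op N F).
Proof.
move=> h; apply: (lip_decay_symsum (c := fun b => C * wgt_sq (b%:R : R))).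
  by move=> b; exact: lip_decay_shift.
by rewrite symsumZ mulrC ler_wpM2r ?symsum_wgt_sq_le// (lip_decay_ge0 h).
Qed.

Lemma fejer_op_integral N C F s : lip_decay C 1 F -> 0 <= s ->
  fejer_op N F s = \int[mu]_x (F (s + x ^+ 2) * fejer_kernel N x).
Proof.
move=> h s0; rewrite /fejer_op /fejer_kernel; move: (fejer_wgt N) => l.
suff H : mu.-integrable setT (EFin \o (fun x => F (s + x ^+ 2) *
      symsum N (fun b => l b * cos (2 * pi * b%:R * x)))) /\
   symsum N (fun b => l b * line_cos b%:R F s) = \int[mu]_x (F (s + x ^+ 2) *
      symsum N (fun b => l b * cos (2 * pi * b%:R * x))) by exact: H.2.
have hb c b : mu.-integrable setT (EFin \o (fun x => F (s + x ^+ 2) *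
      (c * cos (2 * pi * b%:R * x)))) /\
   c * line_cos b%:R F s = \int[mu]_x (F (s + x ^+ 2) * (c * cos (2 * pi * b%:R * x))).
  have I := line_cos_integrable b%:R h s0.
  rewrite (_ : (fun x => _) = (fun x => c * (F (s + x ^+ 2) * cos (2 * pi * b%:R * x)))).
    by split; [have := integrableZl measurableT c I|rewrite RintegralZl].
  by apply/funext => x; rewrite mulrCA.
elim: N => [|N [IH1 IH2]].
  have [i1 i2] := hb (l 0%N) 0%N; split.
    rewrite (_ : (fun x => _) = (fun x => F (s + x ^+ 2) * (l 0%N * cos (2 * pi * 0%:R * x))))//.
    by apply/funext => x; rewrite symsum0.
  by rewrite symsum0 i2; apply: eq_Rintegral => x _; rewrite symsum0.
have [i1 i2] := hb (2 * l N.+1) N.+1.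
rewrite (_ : (fun x => F (s + x ^+ 2) * symsum N.+1 _) = (fun x =>
    F (s + x ^+ 2) * symsum N (fun b => l b * cos (2 * pi * b%:R * x)) +
    F (s + x ^+ 2) * (2 * l N.+1 * cos (2 * pi * N.+1%:R * x)))); last first.
  by apply/funext => x; rewrite symsumS; ring.
split; first by have := integrableD measurableT IH1 i1.
by rewrite RintegralD// -i2 -IH2 symsumS mulrA.
Qed.

Lemma fejer_op_bound N (c : R) G s M : (0 < N)%N -> rapid G -> 0 <= s ->
  (forall t, 0 <= t -> `|G t| <= c * wgt t ^+ M.+2) ->
  `|fejer_op N G s| <= 32 * c * wgt s ^+ M.
Proof.
move=> N0 rG s0 Gc; have [C hC] := rG 1%N; rewrite (fejer_op_integral _ hC)// -mulrA.
have c0 : 0 <= c.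
  have := le_trans (normr_ge0 _) (Gc 0 (lexx _)).
  by rewrite pmulr_lge0// exprn_gt0// wgt_gt0.
apply: (fejer_bound N0 (lip_decay_cont_sq hC s0)) => x.
rewrite (le_trans (Gc _ _)) ?addr_ge0 ?sqr_ge0// -mulrA ler_wpM2l//.
exact: wgtX_sqr2.
Qed.

(** The function x |-> F (s + x ^ 2) satisfies the hypotheses of
    [fejer_approx]: near e the increment of x ^ 2 is at most (2 |e| + 1 / 2)
    |x - e|, and the growing factor is absorbed by one of the two powers of
    the weight. *)
Lemma fejer_op_lattice_op N C F s M : (0 < N)%N -> lip_decay C M.+2 F -> 0 <= s ->
  `|fejer_op N F s - lattice_op N F s| <= 72 * C / Num.sqrt N%:R * wgt s ^+ M.
Proof.
move=> N0 h s0; have C0 := lip_decay_ge0 h.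
have h1 : lip_decay C 1 F by exact: lip_decay_weaken h _ _.
rewrite (fejer_op_integral _ h1)//.
have -> : 72 * C / Num.sqrt N%:R * wgt s ^+ M =
    (12 * (C * wgt s ^+ M) + 10 * (6 * C * wgt s ^+ M)) / Num.sqrt N%:R by ring.
apply: (fejer_approx N0 (g := fun x => F (s + x ^+ 2)) (lip_decay_cont_sq h s0)).
- by rewrite !mulr_ge0 ?wgtX_ge0.
- by move=> x; rewrite sqrrN.
- move=> x; rewrite (le_trans (lip_decay_bound h _)) ?addr_ge0 ?sqr_ge0//.
  by rewrite -mulrA ler_wpM2l//; exact: wgtX_sqr2.
move=> n e x nx; have [en xe] := nx.
have e2 : e ^+ 2 = n%:R ^+ 2 by case: en => ->//; rewrite sqrrN.
have wx := near_int_wgt_sq nx.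
have we : wgt_sq e <= 2 * wgt_sq (n%:R : R).
  by rewrite /wgt_sq e2 ler_peMl ?wgt_sq_ge0// ler1n.
have xe2 : `|x ^+ 2 - e ^+ 2| <= `|x - e| * (2 * n%:R + 2^-1).
  rewrite subr_sqr normrM ler_wpM2l// (_ : x + e = (x - e) + 2 * e); last by ring.
  rewrite (le_trans (ler_normD _ _))// addrC lerD// normrM ger0_norm// ler_pM2l//.
  by case: en => ->; rewrite ?normrN normr_nat.
have main (y z : R) : y ^+ 2 <= z ^+ 2 -> wgt_sq y <= 2 * wgt_sq (n%:R : R) ->
    `|F (s + z ^+ 2) - F (s + y ^+ 2)| <= C * (z ^+ 2 -
      y ^+ 2) * (wgt s ^+ M * (2 * wgt_sq (n%:R : R)) ^+ 2).
  move=> yz wy.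
  have [_ hl] := h (s + y ^+ 2) (s + z ^+ 2) (addr_ge0 s0 (sqr_ge0 y)) (lerD (lexx _) yz).
  rewrite (le_trans hl)// opprD addrACA subrr add0r ler_wpM2l//.
    by rewrite mulr_ge0// subr_ge0.
  rewrite (le_trans (wgtX_sqr2 y M s0))// ler_wpM2l ?wgtX_ge0//.
  by rewrite ler_sqr ?nnegrE ?wgt_sq_ge0// mulr_ge0// wgt_sq_ge0.
apply: (@le_trans _ _ (C * `|x ^+ 2 - e ^+ 2| * (wgt s ^+ M * (2 * wgt_sq (n%:R : R)) ^+ 2))).
  have [le_ex|le_xe] := leP (e ^+ 2) (x ^+ 2).
    by rewrite [X in _ * X * _]ger0_norm ?subr_ge0//; exact: main.
  rewrite distrC [X in _ * X * _]distrC [X in _ * X * _]gtr0_norm ?subr_gt0//.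
  by apply: main => //; exact: ltW.
apply: (@le_trans _ _ (C * (`|x - e| * (2 * n%:R + 2^-1)) * (wgt s ^+ M * (2 * wgt_sq (n%:R :
  R)) ^+ 2))).
  by rewrite ler_wpM2r ?mulr_ge0 ?wgtX_ge0 ?exprn_ge0 ?mulr_ge0 ?wgt_sq_ge0// ler_wpM2l.
rewrite [leLHS](_ : _ = (C * wgt s ^+ M * `|x - e| * wgt_sq (n%:R : R)) *
   (4 * ((2 * n%:R + 2^-1) * wgt_sq (n%:R : R)))); last by ring.
rewrite [leRHS](_ : _ = (C * wgt s ^+ M * `|x - e| * wgt_sq (n%:R : R)) * 6); last by ring.
rewrite ler_wpM2l ?mulr_ge0 ?wgtX_ge0 ?wgt_sq_ge0//.
have : (2 * n%:R + 2^-1) * wgt_sq (n%:R : R) <= 3 / 2.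
  rewrite /wgt_sq ler_pdivrMr ?ltr_wpDr ?sqr_ge0//.
  by have := sqr_ge0 (n%:R - 1 : R); nra.
lra.
Qed.

(** Telescoping: P (P ^ k F) - Q (Q ^ k F) = P (P ^ k F - Q ^ k F) + (P - Q)
    (Q ^ k F), where the first term is estimated by the uniform bound for P
    and the second by the one-step estimate. *)
Lemma iter_fejer_op_lattice_op k F M : rapid F -> exists K, forall N s, (0 < N)%N -> 0 <= s ->
  `|iter k (fejer_op N) F s - iter k (lattice_op N) F s| <= K / Num.sqrt N%:R * wgt s ^+ M.
Proof.
move=> rF; elim: k M => [|k IH] M.
  by exists 0 => N s _ _ /=; rewrite subrr normr0 !mul0r.
(* the bound for the Fejer operator costs two powers of the weight *)
have [K hK] := IH M.+2.
have [C hC] : exists C, forall N, lip_decay C M.+2 (iter k (lattice_op N) F).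
  elim: (k) (M.+2) => [|j IHj] m /=; first by have [C hC] := rF m; exists C.
  by have [C hC] := IHj m.+1; exists (5 * C) => N; exact: lattice_op_lip_decay.
exists (32 * K + 72 * C) => N s N0 s0 /=.
have rP : rapid (iter k (fejer_op N) F) by elim: (k) => //= j; exact: fejer_op_rapid.
have rQ : rapid (iter k (lattice_op N) F).
  elim: (k) => //= j rj m; have [D hD] := rj m.+1; exists (5 * D); exact: lattice_op_lip_decay.
set G := iter k (fejer_op N) F in rP *; set H := iter k (lattice_op N) F in rQ hC *.
have rGH : rapid (fun t => G t + (-1) * H t) by apply: rapidD => //; exact: rapidZ.
(* written as a sum because [rapid] is stable under sums and multiples *)
have PB : fejer_op N G s - fejer_op N H s = fejer_op N (fun t => G t + (-1) * H t) s.
  have [c1 g1] := rP 1%N; have [c2 g2] := rQ 1%N; have [c3 g3] := rGH 1%N.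
  rewrite /fejer_op -symsumB; apply: eq_symsum => b _; rewrite -mulrBr; congr (_ * _).
  rewrite /line_cos -RintegralB//; try exact: line_cos_integrable g1 s0;
    try exact: line_cos_integrable g2 s0.
  by apply: eq_Rintegral => x _; ring.
rewrite -(subrK (fejer_op N H s) (fejer_op N G s)) -addrA (le_trans (ler_normD _ _))//.
rewrite mulrDl mulrDl lerD//; last exact: (fejer_op_lattice_op N0 (hC N) s0).
rewrite PB -[32 * K / _]mulrA; apply: fejer_op_bound => // t t0.
by rewrite mulN1r; exact: hK.
Qed.

Lemma eq_box_sum N u k a a' : a =1 a' -> box_sum N u k a = box_sum N u k a'.
Proof. by move=> aa; congr box_sum; apply/funext. Qed.

Lemma iter_lattice_op_box N k F s : iter k (lattice_op N) F s =
  box_sum N (fun=> 1) k (fun n => F (s + n%:R)).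
Proof.
elim: k s => [|k IH] s /=; first by rewrite addr0.
apply: eq_symsum => b _; rewrite mul1r IH; apply: eq_box_sum => n.
by rewrite natrD natrX addrA addrAC.
Qed.

Lemma rapid_box_sum N u k (f : nat -> R -> R) : (forall n, rapid (f n)) ->
  rapid (fun s => box_sum N u k (fun n => f n s)).
Proof.
elim: k f => [|k IH] f rf //=.
by apply: rapid_symsum => b; apply: rapidZ; exact: (IH (fun n => f (n + b ^ 2)%N)).
Qed.

Lemma line_cosZ r c F s : rapid F -> 0 <= s -> line_cos r (fun t => c * F t) s =
  c * line_cos r F s.
Proof.
move=> /(_ 1%N)[C hC] s0; rewrite /line_cos -RintegralZl//; last exact: line_cos_integrable hC s0.
by apply: eq_Rintegral => x _; rewrite mulrA.
Qed.

Lemma line_cosD r F G s : rapid F -> rapid G -> 0 <= s ->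
  line_cos r (fun t => F t + G t) s = line_cos r F s + line_cos r G s.
Proof.
move=> /(_ 1%N)[C hC] /(_ 1%N)[D hD] s0.
rewrite /line_cos -RintegralD//; [|exact: line_cos_integrable hC s0|exact: line_cos_integrable
  hD s0].
by apply: eq_Rintegral => x _; rewrite mulrDl.
Qed.

Lemma line_cos_symsum r N (f : nat -> R -> R) s : (forall b, rapid (f b)) -> 0 <= s ->
  line_cos r (fun t => symsum N (fun b => f b t)) s = symsum N (fun b => line_cos r (f b) s).
Proof.
move=> rf s0; elim: N => [|N IH].
  by rewrite symsum0; congr line_cos; apply/funext => t; rewrite symsum0.
rewrite (_ : (fun t => _) = (fun t => symsum N (fun b => f b t) + 2 * f N.+1 t)); last first.
  by apply/funext => t; rewrite symsumS.
rewrite line_cosD//; [|exact: rapid_symsum|exact: rapidZ].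
by rewrite IH line_cosZ// symsumS.
Qed.

Lemma line_cos_box r N u k (f : nat -> R -> R) s : (forall n, rapid (f n)) -> 0 <= s ->
  line_cos r (fun t => box_sum N u k (fun n => f n t)) s =
    box_sum N u k (fun n => line_cos r (f n) s).
Proof.
move=> rf s0; elim: k f rf => [|k IH] f rf //=.
rewrite line_cos_symsum//; last by move=> b; apply: rapidZ;
  exact: (rapid_box_sum _ _ _ (fun n => rf _)).
apply: eq_symsum => b _; rewrite line_cosZ//; last exact: (rapid_box_sum _ _ _ (fun n => rf _)).
by rewrite (IH (fun n => f (n + b ^ 2)%N)).
Qed.

(** Each new coordinate b applies A_b to functions A_r G already obtained, and
    the rotation merges both into A_(sqrt (r ^ 2 + b ^ 2)) A_0 G; so the
    result is again a sum over squared radii n. *)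
Lemma iter_fejer_op_box N k F s : rapid F -> 0 <= s ->
  iter k.+1 (fejer_op N) F s =
  box_sum N (fejer_wgt N) k.+1 (fun n => line_cos (Num.sqrt n%:R) (iter k (line_cos 0) F) s).
Proof.
move=> rF s0; have rA j : rapid (iter j (line_cos 0) F) by elim: j => //= j;
  exact: line_cos_rapid.
elim: k s s0 => [|k IH] s s0.
  rewrite /= /fejer_op; apply: eq_symsum => b _; rewrite add0n natrX sqrtr_sqr.
  by rewrite ger0_norm.
rewrite iterS /fejer_op [RHS]/=.
apply: eq_symsum => b _; congr (_ * _).
rewrite (_ : line_cos b%:R (iter k.+1 (fejer_op N) F) s =
  line_cos b%:R (fun t => box_sum N (fejer_wgt N) k.+1 (fun n => line_cos (Num.sqrt n%:R) (iter
    k (line_cos 0) F) t)) s); last first.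
  by apply: eq_Rintegral => x _; rewrite IH// addr_ge0// sqr_ge0.
rewrite line_cos_box//; last by move=> n; exact: line_cos_rapid.
transitivity (box_sum N (fejer_wgt N) k.+1
  (fun n => line_cos (Num.sqrt (n + b ^ 2)%:R) (line_cos 0 (iter k (line_cos 0) F)) s));
    last by [].
apply: eq_box_sum => n; have [C hC] := rA k 2%N.
rewrite (line_cos_rotate _ hC)// ?ler0n// sqr_sqrtr ?ler0n//.
by rewrite natrD natrX addrC.
Qed.
End Iterate.

(** * Sums over boxes of lattice points and the function r_k *)

Section Representations.
Context {R : realType}.
Implicit Types (M N n b k : nat) (f g a u : nat -> R).

(** The indices 0, ..., 2 N represent the integers - N, ..., N, and only
    absolute values matter. *)
Definition ord_dist N (i : 'I_(N.*2.+1)) : nat := `|(i : nat)%:Z - N%:Z|%N.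

Lemma symsum_ord N f : symsum N f = \sum_(i < N.*2.+1) f (ord_dist i).
Proof.
rewrite /symsum -(big_mkord xpredT (fun i => f `|i%:Z - N%:Z|%N)).
have NN : (N <= N.*2.+1)%N by lia.
rewrite (big_cat_nat (leq0n N) NN) /=.
have N1 : (N < N.*2.+1)%N by lia.
rewrite [X in _ = _ + X](big_ltn N1).
have -> : \sum_(0 <= i < N) f `|i%:Z - N%:Z|%N = \sum_(1 <= b < N.+1) f b.
  rewrite big_nat_rev /= [RHS]big_add1 /=; apply: eq_big_nat => i /andP[_ iN].
  by congr f; lia.
have -> : \sum_(N.+1 <= i < N.*2.+1) f `|i%:Z - N%:Z|%N = \sum_(1 <= b < N.+1) f b.
  rewrite -[N.+1]addn0 [in LHS]addnC (_ : N.*2.+1 = (N + N.+1)%N); last by lia.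
  rewrite (_ : (0 + N.+1 = 1 + N)%N) // [(N + N.+1)%N]addnC big_addn addnK addn0.
  by apply: eq_big_nat => i _; congr f; lia.
by rewrite subrr absz0; ring.
Qed.

Lemma ffun_split (T : finType) k (G : {ffun 'I_k.+1 -> T} -> R) :
  \sum_f G f = \sum_(b : T) \sum_(f : {ffun 'I_k -> T})
    G [ffun i => if unlift ord0 i is Some j then f j else b].
Proof.
rewrite pair_big /=.
pose c (p : T * {ffun 'I_k -> T}) : {ffun 'I_k.+1 -> T} :=
  [ffun i => if unlift ord0 i is Some j then p.2 j else p.1].
pose d (f : {ffun 'I_k.+1 -> T}) : T * {ffun 'I_k -> T} :=
  (f ord0, [ffun j => f (lift ord0 j)]).
rewrite (reindex c) //=; exists d => [[b f] _|f _]; rewrite /c /d /=.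
  rewrite ffunE unlift_none; congr (_, _); apply/ffunP => j.
  by rewrite !ffunE liftK.
apply/ffunP => i; rewrite ffunE; case: unliftP => [j ->|->//].
by rewrite ffunE.
Qed.

Definition ord_sqnorm N k (f : {ffun 'I_k -> 'I_(N.*2.+1)}) : nat :=
  (\sum_i ord_dist (f i) ^ 2)%N.

Lemma box_sum_ffun N k a : box_sum N (fun=> 1) k a = \sum_(f : {ffun 'I_k ->
  'I_(N.*2.+1)}) a (ord_sqnorm f).
Proof.
elim: k a => [|k IH] a /=.
  rewrite (big_pred1 [ffun=> ord0]) ?/ord_sqnorm ?big_ord0// => f /=.
  by apply/esym/eqP/ffunP => -[].
rewrite ffun_split symsum_ord; apply: eq_bigr => b _; rewrite mul1r IH.
apply: eq_bigr => f _; congr a; rewrite /ord_sqnorm big_ord_recl ffunE unlift_none addnC.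
by congr (_ + _)%N; apply: eq_bigr => i _; rewrite ffunE liftK.
Qed.

(** A coordinate of a representation of n <= N is at most N in absolute value,
    so the box contains all representations. *)
Lemma r_card_ffun N k n : (n <= N)%N ->
  r_ k n = #|[pred f : {ffun 'I_k -> 'I_(N.*2.+1)} | ord_sqnorm f == n]|.
Proof.
move=> nN.
(* the index i stands for the integer i - N *)
pose emb (f : {ffun 'I_k -> 'I_(N.*2.+1)}) : 'rV[int]_k := \row_i ((f i : nat)%:Z - N%:Z).
have emb_inj : injective emb.
  move=> f g fg; apply/ffunP => i; apply/val_inj.
  have := congr1 (fun m : 'rV[int]_k => m ord0 i) fg; rewrite /emb !mxE => /addIr [].
  by [].
have embE (f : {ffun 'I_k -> 'I_(N.*2.+1)}) : \sum_(i < k) emb f ord0 i ^+ 2 = (ord_sqnorm f)%:Z.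
  rewrite /ord_sqnorm (big_morph Posz PoszD (erefl _)); apply: eq_bigr => i _.
  by rewrite /emb mxE /ord_dist -[RHS]natz natrX natz abszE real_normK ?num_real.
have -> : r_ k n = #|` [fset emb f | f in [pred f : {ffun 'I_k ->
  'I_(N.*2.+1)} | ord_sqnorm f == n]]%fset|.
  rewrite /r_; congr #|` _|; apply/fsetP => m.
  rewrite in_fset_set; last exact: finite_sqsum_reps.
  apply/idP/imfsetP => /=.
    rewrite inE /sqsum_reps /= => mn.
    have le_mn i : (`|m ord0 i| <= N)%N.
      apply: leq_trans nN.
      have le2 : m ord0 i ^+ 2 <= n%:Z.
        by rewrite -mn (bigD1 i)//= lerDl sumr_ge0// => j _; exact: sqr_ge0.
      have : (`|m ord0 i|%N ^ 2 <= n)%N.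
        by rewrite -lez_nat -[X in X <= _]natz natrX natz abszE real_normK ?num_real.
      by apply: leq_trans; rewrite -mulnn; case: `|m ord0 i|%N => // p; rewrite leq_pmulr.
    pose f : {ffun 'I_k -> 'I_(N.*2.+1)} := [ffun i => inord `|(m ord0 i + N%:Z)%R|%N].
    have mf : m = emb f.
      apply/rowP => i; change (m ord0 i = emb f ord0 i); rewrite [RHS]mxE ffunE.
      by move: (m ord0 i) (le_mn i) => z zN; rewrite inordK; lia.
    exists f => //; apply/eqP.
    by have := embE f; rewrite -mf mn => -[].
  move=> [f /eqP fn ->].
  by rewrite inE /sqsum_reps /= embE fn.
by rewrite card_imfset //= -cardE.
Qed.

Lemma box_sum_r N k a : (forall n, (N <= n)%N -> a n = 0) ->
  box_sum N (fun=> 1) k a = \sum_(0 <= n < N) (r_ k n)%:R * a n.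
Proof.
move=> a0; rewrite box_sum_ffun.
have [N0|N0] := posnP N.
  by rewrite [RHS]big_geq ?N0// big1// => f _; rewrite a0// N0.
rewrite (bigID (fun f : {ffun 'I_k -> 'I_(N.*2.+1)} => (ord_sqnorm f < N)%N)) /= [X in _ +
  X]big1 ?addr0; last first.
  by move=> f; rewrite -leqNgt => /a0.
rewrite big_mkord.
case: N N0 a0 => // N _ a0.
rewrite (partition_big (fun f : {ffun 'I_k -> 'I_(N.+1.*2.+1)} => inord (ord_sqnorm f) :
  'I_N.+1) xpredT)//=.
apply: eq_bigr => n _.
rewrite (r_card_ffun k (ltnW (ltn_ord n))) -sum1_card natr_sum mulr_suml.
apply: eq_big => [f|f /andP[fN /eqP <-]].
  rewrite inE; apply/andP/eqP => [[fN /eqP <-]|fn]; first by rewrite inordK.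
  by rewrite fn ltn_ord inord_val eqxx.
by rewrite inordK// mul1r.
Qed.

Lemma r_at0 k : r_ k 0 = 1%N.
Proof.
rewrite (@r_card_ffun 0 k 0)// (eq_card (B := predT)) ?card_ffun ?card_ord ?exp1n// => f.
rewrite !inE /ord_sqnorm big1// => i _.
by rewrite /ord_dist (_ : f i = ord0) ?subrr//; exact: ord1.
Qed.

Lemma ler_box_sum N u k a a' : (forall b, (b <= N)%N -> 0 <= u b) ->
  (forall n, a n <= a' n) -> box_sum N u k a <= box_sum N u k a'.
Proof.
move=> u0; elim: k a a' => [|k IH] a a' aa //=.
by apply: ler_symsum => b bN; rewrite ler_wpM2l ?u0// IH.
Qed.

Lemma box_sum_norm N u k a : (forall b, (b <= N)%N -> 0 <= u b) ->
  `|box_sum N u k a| <= box_sum N u k (fun n => `|a n|).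
Proof.
move=> u0; elim: k a => [|k IH] a //=.
apply: (le_trans (symsum_norm _ _)); apply: ler_symsum => b bN.
by rewrite normrM ger0_norm ?u0// ler_wpM2l ?u0.
Qed.

Lemma box_sum_weight_le N u k a : (forall b, (b <= N)%N -> 0 <= u b <= 1) ->
  (forall n, 0 <= a n) -> 0 <= box_sum N u k a <= box_sum N (fun=> 1) k a.
Proof.
move=> u01; elim: k a => [|k IH] a a0 /=; first by rewrite a0 lexx.
apply/andP; split.
  apply: symsum_ge0 => b bN; have /andP[u0 _] := u01 b bN.
  by rewrite mulr_ge0//; have /andP[] := IH (fun n => a (n + b ^ 2)%N) (fun n => a0 _).
apply: ler_symsum => b bN; have /andP[u0 u1] := u01 b bN.
have /andP[h0 h1] := IH (fun n => a (n + b ^ 2)%N) (fun n => a0 _).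
by rewrite ler_pM.
Qed.

Lemma box_sumZ N u k c a : box_sum N u k (fun n => c * a n) = c * box_sum N u k a.
Proof.
elim: k a => [|k IH] a //=; rewrite -symsumZ; apply: eq_symsum => b _.
by rewrite IH mulrCA.
Qed.

Lemma box_sumD N u k a a' : box_sum N u k (fun n => a n + a' n) =
  box_sum N u k a + box_sum N u k a'.
Proof.
elim: k a a' => [|k IH] a a' //=; rewrite -symsumD; apply: eq_symsum => b _.
by rewrite IH mulrDr.
Qed.

(** One power of the weight pays for the sum over one coordinate, as in
    [wgtX_sqr]. *)
Lemma box_sum_wgt N k M (s : R) : 0 <= s ->
  box_sum N (fun=> 1) k (fun n => wgt (s + n%:R) ^+ (k + M)) <= 5 ^+ k * wgt s ^+ M.
Proof.
elim: k M s => [|k IH] M s s0 /=; first by rewrite addr0 mul1r.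
apply: (@le_trans _ _ (symsum N (fun b => 5 ^+ k * wgt s ^+ M * wgt_sq (b%:R : R)))).
  apply: ler_symsum => b _; rewrite mul1r.
  have sb : 0 <= s + b%:R ^+ 2 by rewrite addr_ge0// sqr_ge0.
  rewrite (@eq_box_sum R N (fun=> 1) k _ (fun n => wgt (s + b%:R ^+ 2 + n%:R) ^+ (k + M.+1))).
    apply: (le_trans (IH M.+1 _ sb)); rewrite -mulrA ler_wpM2l ?exprn_ge0//.
    exact: wgtX_sqr.
  by move=> n; rewrite addnS natrD natrX addrA addrAC.
rewrite symsumZ exprS [leRHS](_ : _ = 5 ^+ k * wgt s ^+ M * 5); last by ring.
by rewrite ler_wpM2l ?symsum_wgt_sq_le// mulr_ge0 ?wgtX_ge0 ?exprn_ge0.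
Qed.

(** The relative error 1 - (1 - |b| / N) = |b| / N of one coordinate is at
    most b ^ 2 / N, and these add up to |v| ^ 2 / N. *)
Lemma box_sum_fejer_err N k a : (0 < N)%N ->
  `|box_sum N (fun=> 1) k a - box_sum N (fejer_wgt N) k a| <=
  N%:R^-1 * box_sum N (fun=> 1) k (fun n => n%:R * `|a n|).
Proof.
move=> N0; elim: k a => [|k IH] a /=; first by rewrite subrr normr0 mul0r mulr0.
rewrite -symsumB -symsumZ (le_trans (symsum_norm _ _))//.
apply: ler_symsum => b bN; rewrite !mul1r.
set ab := fun n => a (n + b ^ 2)%N.
have l01 c : (c <= N)%N -> 0 <= (fejer_wgt N c : R) <= 1.
  by move=> cN; rewrite fejer_wgt_ge0 ?fejer_wgt_le1.
have l0 c : (c <= N)%N -> 0 <= (fejer_wgt N c : R) by move=> cN; rewrite fejer_wgt_ge0.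
rewrite (_ : _ - _ = (box_sum N (fun=> 1) k ab - box_sum N (fejer_wgt N) k ab) +
   (1 - fejer_wgt N b) * box_sum N (fejer_wgt N) k ab); last by ring.
rewrite (le_trans (ler_normD _ _))//.
rewrite (@eq_box_sum R N _ k (fun n => (n + b ^ 2)%:R * `|a (n + b ^ 2)%N|)
  (fun n => n%:R * `|ab n| + (b ^ 2)%:R * `|ab n|)); last first.
  by move=> n; rewrite natrD mulrDl.
rewrite box_sumD box_sumZ mulrDr lerD ?IH// normrM.
have b2 : `|1 - fejer_wgt N b| <= N%:R^-1 * (b ^ 2)%:R :> R.
  rewrite /fejer_wgt opprB addrCA subrr addr0 ger0_norm ?divr_ge0// mulrC ler_wpM2l ?invr_ge0//.
  by rewrite ler_nat; case: (b) => // c; rewrite -mulnn leq_pmulr.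
rewrite mulrA ler_pM// (le_trans (box_sum_norm _ _ l0))//.
by have /andP[] := box_sum_weight_le k l01 (fun n => normr_ge0 (ab n)).
Qed.

Lemma box_sum_bound N k a C : (forall n, `|a n| <= C * wgt (n%:R : R) ^+ k) ->
  box_sum N (fun=> 1) k (fun n => `|a n|) <= C * 5 ^+ k.
Proof.
move=> aC; have C0 : 0 <= C.
  have := le_trans (normr_ge0 _) (aC 0%N).
  by rewrite pmulr_lge0// exprn_gt0// wgt_gt0.
apply: (@le_trans _ _ (box_sum N (fun=> 1) k (fun n => C * wgt (n%:R : R) ^+ k))).
  exact: ler_box_sum.
rewrite box_sumZ ler_wpM2l//; have := @box_sum_wgt N k 0 0 (lexx 0).
rewrite addn0 expr0 mulr1; apply: le_trans.
by rewrite (@eq_box_sum R N _ k _ (fun n => wgt (0 + n%:R) ^+ k))// => n; rewrite add0r.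
Qed.

(** Squared radii below N are fully represented in the box; those at least N
    are controlled by one spare power of the weight. *)
Lemma box_sum_trunc N k a C : (forall n, `|a n| <= C * wgt (n%:R : R) ^+ k.+1) ->
  `|box_sum N (fun=> 1) k a - \sum_(0 <= n < N) (r_ k n)%:R * a n| <= C * 5 ^+ k * wgt N%:R.
Proof.
move=> aC; have C0 : 0 <= C.
  have := le_trans (normr_ge0 _) (aC 0%N).
  by rewrite pmulr_lge0// exprn_gt0// wgt_gt0.
pose a1 n := if (n < N)%N then a n else 0.
pose a2 n := if (n < N)%N then 0 else a n.
have -> : \sum_(0 <= n < N) (r_ k n)%:R * a n = box_sum N (fun=> 1) k a1.
  rewrite box_sum_r; last by move=> n nN; rewrite /a1 ltnNge nN.
  by apply: eq_big_nat => n /andP[_ nN]; rewrite /a1 nN.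
rewrite (@eq_box_sum R N _ k a (fun n => a1 n + a2 n)); last first.
  by move=> n; rewrite /a1 /a2; case: ifP => _; rewrite ?addr0 ?add0r.
rewrite box_sumD addrAC subrr add0r (le_trans (box_sum_norm _ _ _))//.
rewrite mulrAC; apply: box_sum_bound => n.
rewrite /a2; case: ifPn => [_|]; first by rewrite normr0 !mulr_ge0 ?exprn_ge0 ?wgt_ge0.
rewrite -leqNgt => nN; rewrite (le_trans (aC n))// exprS -!mulrA ler_wpM2l//.
by rewrite ler_wpM2r ?wgtX_ge0// wgt_le// ler_nat.
Qed.

Lemma series_r_cvg k a C : (forall n, `|a n| <= C * wgt (n%:R : R) ^+ k) ->
  cvgn (series (fun n => (r_ k n)%:R * a n)).
Proof.
move=> aC; apply: normed_cvg.
apply: nondecreasing_is_cvgn.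
  by apply/nondecreasing_seqP => n; rewrite [leRHS]/series /= big_nat_recr//= lerDl.
exists (C * 5 ^+ k) => _ [N _ <-]; rewrite /series /=.
pose a1 n := if (n < N)%N then a n else 0.
apply: (@le_trans _ _ (box_sum N (fun=> 1) k (fun n => `|a1 n|))).
  rewrite box_sum_r; last by move=> n nN; rewrite /a1 ltnNge nN normr0.
  rewrite le_eqVlt; apply/orP; left; apply/eqP; apply: eq_big_nat => n /andP[_ nN].
  by rewrite /a1 nN normrM normr_nat.
apply: box_sum_bound => n; rewrite /a1; case: ifP => // _.
by rewrite normr0 (le_trans _ (aC n)).
Qed.

Lemma cvg_box_sum k a C : (forall n, `|a n| <= C * wgt (n%:R : R) ^+ k.+1) ->
  box_sum N (fun=> 1) k a @[N --> \oo] --> limn (series (fun n => (r_ k n)%:R * a n)).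
Proof.
move=> aC; have C0 : 0 <= C.
  have := le_trans (normr_ge0 _) (aC 0%N).
  by rewrite pmulr_lge0// exprn_gt0// wgt_gt0.
have aC' n : `|a n| <= C * wgt (n%:R : R) ^+ k.
  by rewrite (le_trans (aC n))// ler_wpM2l// wgtX_le_exp.
have cs := series_r_cvg aC'.
rewrite (_ : (fun N => _) = (fun N => (box_sum N (fun=> 1) k a -
  series (fun n => (r_ k n)%:R * a n) N)
   + series (fun n => (r_ k n)%:R * a n) N)); last by apply/funext => N; rewrite subrK.
rewrite -[X in _ --> X]add0r; apply: cvgD => //.
apply/norm_cvg0P; apply: (@squeeze_cvgr _ _ _ _ (cst 0) (fun N => C * 5 ^+ k * wgt N%:R)).
- apply: nearW => N; rewrite normr_ge0 /= seriesEnat; exact: box_sum_trunc.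
- exact: cvg_cst.
rewrite -[X in _ --> X](mulr0 (C * 5 ^+ k)); apply: cvgM; first exact: cvg_cst.
rewrite /wgt; under eq_fun do rewrite nat1r; exact: cvg_harmonic.
Qed.

Lemma cvg_box_sum_fejer k a C : (forall n, `|a n| <= C * wgt (n%:R : R) ^+ k.+1) ->
  box_sum N (fejer_wgt N) k a @[N --> \oo] --> limn (series (fun n => (r_ k n)%:R * a n)).
Proof.
move=> aC; have C0 : 0 <= C.
  have := le_trans (normr_ge0 _) (aC 0%N).
  by rewrite pmulr_lge0// exprn_gt0// wgt_gt0.
rewrite (_ : (fun N => _) = (fun N => box_sum N (fun=> 1) k a -
   (box_sum N (fun=> 1) k a - box_sum N (fejer_wgt N) k a))); last by apply/funext => N; ring.
rewrite -[X in _ --> X]subr0; apply: cvgB; first exact: cvg_box_sum aC.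
apply/norm_cvg0P.
apply: (@squeeze_cvgr _ _ _ _ (cst 0) (fun N => C * 5 ^+ k * (N%:R^-1 : R))); last 2 first.
- exact: cvg_cst.
- rewrite -[X in _ --> X](mulr0 (C * 5 ^+ k)); apply: cvgM; first exact: cvg_cst.
  by rewrite -(cvg_shiftS (fun n => n%:R^-1 : R)); exact: cvg_harmonic.
near=> N; rewrite normr_ge0 /=.
have N0 : (0 < N)%N by near: N; exact: nbhs_infty_gt.
rewrite (le_trans (box_sum_fejer_err k a N0))// mulrC ler_wpM2r ?invr_ge0//.
rewrite (@eq_box_sum R N _ k _ (fun n => `|n%:R * a n|)); last first.
  by move=> n; rewrite normrM normr_nat.
apply: box_sum_bound => n; rewrite normrM normr_nat.
apply: (@le_trans _ _ (n%:R * (C * wgt n%:R ^+ k.+1))); first by rewrite ler_wpM2l.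
rewrite exprS [leLHS](_ : _ = C * wgt n%:R ^+ k * (n%:R * wgt n%:R)); last by ring.
by rewrite ler_piMr ?mulr_ge0 ?wgtX_ge0// /wgt ler_pdivrMr ?ltr_wpDr// mul1r lerDr.
Unshelve. all: by end_near. Qed.
End Representations.

(** * The function u (sqrt s) / sqrt s for an odd Schwartz function u *)

(** The function F with u x = x * F (x ^ 2) for an odd u; the value at 0 is
    the limit. *)
Definition sqrt_quotient {R : realType} (u : R -> R) (s : R) : R :=
  if s == 0 then derive1 u 0 else u (Num.sqrt s) / Num.sqrt s.

Section SqrtQuotient.
Context {R : realType}.
Implicit Types (u f : R -> R) (B C D s t x y : R) (M n : nat).

Lemma mean_value_le f f' x B : (forall y, is_derive y 1 f (f' y)) -> 0 <= x ->
  (forall y, 0 <= y <= x -> `|f' y| <= B) -> `|f x - f 0| <= B * x.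
Proof.
move=> fd x0 fB.
have [c cx ->] := @MVT_segment _ f f' 0 x x0 (fun y _ => fd y)
  (continuous_subspaceT (is_derive_continuous fd)).
rewrite subr0 normrM (ger0_norm x0) ler_wpM2r//.
by apply: fB; move: cx; rewrite in_itv.
Qed.

Lemma derive1_odd u x : (forall y, derivable u y 1) -> (forall y, u (- y) = - u y) ->
  derive1 u (- x) = derive1 u x.
Proof.
move=> du ou.
have h : is_derive x 1 (fun y => - u (- y)) (derive1 u (- x)).
  have dN : is_derive x 1 (fun y : R => - y) (- 1) by exact: is_deriveN.
  have du' : is_derive (- x) 1 u (derive1 u (- x)) by exact: derivable_is_derive1.
  apply: (is_derive_eqr (is_deriveN (is_derive1_comp du' dN))).
  by rewrite mulrN1 opprK.
rewrite (_ : (fun y => _) = u) in h; last by apply/funext => y; rewrite ou opprK.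
by rewrite [RHS]derive1E; apply/esym; have := @derive_val _ _ _ _ _ _ _ h.
Qed.

Lemma derive1_even u x : (forall y, derivable u y 1) -> (forall y, u (- y) = u y) ->
  derive1 u (- x) = - derive1 u x.
Proof.
move=> du ou.
have h : is_derive x 1 (fun y => u (- y)) (- derive1 u (- x)).
  have dN : is_derive x 1 (fun y : R => - y) (- 1) by exact: is_deriveN.
  have du' : is_derive (- x) 1 u (derive1 u (- x)) by exact: derivable_is_derive1.
  apply: (is_derive_eqr (is_derive1_comp du' dN)).
  by rewrite mulrN1.
rewrite (_ : (fun y => _) = u) in h; last by apply/funext => y; rewrite ou.
apply/oppr_inj; rewrite opprK [RHS]derive1E.
by have := @derive_val _ _ _ _ _ _ _ h => <-.
Qed.

(** Near 0 the bound by x ^ n is used, far away the decay of f, and 1 + x ^ 2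
    is between 1 and 2 on [0, 1]. *)
Lemma quotient_dom_wgt f n M C D x : 0 < x ->
  (forall y, 0 <= y <= 1 -> `|f y| <= D * y ^+ n) ->
  (forall y, `|f y| <= C * wgt_sq y ^+ M) ->
  `|f x| / x ^+ n <= (D * 2 ^+ M + C) * wgt (x ^+ 2) ^+ M.
Proof.
move=> x0 fD fC.
have D0 : 0 <= D.
  have := le_trans (normr_ge0 _) (fD 1 _); rewrite expr1n mulr1; apply.
  by rewrite ler01 lexx.
have C0 : 0 <= C.
  have := le_trans (normr_ge0 _) (fC 0).
  by rewrite pmulr_lge0// exprn_gt0// wgt_sq_gt0.
have w0 : 0 <= wgt_sq x ^+ M by rewrite exprn_ge0 ?wgt_sq_ge0.
rewrite ler_pdivrMr ?exprn_gt0//.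
have [x1|x1] := leP x 1.
  apply: (@le_trans _ _ (D * x ^+ n)); first by rewrite fD// x1 ltW.
  rewrite ler_wpM2r ?exprn_ge0 ?(ltW x0)// -/(wgt_sq x).
  apply: (@le_trans _ _ (D * 2 ^+ M * wgt_sq x ^+ M)); last by rewrite ler_wpM2r// lerDl.
  rewrite -mulrA -exprMn ler_peMr// exprn_ege1// /wgt_sq ler_pdivlMr ?mul1r.
    by rewrite -[leRHS]/(1 + 1) lerD2l expr_le1// ltW.
  by rewrite ltr_wpDr// sqr_ge0.
apply: (le_trans (fC x)); apply: (@le_trans _ _ ((D * 2 ^+ M + C) * wgt_sq x ^+ M)).
  by rewrite ler_wpM2r// lerDr mulr_ge0// exprn_ge0.
rewrite -/(wgt_sq x) ler_peMr ?exprn_ege1 ?(ltW x1)// mulr_ge0// addr_ge0// mulr_ge0// exprn_ge0.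
Qed.

Lemma is_derive_sqrt_quotient u s : (forall y, derivable u y 1) -> 0 < s ->
  is_derive s 1 (fun s => u (Num.sqrt s) / Num.sqrt s)
    ((Num.sqrt s * derive1 u (Num.sqrt s) - u (Num.sqrt s)) / (2 * Num.sqrt s ^+ 3)).
Proof.
move=> du s0; have r0 : Num.sqrt s != 0 by rewrite gt_eqF// sqrtr_gt0.
have ds : is_derive s 1 Num.sqrt ((2 * Num.sqrt s)^-1) by exact: is_derive1_sqrt.
have du' : is_derive (Num.sqrt s) 1 u (derive1 u (Num.sqrt s)).
  exact: derivable_is_derive1.
have d1 := is_derive1_comp du' ds.
have d2 : is_derive s 1 (fun s => (Num.sqrt s)^-1) (- (Num.sqrt s) ^- 2 * (2 * Num.sqrt s)^-1).
  exact: (is_deriveV r0 ds).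
apply: (is_derive_eqr (is_deriveM d1 d2)).
rewrite /GRing.scale /=; move: (Num.sqrt s) (derive1 u _) (u _) r0 => r a b r0.
by field.
Qed.

Section Odd.
Variables (u : R -> R).
Hypotheses (ru : rschwartz u) (ou : forall x, u (- x) = - u x).

Let su : smooth u. Proof. by case: ru. Qed.
Let d1 : R -> R := derive1 u.
Let d2 : R -> R := derive1 d1.
Let d3 : R -> R := derive1 d2.

Let u0 : u 0 = 0.
Proof. by have := ou 0; rewrite oppr0; lra. Qed.

Let is_d0 y : is_derive y 1 u (d1 y). Proof. exact: (smooth_is_derive0 y su). Qed.
Let is_d1 y : is_derive y 1 d1 (d2 y).
Proof. exact: (smooth_is_derive0 y (smooth_derive1 su)). Qed.
Let is_d2 y : is_derive y 1 d2 (d3 y).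
Proof. exact: (smooth_is_derive0 y (smooth_derive1 (smooth_derive1 su))). Qed.

Let d20 : d2 0 = 0.
Proof.
have e1 x : d1 (- x) = d1 x := derive1_odd x (@su 0%N) ou.
have := @derive1_even d1 0 (@smooth_derive1 _ _ su 0%N) e1.
by rewrite oppr0 -/d2; lra.
Qed.

Let bounded_deriv : exists2 B : R, 0 <= B & forall y, `|d1 y| <= B /\ `|d3 y| <= B.
Proof.
have [C1 h1] := proj2 ru 0%N 1%N; have [C3 h3] := proj2 ru 0%N 3%N.
exists (Num.max C1 C3 : R) => [|y]; last first.
  by have := h1 y; have := h3 y; rewrite !expr0 !mul1r !le_max => -> ->; rewrite orbT.
by have := h1 0; rewrite expr0 mul1r le_max => /(le_trans (normr_ge0 _)) ->.
Qed.

Let d2_le B x : (forall y, `|d1 y| <= B /\ `|d3 y| <= B) -> 0 <= x -> `|d2 x| <= B * x.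
Proof.
move=> hB x0; rewrite -[d2 x]subr0 -d20; apply: mean_value_le is_d2 x0 _ => y _.
by case: (hB y).
Qed.

Lemma sqrt_quotientE x : x * sqrt_quotient u (x ^+ 2) = u x.
Proof.
rewrite /sqrt_quotient sqrf_eq0; have [->|x0] := eqVneq x 0; first by rewrite mul0r u0.
rewrite sqrtr_sqr; have [h|h] := leP 0 x.
  by rewrite ger0_norm// mulrC divfK.
by rewrite ltr0_norm// ou invrN mulrNN mulrC divfK.
Qed.

Lemma sqrt_quotient_bound M : exists C, forall s, 0 <= s ->
  `|sqrt_quotient u s| <= C * wgt s ^+ M.
Proof.
have [B B0 hB] := bounded_deriv; have [C hC] := rschwartz_dom M ru.
have C0 : 0 <= C.
  have := le_trans (normr_ge0 _) (hC 0).
  by rewrite pmulr_lge0// exprn_gt0// wgt_sq_gt0.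
exists (B * 2 ^+ M + C) => s s0; rewrite /sqrt_quotient; case: eqVneq => [->|sn0].
  rewrite /wgt addr0 invr1 expr1n mulr1; have [h _] := hB 0; rewrite (le_trans h)//.
  by rewrite (@le_trans _ _ (B * 2 ^+ M))// ?lerDl// ler_peMr// exprn_ege1// ler1n.
have x0 : 0 < Num.sqrt s by rewrite sqrtr_gt0 lt_neqAle eq_sym sn0.
rewrite normrM normfV (gtr0_norm x0) -{3}(sqr_sqrtr s0) -[X in _ / X]expr1.
apply: quotient_dom_wgt => // y /andP[y0 _]; rewrite expr1.
by rewrite -[u y]subr0 -u0; apply: mean_value_le is_d0 y0 _ => z _; case: (hB z).
Qed.

(** The increment is (u x - x u' 0) / x with x = sqrt t, and the numerator is
    O (x ^ 3) because u'' vanishes at 0 for an odd u. *)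
Lemma sqrt_quotient_near0 : exists C, forall t, 0 <= t ->
  `|sqrt_quotient u t - sqrt_quotient u 0| <= C * t.
Proof.
have [B B0 hB] := bounded_deriv; exists B => t t0.
rewrite /sqrt_quotient eqxx; case: eqVneq => [->|tn0]; first by rewrite subrr normr0 mulr0.
have x0 : 0 < Num.sqrt t by rewrite sqrtr_gt0 lt_neqAle eq_sym tn0.
rewrite -{3}(sqr_sqrtr t0); move: (Num.sqrt t) x0 => x x0.
pose g y := u y - y * d1 0.
have dg y : is_derive y 1 g (d1 y - d1 0).
  have h : is_derive y 1 (fun y : R => y * d1 0) (d1 0).
    apply: (is_derive_eqr (is_deriveM (is_derive_id y 1) (is_derive_cst (d1 0) y 1))).
    by rewrite /GRing.scale/= mulr0 add0r mulr1.
  exact: is_deriveB.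
have -> : u x / x - derive1 u 0 = (g x - g 0) / x.
  by rewrite /g u0 mul0r !subr0 mulrBl mulrAC divff ?mul1r// gt_eqF.
rewrite normrM normfV (gtr0_norm x0) ler_pdivrMr//.
apply: (mean_value_le dg (ltW x0)) => y /andP[y0 yx].
rewrite expr2 mulrA; apply: (@le_trans _ _ (B * x * y));
  last by rewrite ler_wpM2l// mulr_ge0// ltW.
apply: (mean_value_le is_d1 y0) => z /andP[z0 zy].
by rewrite (le_trans (d2_le hB z0))// ler_wpM2l// (le_trans zy).
Qed.

(** By the mean value theorem: the derivative is h x / (2 x ^ 3) at x = sqrt
    s, with h x = x u' x - u x.  As h' x = x u'' x and u'' 0 = 0, h is O
    (x ^ 3) near 0, so the derivative stays bounded there; h decays rapidly at
    infinity. *)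
Lemma sqrt_quotient_lip M : exists C, forall s t, 0 < s -> s <= t ->
  `|sqrt_quotient u t - sqrt_quotient u s| <= C * (t - s) * wgt s ^+ M.
Proof.
have [B B0 hB] := bounded_deriv.
pose h y := y * d1 y - u y.
have rh : rschwartz (fun y => y * d1 y) by apply: rschwartz_xM; exact: rschwartz_derive1.
have [C1 hC1] := rschwartz_dom M rh; have [C2 hC2] := rschwartz_dom M ru.
have hw y : `|h y| <= (C1 + C2) * wgt_sq y ^+ M.
  by rewrite (le_trans (ler_normB _ _))// mulrDl lerD.
have h3 y : 0 <= y <= 1 -> `|h y| <= B * y ^+ 3.
  move=> /andP[y0 _].
  have dh (z : R) : is_derive z 1 h (z * d2 z).
    have k : is_derive z 1 (fun z : R => z * d1 z) (d1 z + z * d2 z).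
      by apply: (is_derive_eqr (is_derive_xM (is_d1 z))); ring.
    by apply: (is_derive_eqr (is_deriveB k (is_d0 z))); ring.
  have -> : h y = h y - h 0 by rewrite /h u0 mul0r !subr0.
  rewrite exprSr mulrA; apply: (mean_value_le dh y0) => z /andP[z0 zy].
  rewrite normrM (ger0_norm z0) expr2 mulrCA ler_pM//.
  by rewrite (le_trans (d2_le hB z0))// ler_wpM2l.
have C0 : 0 <= C1 + C2.
  have := le_trans (normr_ge0 _) (hw 0).
  by rewrite pmulr_lge0// exprn_gt0// wgt_sq_gt0.
set C := B * 2 ^+ M + (C1 + C2).
have CC0 : 0 <= C by rewrite addr_ge0// mulr_ge0// exprn_ge0.
exists C => s t s0 st; have t0 : 0 < t by exact: lt_le_trans st.
rewrite /sqrt_quotient !gt_eqF//.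
pose f s := u (Num.sqrt s) / Num.sqrt s.
pose f' s := h (Num.sqrt s) / (2 * Num.sqrt s ^+ 3).
have df (z : R) : 0 < z -> is_derive z 1 f (f' z).
  by move=> z0; apply: is_derive_sqrt_quotient => // y; exact: (@su 0%N).
have df' z : z \in `]s, t[%R -> is_derive z 1 f (f' z).
  by rewrite in_itv/= => /andP[sz _]; exact: df (lt_trans s0 sz).
have cf : {within `[s, t], continuous f}.
  apply: derivable_within_continuous => z; rewrite in_itv/= => /andP[sz _].
  by have [] := df z (lt_le_trans s0 sz).
have [c /[!in_itv]/= /andP[sc ct] ->] := @MVT_segment _ f f' s t st df' cf.
have c0 : 0 < c by exact: lt_le_trans sc.
rewrite normrM [ `|t - s|]ger0_norm ?subr_ge0// mulrAC ler_wpM2r ?subr_ge0//.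
apply: (@le_trans _ _ (C * wgt c ^+ M)); last by rewrite ler_wpM2l// wgtX_le// ltW.
rewrite -{2}(sqr_sqrtr (ltW c0)).
have x0 : 0 < Num.sqrt c by rewrite sqrtr_gt0.
apply: le_trans (quotient_dom_wgt x0 h3 hw).
rewrite /f' invfM normrM normrM !normfV [ `|2|]ger0_norm// [ `|_ ^+ 3|]ger0_norm ?exprn_ge0
  ?(ltW x0)//.
rewrite ler_wpM2l// ler_piMl ?invr_ge0 ?exprn_ge0 ?(ltW x0)//.
by rewrite invf_le1// ler1n.
Qed.

Lemma sqrt_quotient_rapid : rapid (sqrt_quotient u).
Proof.
move=> M; have [C1 h1] := sqrt_quotient_bound M; have [C2 h2] := sqrt_quotient_near0.
have [C3 h3] := sqrt_quotient_lip M.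
exists (Num.max C1 (Num.max C2 C3)) => s t s0 st; split.
  by rewrite (le_trans (h1 s s0))// ler_wpM2r ?wgtX_ge0// le_max lexx.
have ts : 0 <= (t - s) * wgt s ^+ M by rewrite mulr_ge0 ?subr_ge0 ?wgtX_ge0.
rewrite -mulrA; move: s0; rewrite le_eqVlt => /orP[/eqP s0|s0].
  rewrite -s0 subr0 /wgt addr0 invr1 expr1n mulr1 (le_trans (h2 t _)) ?s0//.
  by rewrite ler_wpM2r ?s0// !le_max lexx orbT.
rewrite (le_trans (h3 s t s0 st))// -mulrA ler_wpM2r// !le_max lexx !orbT//.
Qed.

End Odd.
End SqrtQuotient.

(** * The summation formula for real odd Schwartz functions *)

Section RealFormula.
Context {R : realType}.
Implicit Types (f g u F : R -> R) (C s t x r : R) (n m M : nat).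

Lemma rschwartz_sin_tr u : rschwartz u -> rschwartz (sin_tr u).
Proof.
by move=> ru; split; [exact: sin_tr_smooth|move=> M n; exact: (sin_tr_decay n M ru)].
Qed.

Lemma rschwartz_derive1n u n : rschwartz u -> rschwartz (derive1n n u).
Proof. by move=> ru; elim: n => //= n; exact: rschwartz_derive1. Qed.

Lemma rschwartz_XM u n : rschwartz u -> rschwartz (fun x => x ^+ n * u x).
Proof.
move=> ru; elim: n => [|n IH].
  by rewrite (_ : (fun x => _) = u)//; apply/funext => x; rewrite expr0 mul1r.
rewrite (_ : (fun x => _) = (fun x => x * (x ^+ n * u x))); first exact: rschwartz_xM.
by apply/funext => x; rewrite exprS mulrA.
Qed.

Lemma sum_dom_wgt_sq (f : nat -> R -> R) M n :
  (forall j, exists C, forall x, `|f j x| <= C * wgt_sq x ^+ M) ->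
  exists C, forall x, `|\sum_(0 <= j < n) f j x| <= C * wgt_sq x ^+ M.
Proof.
move=> fC; elim: n => [|n [C hC]].
  by exists 0 => x; rewrite big_geq// normr0 mul0r.
have [D hD] := fC n; exists (C + D) => x.
by rewrite big_nat_recr//= (le_trans (ler_normD _ _))// mulrDl lerD.
Qed.

Lemma iter_line_cos0 F n : iter (2 * n) (line_cos 0) F = iter n plane_int F.
Proof. by elim: n => // n IH; rewrite mulnS /= IH. Qed.

Lemma wgt_natE n : wgt (n%:R : R) = wgt_sq (Num.sqrt n%:R).
Proof. by rewrite /wgt_sq sqr_sqrtr. Qed.

(** At the radii sqrt n with n >= 1 the power r ^ (2 m + 1) in
    [radial_ft_expansion] is at least 1, so the decay of chi and its
    derivatives suffices. *)
Lemma radial_ft_decay u F m M : rschwartz u -> rapid F ->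
  (forall t, sin_tr u t = t * radial_ft F 1 t) ->
  exists C, forall n : nat, `|radial_ft F m.+1 (Num.sqrt n%:R)| <= C * wgt (n%:R : R) ^+ M.
Proof.
move=> ru rF chiE.
have [C hC] : exists C, forall x,
    `|\sum_(0 <= j < m.+1) beta_odd m j * x ^+ j * derive1n j (sin_tr u) x| <= C * wgt_sq x ^+ M.
  apply: sum_dom_wgt_sq => j.
  have h : rschwartz (fun x => beta_odd m j * (x ^+ j * derive1n j (sin_tr u) x)).
    by apply/rschwartz_ZM/rschwartz_XM/rschwartz_derive1n/rschwartz_sin_tr.
  by have [C hC] := rschwartz_dom M h; exists C => x; rewrite -mulrA.
exists (Num.max C `|radial_ft F m.+1 0|) => -[|n].
  by rewrite sqrtr0 /wgt addr0 invr1 expr1n mulr1 le_max lexx orbT.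
set r := Num.sqrt _; have r1 : 1 <= r by rewrite -[1]sqrtr1 ler_sqrt ?ler1n.
apply: (@le_trans _ _ (C * wgt n.+1%:R ^+ M)); last first.
  by rewrite ler_wpM2r ?wgtX_ge0// le_max lexx.
rewrite wgt_natE; apply: le_trans (hC r).
rewrite (radial_ft_expansion m r rF (sin_tr_smooth ru) chiE) normrM ler_peMl//.
by rewrite ger0_norm ?exprn_ege1// exprn_ge0// (le_trans _ r1).
Qed.

Lemma cvg_sum_from1 (a : nat -> R) l : series a @ \oo --> l ->
  (fun N => \sum_(1 <= n < N) a n) @ \oo --> l - a 0%N.
Proof.
move=> al; rewrite -cvg_shiftS.
rewrite (_ : [sequence _]_n = (fun N => series a N.+1 - a 0%N)); last first.
  by apply/funext => N; rewrite /series /= (big_ltn (ltn0Sn N)) addrAC subrr add0r.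
apply: cvgB; last exact: cvg_cst.
by rewrite (cvg_shiftS (series a)).
Qed.

(** Both sides are limits of box sums that differ by O (N ^ (- 1 / 2)). *)
Lemma lattice_summation F k C1 C2 : rapid F ->
  (forall n : nat, `|F n%:R| <= C1 * wgt (n%:R : R) ^+ k.+2) ->
  (forall n : nat, `|line_cos (Num.sqrt n%:R) (iter k (line_cos 0) F) 0| <= C2 * wgt (n%:R :
    R) ^+ k.+2) ->
  limn (series (fun n => (r_ k.+1 n)%:R * F n%:R)) =
  limn (series (fun n => (r_ k.+1 n)%:R * line_cos (Num.sqrt n%:R) (iter k (line_cos 0) F) 0)).
Proof.
move=> rF h1 h2; have [K hK] := iter_fejer_op_lattice_op k.+1 0 rF.
have c1 := cvg_box_sum h1; have c2 := cvg_box_sum_fejer h2.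
apply: (cvg_unique _ c1); first exact: norm_hausdorff.
move: c2; set L := limn _ => c2; change (box_sum N (fun=> 1) k.+1 (fun n => F n%:R) @[N -->
  \oo] --> L).
rewrite (_ : (fun N => _) = (fun N =>
  box_sum N (fejer_wgt N) k.+1 (fun n => line_cos (Num.sqrt n%:R) (iter k (line_cos 0) F) 0) -
  (iter k.+1 (fejer_op N) F 0 - iter k.+1 (lattice_op N) F 0))); last first.
  apply/funext => N; rewrite -(iter_fejer_op_box N k rF (lexx 0)) subKr iter_lattice_op_box.
  by apply: eq_box_sum => n; rewrite add0r.
rewrite -[X in _ --> X]subr0; apply: cvgB; first exact: c2.
apply/norm_cvg0P.
apply: (@squeeze_cvgr _ _ _ _ (cst 0) (fun N => K * (Num.sqrt N%:R)^-1)).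
- near=> N; rewrite normr_ge0 /=.
  have N0 : (0 < N)%N by near: N; exact: nbhs_infty_gt.
  by have := hK N 0 N0 (lexx 0); rewrite expr0 mulr1.
- exact: cvg_cst.
rewrite -[X in _ --> X](mulr0 K); apply: cvgM; first exact: cvg_cst.
rewrite (_ : (fun N => _) = (fun N => Num.sqrt (N%:R^-1 : R))).
  rewrite -sqrtr0; apply: continuous_cvg; first exact: sqrt_continuous.
  by rewrite -(cvg_shiftS (fun n => n%:R^-1 : R)); exact: cvg_harmonic.
by apply/funext => N; rewrite sqrtrV.
Unshelve. all: by end_near. Qed.

Lemma alpha_cancel (D p e : R) m : D != 0 -> p != 0 ->
  (-1) ^+ m / D * (1 / p) ^+ m * (D * (- p) ^+ m * e) = e.
Proof.
move=> D0 p0.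
have h : (1 / p) ^+ m * (- p) ^+ m = (-1) ^+ m.
  by rewrite -exprMn mul1r mulrN mulVf.
move: ((1 / p) ^+ m) ((- p) ^+ m) h => x y h.
rewrite [LHS](_ : _ = D / D * ((-1) ^+ m * (x * y)) * e); last by ring.
by rewrite h divff// mul1r -expr2 sqrr_sign mul1r.
Qed.

Theorem real_summation u m : rschwartz u -> (forall x, u (- x) = - u x) ->
  exists S T : R,
  [/\ (fun N => \sum_(1 <= n < N)
         (r_ (2 * m + 3) n)%:R / Num.sqrt n%:R * u (Num.sqrt n%:R)) @ \oo --> S,
      (fun N => \sum_(1 <= n < N)
         (r_ (2 * m + 3) n)%:R / Num.sqrt n%:R ^+ (2 * m + 1) *
         \sum_(0 <= j < m.+1) beta_odd m j * Num.sqrt n%:R ^+ j * derive1n j (sin_tr u)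
           (Num.sqrt n%:R))
         @ \oo --> T &
      derive1 u 0 + S = (-1) ^+ m / (dfact (2 * m + 1))%:R * (1 / (2 * pi)) ^+ m *
         derive1n (2 * m + 1) (sin_tr u) 0 + T].
Proof.
move=> ru ou; set F := sqrt_quotient u.
have rF : rapid F := sqrt_quotient_rapid ru ou.
have chiE t : sin_tr u t = t * radial_ft F 1 t.
  rewrite -radial_ft1E//; congr (sin_tr _ t); apply/funext => x.
  by rewrite (sqrt_quotientE ou).
(* k + 1 coordinates: one is transformed, the k others are integrated in pairs *)
set k := (2 * m.+1)%N.
have kE : (2 * m + 3 = k.+1)%N by rewrite /k; lia.
have EA n : line_cos (Num.sqrt n%:R) (iter k (line_cos 0) F) 0 = radial_ft F m.+1 (Num.sqrt n%:R).
  by rewrite iter_line_cos0.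
have [C1 h1] : exists C, forall n : nat, `|F n%:R| <= C * wgt (n%:R : R) ^+ k.+2.
  by have [C hC] := rF k.+2; exists C => n; exact: (lip_decay_bound hC).
have [C2 h2] := radial_ft_decay m k.+2 ru rF chiE.
have h2' n : `|line_cos (Num.sqrt n%:R) (iter k (line_cos 0) F) 0| <= C2 * wgt (n%:R : R) ^+ k.+2.
  by rewrite EA.
have L := lattice_summation rF h1 h2'.
have weak (a : nat -> R) C : (forall n, `|a n| <= C * wgt (n%:R : R) ^+ k.+2) ->
    cvgn (series (fun n => (r_ k.+1 n)%:R * a n)).
  move=> aC; apply: (@series_r_cvg _ _ _ C) => n; rewrite (le_trans (aC n))//.
  have C0 : 0 <= C.
    have := le_trans (normr_ge0 _) (aC 0%N).
    by rewrite pmulr_lge0// exprn_gt0// wgt_gt0.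
  by rewrite ler_wpM2l// wgtX_le_exp.
have S1 := cvg_sum_from1 (weak _ _ h1).
have S2 := cvg_sum_from1 (weak _ _ h2').
rewrite L in S1.
move: S1 S2; set l := limn _ => S1 S2; rewrite !r_at0 !mul1r EA sqrtr0 in S1 S2.
exists (l - F 0), (l - radial_ft F m.+1 0); rewrite kE; split.
- rewrite (_ : (fun N => _) = (fun N => \sum_(1 <= n < N) (r_ k.+1 n)%:R * F n%:R))//.
  apply/funext => N; apply: eq_big_nat => n /andP[n0 _].
  by rewrite /F /sqrt_quotient pnatr_eq0 gtn_eqF// mulrAC mulrA.
- rewrite (_ : (fun N => _) = (fun N => \sum_(1 <= n < N) (r_ k.+1 n)%:R *
    line_cos (Num.sqrt n%:R) (iter k (line_cos 0) F) 0))//.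
  apply/funext => N; apply: eq_big_nat => n /andP[n0 _].
  rewrite EA (radial_ft_expansion m _ rF (sin_tr_smooth ru) chiE) mulrA divfK//.
  by rewrite expf_neq0// gt_eqF// sqrtr_gt0 ltr0n.
have -> : F 0 = derive1 u 0 by rewrite /F /sqrt_quotient eqxx.
have -> : derive1n (2 * m + 1) (sin_tr u) 0 =
    (dfact (2 * m + 1))%:R * (- (2 * pi)) ^+ m * radial_ft F m.+1 0.
  have -> : sin_tr u = (fun r => r * radial_ft F 1 r) by apply/funext.
  by rewrite addn1; exact: radial_ft_taylor 1 m rF.
have d0 : (dfact (2 * m + 1))%:R != 0 :> R.
  rewrite pnatr_eq0 addn1 -lt0n.
  by elim: (m) => // p IH; rewrite mulnS /= muln_gt0.
have p0 : 2 * pi != 0 :> R by rewrite mulf_neq0// gt_eqF// pi_gt0.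
rewrite alpha_cancel//; ring.
Qed.
End RealFormula.

(** * Complex-valued functions *)

Local Open Scope complex_scope.

Section Complex.
Context {R : realType}.
Implicit Types (f phi : R -> R[i]) (t x r : R) (n m : nat).
Notation Re := complex.Re.
Notation Im := complex.Im.

Lemma complex_eta (z : R[i]) : z = Re z +i* Im z.
Proof. by case: z. Qed.

Lemma complexM_real (a : R) (z : R[i]) : a%:C * z = (a * Re z) +i* (a * Im z).
Proof. by case: z => x y; simpc. Qed.

Lemma sum_complex (a b : nat -> R) n m :
  \sum_(m <= j < n) (a j +i* b j) = (\sum_(m <= j < n) a j) +i* (\sum_(m <= j < n) b j).
Proof.
rewrite [LHS]complex_eta; congr (_ +i* _).
  by rewrite (big_morph (@Re R) (id1 := 0) (op1 := +%R))// => -[? ?] [? ?].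
by rewrite (big_morph (@Im R) (id1 := 0) (op1 := +%R))// => -[? ?] [? ?].
Qed.

Lemma normc_le (x y : R) : `|x +i* y| <= (`|x| + `|y|)%:C.
Proof.
rewrite normc_def /= lecR -[leRHS]ger0_norm ?addr_ge0// -sqrtr_sqr ler_sqrt ?sqr_ge0//.
rewrite -(real_normK (num_real x)) -(real_normK (num_real y)).
by rewrite sqrrD addrAC lerDl mulrn_wge0// mulr_ge0.
Qed.

Lemma has_sum_componentwise (a b : nat -> R) (s t : R) :
  (fun N => \sum_(1 <= n < N) a n) @ \oo --> s ->
  (fun N => \sum_(1 <= n < N) b n) @ \oo --> t ->
  has_sum_from1 (fun n => a n +i* b n) (s +i* t).
Proof.
move=> /cvgrPdist_lt ha /cvgrPdist_lt hb; apply/cvgrPdist_lt => e.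
rewrite ltcE /= => /andP[/eqP ei e0].
(* a positive element of the complex numbers is a positive real *)
have e2 : 0 < Re e / 2 by rewrite divr_gt0.
have := ha _ e2; have := hb _ e2; apply: filterS2 => N hbN haN.
rewrite sum_complex (_ : _ - _ = (s - \sum_(1 <= n < N) a n) +i* (t - \sum_(1 <= n < N) b n)) //.
apply: (le_lt_trans (normc_le _ _)); rewrite [e]complex_eta ei ltcR.
by rewrite [ltRHS]splitr ltrD.
Qed.

Lemma normr_le_normc (x y : R) : `|x| <= Normc.normc (x +i* y) /\ `|y| <= Normc.normc (x +i* y).
Proof. by rewrite /= -!sqrtr_sqr !ler_sqrt ?addr_ge0 ?sqr_ge0// lerDl lerDr !sqr_ge0. Qed.

Lemma schwartz_rsch f : schwartz f ->
  rschwartz (fun x => Re (f x)) /\ rschwartz (fun x => Im (f x)).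
Proof.
move=> [sf bf]; split; split.
- by move=> n x; have [] := sf n x.
- move=> m n; have [C hC] := bf m n; exists C => x; apply: le_trans (hC x).
  by rewrite ler_wpM2l ?exprn_ge0//; have [] := normr_le_normc
    (derive1n n (fun y => Re (f y)) x) (derive1n n (fun y => Im (f y)) x).
- by move=> n x; have [] := sf n x.
- move=> m n; have [C hC] := bf m n; exists C => x; apply: le_trans (hC x).
  by rewrite ler_wpM2l ?exprn_ge0//; have [] := normr_le_normc
    (derive1n n (fun y => Re (f y)) x) (derive1n n (fun y => Im (f y)) x).
Qed.

Lemma cos_tr_odd_eq0 (u : R -> R) t : rschwartz u -> (forall x, u (- x) = - u x) ->
  cos_tr u t = 0.
Proof.
move=> ru ou; have cu := rschwartz_cont ru; have [C hC] := rschwartz_dom 1 ru.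
have hC1 x : `|u x| <= C * wgt_sq x by have := hC x; rewrite expr1.
apply: (@Rintegral_odd _ _ C) => [|x|x].
- by have [] := trig_cont t cu.
- by rewrite ou mulrN cosN mulNr.
- rewrite normrM (le_trans _ (hC1 x))// ler_piMr//.
  by rewrite ler_norml cos_geN1 cos_le1.
Qed.

(** Only the products odd times sine survive in the complex exponential. *)
Lemma fourier_odd phi t : schwartz phi -> (forall x, phi (- x) = - phi x) ->
  fourier phi t = sin_tr (fun x => Im (phi x)) t +i* (- sin_tr (fun x => Re (phi x)) t).
Proof.
move=> sphi ophi; have [ru rv] := schwartz_rsch sphi.
set u := (fun x => Re (phi x)) in ru *; set v := (fun x => Im (phi x)) in rv *.
have ou x : u (- x) = - u x by rewrite /u ophi; case: (phi x).
have ov x : v (- x) = - v x by rewrite /v ophi; case: (phi x).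
have [C hC] := rschwartz_dom 1 ru; have [D hD] := rschwartz_dom 1 rv.
have hC1 x : `|u x| <= C * wgt_sq x by have := hC x; rewrite expr1.
have hD1 x : `|v x| <= D * wgt_sq x by have := hD x; rewrite expr1.
have [uc us] := trig_integrable t (rschwartz_cont ru) hC1.
have [vc vs] := trig_integrable t (rschwartz_cont rv) hD1.
rewrite /fourier; congr (_ +i* _).
  rewrite -[RHS]add0r -(cos_tr_odd_eq0 t ru ou) /cos_tr /sin_tr -RintegralD//.
  apply: eq_Rintegral => x _; rewrite /u /v; case: (phi x) => a b /=.
  by rewrite cosN sinN mulrN opprK.
rewrite -[RHS]add0r -(cos_tr_odd_eq0 t rv ov) /cos_tr /sin_tr -RintegralB//.
apply: eq_Rintegral => x _; rewrite /u /v; case: (phi x) => a b /=.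
by rewrite cosN sinN mulrN addrC.
Qed.

Lemma cderiven_fourier phi n r : schwartz phi -> (forall x, phi (- x) = - phi x) ->
  cderiven n (fourier phi) r =
  derive1n n (sin_tr (fun x => Im (phi x))) r +i* (- derive1n n (sin_tr (fun x => Re (phi x))) r).
Proof.
move=> sphi ophi; have [ru rv] := schwartz_rsch sphi.
have -> : fourier phi = (fun t =>
    sin_tr (fun x => Im (phi x)) t +i* (- sin_tr (fun x => Re (phi x)) t)).
  by apply/funext => t; exact: fourier_odd.
rewrite /cderiven; congr (_ +i* _).
rewrite /= -[RHS]mulN1r.
have -> : (fun y => - sin_tr (fun x => Re (phi x)) y) =
  (fun y => -1 * sin_tr (fun x => Re (phi x)) y).
  by apply/funext => y; rewrite mulN1r.
by rewrite (derive1n_ZM (-1) n (sin_tr_smooth ru)).2.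
Qed.

Lemma powR_half (x : R) n : 0 <= x -> x `^ (n%:R / 2) = Num.sqrt x ^+ n.
Proof. by move=> x0; rewrite mulrC powRrM powR12_sqrt// powR_mulrn// sqrtr_ge0. Qed.
End Complex.

Theorem theorem2p2 (R : realType) (phi : R -> R[i]) (k : nat) :
  schwartz phi ->
  (forall x : R, phi (- x) = - phi x) ->
  odd k -> (3 <= k)%N ->
  let psi := fourier phi in
  exists S T : R[i],
    [/\ has_sum_from1 (fun n : nat =>
          ((r_ k n)%:R / Num.sqrt n%:R)%:C * phi (Num.sqrt n%:R)) S,
        has_sum_from1 (fun n : nat =>
          ((r_ k n)%:R / (n%:R `^ ((k - 2)%:R / 2)))%:C *
          \sum_(0 <= j < ((k - 3) %/ 2).+1)
            (beta R j k * n%:R `^ (j%:R / 2))%:C *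
            cderiven j psi (Num.sqrt n%:R)) T &
        cderiven 1 phi 0 + S
        = 'i%C * (alpha R k)%:C * cderiven (k - 2) psi 0 + 'i%C * T].
Proof.
move=> sphi ophi ok k3 psi; have [ru rv] := schwartz_rsch sphi.
pose m := ((k - 3) %/ 2)%N.
have kE : k = (2 * m + 3)%N by rewrite /m; lia.
have k2 : (k - 2 = 2 * m + 1)%N by lia.
set u := (fun x => complex.Re (phi x)) in ru; set v := (fun x => complex.Im (phi x)) in rv.
have ou x : u (- x) = - u x by rewrite /u ophi; case: (phi x).
have ov x : v (- x) = - v x by rewrite /v ophi; case: (phi x).
have [Su [Tu [hSu hTu eu]]] := real_summation m ru ou.
have [Sv [Tv [hSv hTv ev]]] := real_summation m rv ov.
rewrite -!kE -?k2 in hSu hTu hSv hTv eu ev.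
exists (Su +i* Sv), (Tv +i* (- Tu)); split.
- rewrite (_ : (fun n : nat => _) = (fun n => ((r_ k n)%:R / Num.sqrt n%:R * u (Num.sqrt n%:R))
    +i* ((r_ k n)%:R / Num.sqrt n%:R * v (Num.sqrt n%:R)))); last first.
    by apply/funext => n; rewrite complexM_real.
  exact: has_sum_componentwise.
- pose U (u : R -> R) n : R := (r_ k n)%:R / Num.sqrt n%:R ^+ (k - 2) *
         \sum_(0 <= j < m.+1) beta_odd m j * Num.sqrt n%:R ^+ j * derive1n j (sin_tr u)
           (Num.sqrt n%:R).
  rewrite (_ : (fun n : nat => _) = (fun n => U v n +i* (- U u n))); last first.
    apply/funext => n; rewrite powR_half//.
    have -> : \sum_(0 <= j < ((k - 3) %/ 2).+1) (beta R j k * n%:R `^ (j%:R / 2))%:C *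
            cderiven j psi (Num.sqrt n%:R) =
      \sum_(0 <= j < m.+1) ((beta_odd m j * Num.sqrt n%:R ^+ j * derive1n j (sin_tr v)
        (Num.sqrt n%:R))
       +i* (- (beta_odd m j * Num.sqrt n%:R ^+ j * derive1n j (sin_tr u) (Num.sqrt n%:R)))).
      apply: eq_big_nat => j /andP[_ jm].
      rewrite cderiven_fourier// complexM_real /= powR_half// mulrN.
      by rewrite kE beta_oddE// -ltnS.
    by rewrite sum_complex complexM_real /= sumrN mulrN.
  apply: has_sum_componentwise; first exact: hTv.
  under eq_fun do rewrite sumrN; exact: cvgN.
rewrite cderiven_fourier// /cderiven /=.
rewrite -[derive1 (fun y => complex.Re (phi y)) 0]/(derive1 u 0).
rewrite -[derive1 (fun y => complex.Im (phi y)) 0]/(derive1 v 0).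
rewrite -/u -/v /alpha -/m.
move: eu ev; set a := _ * _ ^+ m.
move: (derive1 u 0) (derive1 v 0) (derive1n _ (sin_tr u) 0) (derive1n _ (sin_tr v) 0) => du dv
  cu cv eu ev.
by simpc; rewrite eu ev.
Qed.
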